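(* Let $f\in C^2(\mathbb{R}^d,\mathbb{R})$ and assume: (A1) there is $L\ge0$ with $\|\nabla f(x)-\nabla f(y)\|\le L\|x-y\|$ for all $x,y\in\mathbb{R}^d$; (A2a) there are a Polish probability space $(\mathsf Z,\mathcal Z,\pi^Z)$, $\eta\ge0$ and $H:\mathbb{R}^d\times\mathsf Z\to\mathbb{R}^d$ such that for all $x$, $\int H(x,z)d\pi^Z(z)=\nabla f(x)$ and $\int\|H(x,z)-\nabla f(x)\|^2d\pi^Z(z)\le\eta$; (A3) with $\Sigma(x)=\int(H(x,z)-\nabla f(x))(H(x,z)-\nabla f(x))^\top d\pi^Z(z)$, there is $\mathtt M\ge0$ with $\|\Sigma(x)^{1/2}-\Sigma(y)^{1/2}\|\le\mathtt M\|x-y\|$ for all $x,y$; (F3) there exist $x^\star\in\arg\min_{\mathbb{R}^d}f\neq\emptyset$, $r_1\in(0,2)$, $r_2\ge0$, $\tau>0$ such that for all $x\in\mathbb{R}^d$, $\|\nabla f(x)\|^{r_1}\|x-x^\star\|^{r_2}\ge\tau(f(x)-f(x^\star))$. Let $\alpha,\gamma\in(0,1)$, $\gamma_\alpha=\gamma^{1/(1-\alpha)}$, and let $(\mathbf X_t)_{t\ge0}$ be the strong solution started from $\mathbf X_0\in\mathbb{R}^d$ of $$d\mathbf X_t=-(\gamma_\alpha+t)^{-\alpha}\{\nabla f(\mathbf X_t)dt+\gamma_\alpha^{1/2}\Sigma(\mathbf X_t)^{1/2}d\mathbf B_t\}.$$ Let $r_3=(1-r_1/2)^{-1}$ and assume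 that there exist $\beta,\varepsilon\ge0$ and $C_{\beta,\varepsilon}\ge0$ such that for any $t\ge0$, $$\mathbb{E}[\|\mathbf X_t-x^\star\|^{r_2r_3}]\le C_{\beta,\varepsilon}(\gamma_\alpha+t)^\beta(1+\log(1+\gamma_\alpha^{-1}t))^\varepsilon .$$ Then there exists $C\ge0$ such that for any $T\ge1$, $$\mathbb{E}[f(\mathbf X_T)]-\min_{\mathbb{R}^d}f\le C\,T^{-\delta}\,[1+\log(1+\gamma_\alpha^{-1}T)]^{\varepsilon},$$ where $\delta=\delta_1\wedge\delta_2$ with $\delta_1=\frac{r_1}{2}\big(1-\frac{r_1}{2}\big)^{-1}(1-\alpha)-\beta$ and $\delta_2=\frac{r_1}{2}\alpha-\beta\big(1-\frac{r_1}{2}\big)$.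
   Context: $(\mathbf B_t)_{t\ge0}$ is a $d$-dimensional Brownian motion. $\Sigma(x)^{1/2}$ is the symmetric positive semi-definite square root. $a\wedge b=\min(a,b)$; $0^0=1$. All functions are assumed measurable. Under (A1) and (A3) the SDE has a unique strong solution. *)

(* Defs.v *)
From mathcomp Require Import all_boot all_order all_algebra.
From mathcomp Require Import all_classical all_reals all_analysis.

Set Implicit Arguments.
Unset Strict Implicit.
Unset Printing Implicit Defensive.

Import Order.TTheory GRing.Theory Num.Theory numFieldNormedType.Exports.
Local Open Scope classical_set_scope.
Local Open Scope ring_scope.

(* Vectors of R^d are columns ['cV[R]_d]. *)

Section EuclideanCalculus.
Context {R : realType}.

(* The library norm on matrices is the sup norm; [enorm] is the Euclidean norm
   on column vectors and the Frobenius norm on square matrices. *)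
Definition enorm m n (A : 'M[R]_(m, n)) : R :=
  Num.sqrt (\sum_i \sum_j A i j ^+ 2).

Context {d : nat}.
Implicit Types f : 'cV[R]_d -> R.

Definition partial f (i : 'I_d) : 'cV[R]_d -> R :=
  fun x => 'D_(delta_mx i ord0) f x.

Definition grad f (x : 'cV[R]_d) : 'cV[R]_d := \col_i partial f i x.

Definition C1 f : Prop :=
  forall i, (forall x, derivable f x (delta_mx i ord0)) /\
            continuous (partial f i).

Definition C2 f : Prop := C1 f /\ forall i, C1 (partial f i).

Definition is_psd_sqrt (A S : 'M[R]_d) : Prop :=
  [/\ S^T = S, forall v : 'cV[R]_d, 0 <= (v^T *m S *m v) ord0 ord0
    & S *m S = A].

(* A positive semi-definite [A] has exactly one such square root, which is then
   the value of [psd_sqrt A]; the default 0 is never reached for such an [A]. *)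
Definition psd_sqrt (A : 'M[R]_d) : 'M[R]_d := xget 0 (is_psd_sqrt A).

End EuclideanCalculus.

Definition borel (T : topologicalType) := g_sigma_algebraType (@open T).

(* The type already carries a complete gauge, so separation and separability
   are what is missing for its topology to be Polish. *)
Definition polish {R : realType} (Z : completePseudoMetricType R) : Prop :=
  hausdorff_space Z /\ exists2 D : set Z, countable D & dense D.

Section NoiseCovariance.
Context {R : realType} {d : nat} {dZ : measure_display} {Z : measurableType dZ}.

Definition noise_cov (piZ : probability Z R) (f : 'cV[R]_d -> R)
    (H : 'cV[R]_d -> Z -> 'cV[R]_d) (x : 'cV[R]_d) : 'M[R]_d :=
  \matrix_(i, j) \int[piZ]_z
    ((H x z - grad f x) *m (H x z - grad f x)^T) i j.

End NoiseCovariance.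

Section StochasticCalculus.
Context {R : realType} {d : nat} {dO : measure_display} {O : measurableType dO}.
Variable P : probability O R.
Implicit Types (B X : R -> O -> 'cV[R]_d) (F : R -> set (set O)).

Definition measurable_wrt (G : set (set O)) m n (Y : O -> 'M[R]_(m, n)) : Prop :=
  forall i j (U : set R), measurable U -> G ((fun w => Y w i j) @^-1` U).

Definition adapted F X : Prop := forall t, 0 <= t -> measurable_wrt (F t) (X t).

Definition continuous_paths X : Prop :=
  {ae P, forall w, {within `[0, +oo[, continuous (fun t => X t w)}}.

Definition past B (t : R) : set (set O) :=
  [set A | exists s i (U : set R), [/\ 0 <= s <= t, measurable U &
             A = (fun w => B s w i ord0) @^-1` U]].

Definition natural_filtration B (t : R) : set (set O) := <<s past B t >>.

Definition augmented_filtration B (t : R) : set (set O) :=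
  <<s past B t `|` [set N | measurable N /\ P N = 0%E] >>.

(* The last clause says both that [B t - B s] has law N(0, (t - s) I_d) (take
   [A] to be the whole space) and that it is independent of the past up to [s];
   [normal_prob] takes the standard deviation. *)
Definition brownian_motion B : Prop :=
  [/\ forall t, 0 <= t -> measurable_wrt measurable (B t),
      {ae P, forall w, B 0 w = 0},
      continuous_paths B
    & forall s t, 0 <= s -> s < t ->
      forall (A : set O) (U : 'I_d -> set R),
        natural_filtration B s A -> (forall i, measurable (U i)) ->
        P (A `&` [set w | forall i, U i (B t w i ord0 - B s w i ord0)]) =
        (P A * \prod_i normal_prob 0 (Num.sqrt (t - s)) (U i))%E].

(* The matrix-valued process equal to [sp_coef k] on ]sp_time k, sp_time k.+1]
   for [k < sp_size], and to 0 elsewhere. *)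
Record simple_process F := SimpleProcess {
  sp_size : nat;
  sp_time : nat -> R;
  sp_coef : nat -> O -> 'M[R]_d;
  sp_time_ge0 : 0 <= sp_time 0;
  sp_time_le : forall k, sp_time k <= sp_time k.+1;
  sp_coef_adapted : forall k, measurable_wrt (F (sp_time k)) (sp_coef k);
  sp_coef_bounded : exists K, forall k w, enorm (sp_coef k w) <= K }.

Definition sp_eval F (phi : simple_process F) (s : R) (w : O) : 'M[R]_d :=
  \sum_(k < sp_size phi)
    (\1_`]sp_time phi k, sp_time phi k.+1] s : R) *: sp_coef phi k w.

Definition sp_integral F (phi : simple_process F) B (t : R) (w : O) : 'cV[R]_d :=
  \sum_(k < sp_size phi) sp_coef phi k w *m
    (B (Num.min (sp_time phi k.+1) t) w - B (Num.min (sp_time phi k) t) w).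

(* [I] is (a version of) the Ito integral of [Phi] against [B] over [0, t]: the
   limit in L^2(P) of the integrals of simple processes that approximate [Phi]
   in L^2(P x dt). *)
Definition ito_integral F B (Phi : R -> O -> 'M[R]_d) (t : R)
    (I : O -> 'cV[R]_d) : Prop :=
  measurable_wrt (F t) I /\
  exists phi : nat -> simple_process F,
    (\int[P]_w \int[lebesgue_measure]_(s in `[0%R, t])
        (enorm (sp_eval (phi n) s w - Phi s w) ^+ 2)%:E)%E
      @[n --> \oo] --> 0%E /\
    (\int[P]_w (enorm (sp_integral (phi n) B t w - I w) ^+ 2)%:E)%E
      @[n --> \oo] --> 0%E.

(* Strong solution, driven by [B], of dX = b(t, X) dt + s(t, X) dB, X_0 = x0.
   The square-integrable Ito integral above is the general one whenever [s] is
   bounded along [X], as for a coefficient [s] with uniformly bounded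
   Frobenius norm. *)
Definition strong_solution B (b : R -> 'cV[R]_d -> 'cV[R]_d)
    (s : R -> 'cV[R]_d -> 'M[R]_d) (x0 : 'cV[R]_d) X : Prop :=
  [/\ adapted (augmented_filtration B) X,
      continuous_paths X
    & forall t, 0 <= t -> exists2 J : O -> 'cV[R]_d,
        ito_integral (augmented_filtration B) B (fun u w => s u (X u w)) t J
      & {ae P, forall w, X t w = x0 +
          \col_i (\int[lebesgue_measure]_(u in `[0, t]) b u (X u w) i ord0) +
          J w}].

End StochasticCalculus.

(* Main.v *)
Require Import Defs.
From mathcomp Require Import all_boot all_order all_algebra.
From mathcomp Require Import all_classical all_reals all_analysis.
From mathcomp Require Import measurable_realfun normal_distribution charge ring lra.

Import Order.TTheory GRing.Theory Num.Theory numFieldNormedType.Exports.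
Local Open Scope classical_set_scope.
Local Open Scope ring_scope.

(** The proof is a Lyapunov argument on the expected gap
    [v t = E (f (X t)) - f xs]. Write [a t] for the learning rate
    [(gammaa + t) `^ (- alpha)].

    Formally, the derivative of [v] is at most
    [- a t * E |grad f (X t)|^2 + C * (a t)^2]: the drift dissipates, and the noise,
    whose covariance has trace at most [eta], brings in an energy of the order of
    the square of the learning rate. Instead of Ito's formula, a weaker version
    of this balance is derived from the increments of the solution. Over a short
    interval [[s, t]], the descent inequality of a function with Lipschitz
    gradient ([descent]) bounds [f (X t) - f (X s)] by a linear and a quadratic
    term in [X t - X s]. The increment is the sum of a drift, close to
    [- (t - s) * a s * grad f (X s)], and of an increment of a stochastic
    integral, of which only two properties matter: its second moment is
    [O ((a s)^2 * (t - s))] and it is orthogonal to the square integrable random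
    variables known at time [s]. Both are proved for simple processes
    ([elem_isometry], [elem_orthogonal]) and survive the passage to the limit
    that defines the integral ([ito_increment]). The outcome is [flow_right]:
    [v t <= v s - (t - s) * a t / 2 * E |grad f (X s)|^2 + C * (a s)^2 * (t - s)]
    up to [O ((t - s)^2)].

    The hypothesis [F3] converts a gap into a gradient. With [p = 2 / r1], whose
    conjugate exponent is [r3], Young's inequality with a free weight [l > 0]
    ([weighted_young]) and the assumed bound on the moment of order [r2 * r3]
    give
    [tau * v s <= l^p / p * E |grad f (X s)|^2 + l^(-r3) / r3 * moment s].
    If [v s] is of the size of the barrier
    [K * (gammaa + s)^(-delta) * (1 + log (1 + s / gammaa))^eps], the weight can be
    chosen so that the moment accounts for at most half of the left-hand side,
    and the gradient must be large: its second moment is at least a multiple of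
    [K^p] times an explicit power of [gammaa + s]. Comparing powers, it exceeds
    the noise because [delta <= delta2], and the slope of the barrier because
    [delta <= delta1]. Since [p > 1], for [K] large enough [v] is pushed below
    the barrier each time it touches it, hence never crosses it
    ([rate_below_barrier]). The argument uses real induction on time rather than
    a derivative of [v], because only one-sided bounds on the increments of [v]
    are at hand ([flow_right], [flow_left]).

    The paths of the solution are continuous only almost surely and on
    nonnegative times; the estimates are carried out for an indistinguishable
    process all of whose paths are continuous ([continuous_modification]), so
    that time integrals along the paths are ordinary integrals of continuous
    functions. *)

(** * Measurability by discretization *)

Section Measurability.
Import HBNNSimple.
Context {R : realType}.

(** The integrands need not be measurable: this is what the double integrals in
    the definition of the stochastic integral call for, where a process is
    changed on a null set before any joint measurability is known. Each simple
    function below [f] is cut off to the complement of [N], which keeps its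
    integral and puts it below [g]. *)
Lemma le_integral_off_null {d} {T : measurableType d}
    (mu : {measure set T -> \bar R}) (N : set T) (f g : T -> \bar R) :
  measurable N -> mu N = 0%E ->
  (forall x, (0 <= f x)%E) -> (forall x, (0 <= g x)%E) ->
  (forall x, ~ N x -> (f x <= g x)%E) ->
  (\int[mu]_x f x <= \int[mu]_x g x)%E.
Proof.
move=> mN N0 f0 g0 fg.
rewrite ge0_integralTE// ge0_integralTE//.
apply: ge_ereal_sup => _ [h hf <-].
have mNC : measurable (~` N) by exact: measurableC.
pose h' := mul_nnsfun h (indic_nnsfun R mNC).
have h'E x : h' x = h x * \1_(~` N) x by [].
rewrite -integralT_nnsfun.
have -> : (\int[mu]_x (h x)%:E = \int[mu]_x (h' x)%:E)%E.
  apply: ge0_ae_eq_integral => //.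
  - by apply/measurable_EFinP; exact: measurable_funPT.
  - by apply/measurable_EFinP; exact: measurable_funPT.
  - by move=> x _; rewrite lee_fin; exact: fun_ge0.
  - by move=> x _; rewrite lee_fin; exact: fun_ge0.
  - exists N; split => // x /= hx; apply: contrapT => Nx; apply: hx => _.
    by rewrite -[RHS]/((h x * \1_(~` N) x)%:E) indicE mem_set// mulr1.
rewrite integralT_nnsfun; apply: ereal_sup_ubound; exists h' => // x.
have [Nx|Nx] := pselect (N x).
  by rewrite h'E indicE memNset ?mulr0//=; apply; exact: Nx.
by rewrite h'E indicE mem_set// mulr1 (le_trans (hf x))// fg.
Qed.

Lemma measurable_countable_case {d} {T : measurableType d} (C : countType)
    (c : T -> C) (F : C -> T -> R) :
  (forall k, measurable (c @^-1` [set k])) ->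
  (forall k, measurable_fun setT (F k)) ->
  measurable_fun setT (fun x => F (c x) x).
Proof.
move=> mc mF _ U mU; rewrite setTI.
have -> : (fun x => F (c x) x) @^-1` U =
    \bigcup_k (c @^-1` [set k] `&` (F k @^-1` U)).
  apply/seteqP; split => [x Ux|x [k _ [/= <-//]]].
  by exists (c x).
apply: countable_bigcupT_measurable => [|k]; first exact: countableP.
by apply: measurableI => //; rewrite -[X in measurable X]setTI; exact: mF.
Qed.

Definition grid (n : nat) (x : R) : int := Num.floor (n.+1%:R * x).

Lemma measurable_grid {d} {T : measurableType d} n (g : T -> R) (k : int) :
  measurable_fun setT g -> measurable ((fun x => grid n (g x)) @^-1` [set k]).
Proof.
move=> mg.
have -> : (fun x => grid n (g x)) @^-1` [set k] =
    setT `&` g @^-1` `[k%:~R / n.+1%:R, (k + 1)%:~R / n.+1%:R[%classic.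
  apply/seteqP; split => x /=.
    rewrite /grid => <-; split => //=; rewrite in_itv/= ler_pdivrMr// ltr_pdivlMr//.
    by rewrite ![g x * _]mulrC ge_floor//= floorD1_gt.
  move=> [_]; rewrite /= in_itv/= ler_pdivrMr// ltr_pdivlMr// => /andP[h1 h2].
  by apply: floor_def; rewrite ![_ * g x]mulrC h1.
exact: mg.
Qed.

Lemma cvg_grid (x : R) : ((grid n x)%:~R / n.+1%:R) @[n --> \oo] --> x.
Proof.
apply/cvgrPdist_le => e e0; near=> n.
have n0 : 0 < n.+1%:R :> R by [].
have h1 : (grid n x)%:~R <= n.+1%:R * x by rewrite ge_floor.
have h2 : n.+1%:R * x < (grid n x)%:~R + 1.
  by have := floorD1_gt (n.+1%:R * x); rewrite intrD.
rewrite ger0_norm; last by rewrite subr_ge0 ler_pdivrMr// mulrC.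
rewrite -(ler_pM2l n0).
have -> : n.+1%:R * (x - (grid n x)%:~R / n.+1%:R) =
    n.+1%:R * x - (grid n x)%:~R by field; rewrite gt_eqF.
apply: (@le_trans _ _ 1); first by lra.
have : e^-1 <= n.+1%:R.
  near: n; exists `|Num.ceil e^-1|%N => // n /= hn.
  apply: le_trans (_ : n%:R <= _); last by rewrite ler_nat.
  have h := ceil_ge e^-1; apply: le_trans h _.
  rewrite -[n%:R]/(n%:~R) ler_int; apply: le_trans (ler_norm _) _.
  by rewrite -abszE lez_nat.
by rewrite -(ler_pM2r e0) mulVf ?gt_eqF.
Unshelve. all: end_near. Qed.

(** Rounding the time down to a grid turns a process into a function that takes
    countably many measurable pieces, and path continuity lets the mesh go to
    zero. *)
Lemma measurable_continuous_process {d} {T : measurableType d} (X : R -> T -> R) :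
  (forall t, measurable_fun setT (X t)) ->
  (forall w, continuous (fun t => X t w)) ->
  measurable_fun setT (fun p : R * T => X p.1 p.2).
Proof.
move=> mX cX.
apply: (@measurable_fun_cvg _ _ _ _
  (fun n (p : R * T) => X ((grid n p.1)%:~R / n.+1%:R) p.2)).
  move=> n; apply: (@measurable_countable_case _ _ _ (fun p : R * T => grid n p.1)
    (fun k p => X (k%:~R / n.+1%:R) p.2)) => k.
    exact: (@measurable_grid _ _ n fst).
  by apply: (measurableT_comp (mX _)); exact: measurable_snd.
move=> [t w] _ /=; exact: (@cvg_comp _ _ _ _ (fun t => X t w) _ _ _ (cvg_grid t) (cX w t)).
Qed.

Lemma cvg_mx {d : nat} (F : nat -> 'cV[R]_d) (l : 'cV[R]_d) :
  (forall i, F n i ord0 @[n --> \oo] --> l i ord0) -> F n @[n --> \oo] --> l.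
Proof.
move=> h; apply/cvgrPdist_lt => e e0.
have : \forall n \near \oo, forall i : 'I_d, `|l i ord0 - F n i ord0| < e.
  by apply: filter_forall => i; have /cvgrPdist_lt := h i; apply.
apply: filterS => n hn.
rewrite /Num.norm/= mx_normrE; apply/bigmax_ltP; split => // -[i j] _ /=.
by rewrite !mxE ord1.
Qed.

(** Rounding each coordinate to a grid gives a vector with countably many values,
    so that no discussion of the Borel sets of vectors is needed. *)
Lemma measurable_continuous_comp {d} {T : measurableType d} {n : nat}
    (g : 'cV[R]_n -> R) (Y : T -> 'cV[R]_n) :
  continuous g -> (forall i, measurable_fun setT (fun w => Y w i ord0)) ->
  measurable_fun setT (g \o Y).
Proof.
move=> cg mY.
apply: (@measurable_fun_cvg _ _ _ _ (fun m w =>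
   g (\col_i ((grid m (Y w i ord0))%:~R / m.+1%:R)))).
  move=> m.
  pose c w := [ffun i => grid m (Y w i ord0)] : {ffun 'I_n -> int}.
  pose F (k : {ffun 'I_n -> int}) (w : T) := g (\col_i ((k i)%:~R / m.+1%:R)).
  rewrite (_ : (fun w => _) = fun w => F (c w) w); last first.
    apply/funext => w; congr g; apply/matrixP => i j.
    by rewrite !mxE ffunE.
  apply: measurable_countable_case => [k|k]; last exact: measurable_cst.
  rewrite (_ : _ @^-1` _ =
    \bigcap_i (fun w => grid m (Y w i ord0)) @^-1` [set k i]).
    by apply: fin_bigcap_measurable => // i _; exact: measurable_grid.
  apply/seteqP; split => [w /= <- i _|w /= h].
    by rewrite /= ffunE.
  by apply/ffunP => i; rewrite ffunE; exact: h.
move=> w _ /=; apply: (@cvg_comp _ _ _ _ g _ _ _ _ (cg (Y w))).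
apply: cvg_mx => i; under eq_fun do rewrite mxE; exact: cvg_grid.
Qed.
End Measurability.

(** * Expectations and square integrable random variables *)

Section Expectations.
Context {R : realType} {d} {T : measurableType d} (P : probability T R).
Implicit Types f g : T -> R.

Definition L1 f : Prop := P.-integrable setT (EFin \o f).
Definition Ex f : R := \int[P]_w f w.
Definition L2 f : Prop := measurable_fun setT f /\ L1 (fun w => f w ^+ 2).

Lemma L1_measurable f : L1 f -> measurable_fun setT f.
Proof. by move=> /integrableP[/measurable_EFinP]. Qed.

Lemma EFin_Ex f : L1 f -> (Ex f)%:E = (\int[P]_w (f w)%:E)%E.
Proof. by move=> h; rewrite fineK//; exact: integrable_fin_num. Qed.

Lemma L1_cst c : L1 (cst c).
Proof. exact: finite_measure_integrable_cst. Qed.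

Lemma Ex_cst c : Ex (cst c) = c.
Proof.
rewrite /Ex Rintegral_cst// (_ : fine _ = 1) ?mulr1//.
by have h := probability_setT P; rewrite (congr1 fine h).
Qed.

Lemma L1D f g : L1 f -> L1 g -> L1 (fun w => f w + g w).
Proof. exact: integrableD. Qed.

Lemma ExD f g : L1 f -> L1 g -> Ex (fun w => f w + g w) = Ex f + Ex g.
Proof. by move=> hf hg; rewrite /Ex RintegralD. Qed.

Lemma L1Z c f : L1 f -> L1 (fun w => c * f w).
Proof. by move=> hf; have := integrableZl measurableT c hf. Qed.

Lemma ExZ c f : L1 f -> Ex (fun w => c * f w) = c * Ex f.
Proof. by move=> hf; rewrite /Ex RintegralZl. Qed.

Lemma L1B f g : L1 f -> L1 g -> L1 (fun w => f w - g w).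
Proof. exact: integrableB. Qed.

Lemma ExB f g : L1 f -> L1 g -> Ex (fun w => f w - g w) = Ex f - Ex g.
Proof. by move=> hf hg; rewrite /Ex RintegralB. Qed.

Lemma L1_sum (I : Type) (s : seq I) (F : I -> T -> R) :
  (forall i, L1 (F i)) -> L1 (fun w => \sum_(i <- s) F i w).
Proof.
move=> hF; elim: s => [|i s IH].
  by under eq_fun do rewrite big_nil; exact: L1_cst.
by under eq_fun do rewrite big_cons; exact: L1D.
Qed.

Lemma Ex_sum (I : Type) (s : seq I) (F : I -> T -> R) :
  (forall i, L1 (F i)) ->
  Ex (fun w => \sum_(i <- s) F i w) = \sum_(i <- s) Ex (F i).
Proof.
move=> hF; elim: s => [|i s IH].
  by under eq_fun do rewrite big_nil; rewrite big_nil; exact: Ex_cst.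
under eq_fun do rewrite big_cons.
by rewrite ExD// ?IH ?big_cons//; exact: L1_sum.
Qed.

Lemma L1_le f g : measurable_fun setT f -> L1 g ->
  (forall w, `|f w| <= g w) -> L1 f.
Proof.
move=> mf hg fg; apply: (le_integrable _ _ _ hg) => //.
  exact/measurable_EFinP.
by move=> w _; rewrite /= lee_fin (le_trans (fg w))// ler_norm.
Qed.

Lemma L1_norm f : L1 f -> L1 (fun w => `|f w|).
Proof. exact: integrable_norm. Qed.

Lemma Ex_le f g : L1 f -> L1 g -> (forall w, f w <= g w) -> Ex f <= Ex g.
Proof. by move=> hf hg fg; apply: le_Rintegral. Qed.

Lemma Ex_ge0 f : (forall w, 0 <= f w) -> 0 <= Ex f.
Proof. by move=> h; apply: Rintegral_ge0. Qed.

Lemma Ex_norm f : L1 f -> `|Ex f| <= Ex (fun w => `|f w|).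
Proof. by move=> h; apply: le_normr_Rintegral. Qed.

(** Nonnegative expectations are often bounded in [\bar R] before integrability
    is known; this turns such a bound into one on [Ex]. *)
Lemma L1_of_le f (c : R) : measurable_fun setT f -> (forall w, 0 <= f w) ->
  (\int[P]_w (f w)%:E <= c%:E)%E -> L1 f /\ Ex f <= c.
Proof.
move=> mf f0 fc.
have h : L1 f.
  apply/integrableP; split; first exact/measurable_EFinP.
  under eq_integral do rewrite /= ger0_norm//.
  by apply: le_lt_trans fc _; rewrite ltry.
by split => //; rewrite -lee_fin EFin_Ex.
Qed.

Lemma L1_ae f g : L1 f -> measurable_fun setT g ->
  {ae P, forall w, f w = g w} -> L1 g /\ Ex g = Ex f.
Proof.
move=> hf mg fg; have mf := L1_measurable _ hf.
have fg' : ae_eq P setT (EFin \o f) (EFin \o g).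
  by apply: filterS fg => w /= -> _.
split.
  have /integrableP[_ h] := hf.
  apply/integrableP; split; first exact/measurable_EFinP.
  suff <- : (\int[P]_x `|(EFin \o f) x| = \int[P]_x `|(EFin \o g) x|)%E by [].
  apply: ge0_ae_eq_integral => //.
  - by apply: measurableT_comp => //; exact/measurable_EFinP.
  - by apply: measurableT_comp => //; exact/measurable_EFinP.
  - by apply: filterS fg => w /= -> _.
rewrite /Ex /Rintegral; congr fine; apply: ae_eq_integral => //.
- exact/measurable_EFinP.
- exact/measurable_EFinP.
- by apply: filterS fg => w /= -> _.
Qed.

Lemma L2_sqr f : L2 f -> L1 (fun w => f w ^+ 2). Proof. by case. Qed.

Lemma L2_mul f g : L2 f -> L2 g -> L1 (fun w => f w * g w).
Proof.
move=> [mf hf] [mg hg]; apply: (L1_le _ (fun w => f w ^+ 2 + g w ^+ 2)).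
- exact: measurable_funM.
- exact: L1D.
- move=> w; rewrite normrM -[f w ^+ 2]real_normK ?num_real//.
  rewrite -[g w ^+ 2]real_normK ?num_real//.
  have := normr_ge0 (f w); have := normr_ge0 (g w); nra.
Qed.

Lemma L2_cst c : L2 (cst c).
Proof. by split => //; exact: (L1_cst (c ^+ 2)). Qed.

Lemma L2_L1 f : L2 f -> L1 f.
Proof.
move=> hf; have := L2_mul _ _ hf (L2_cst 1).
by under eq_fun do rewrite mulr1.
Qed.

Lemma L2D f g : L2 f -> L2 g -> L2 (fun w => f w + g w).
Proof.
move=> hf hg; split; first by apply: measurable_funD; [case: hf|case: hg].
under eq_fun do rewrite sqrrD.
apply: L1D; last exact: L2_sqr.
apply: L1D; first exact: L2_sqr.
by under eq_fun do rewrite -mulr_natl; apply: L1Z; exact: L2_mul.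
Qed.

Lemma L2Z c f : L2 f -> L2 (fun w => c * f w).
Proof.
move=> [mf hf]; split; first exact: measurable_funM.
by under eq_fun do rewrite exprMn; exact: L1Z.
Qed.

Lemma L2N f : L2 f -> L2 (fun w => - f w).
Proof. by move=> /(L2Z (-1)); under eq_fun do rewrite mulN1r. Qed.

Lemma L2B f g : L2 f -> L2 g -> L2 (fun w => f w - g w).
Proof. by move=> hf /L2N hg; exact: L2D. Qed.

Lemma L2_sum (I : Type) (s : seq I) (F : I -> T -> R) :
  (forall i, L2 (F i)) -> L2 (fun w => \sum_(i <- s) F i w).
Proof.
move=> hF; elim: s => [|i s IH].
  by under eq_fun do rewrite big_nil; exact: L2_cst.
by under eq_fun do rewrite big_cons; exact: L2D.
Qed.

Lemma L2_bounded_mul (K : R) f g : measurable_fun setT f ->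
  (forall w, `|f w| <= K) -> L2 g -> L2 (fun w => f w * g w).
Proof.
move=> mf fK [mg hg]; split; first exact: measurable_funM.
apply: (L1_le _ (fun w => K ^+ 2 * g w ^+ 2)); last 1 first.
- move=> w; rewrite ger0_norm ?sqr_ge0// exprMn ler_wpM2r ?sqr_ge0//.
  by rewrite -real_normK ?num_real// lerXn2r ?nnegrE// (le_trans _ (fK w)).
- by apply: measurable_funX; exact: measurable_funM.
- exact: L1Z.
Qed.

(** An approximation argument needs no more than this weighted form of the
    Cauchy-Schwarz inequality, whose proof is pointwise. *)
Lemma Ex_mul_le (l : R) f g : 0 < l -> L2 f -> L2 g ->
  `|Ex (fun w => f w * g w)| <=
    l * Ex (fun w => f w ^+ 2) + l^-1 * Ex (fun w => g w ^+ 2).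
Proof.
move=> l0 hf hg; have hfg := L2_mul _ _ hf hg.
apply: le_trans (Ex_norm _ hfg) _.
have hf2 := L2_sqr _ hf; have hg2 := L2_sqr _ hg.
rewrite -!ExZ// -ExD; [|exact: L1Z..].
apply: Ex_le; [exact: L1_norm|by apply: L1D; exact: L1Z|move=> w].
rewrite normrM -[f w ^+ 2]real_normK ?num_real//.
rewrite -[g w ^+ 2]real_normK ?num_real//.
set a := `|f w|; set b := `|g w|.
have a0 : 0 <= a by exact: normr_ge0.
have b0 : 0 <= b by exact: normr_ge0.
have i0 : 0 < l^-1 by rewrite invr_gt0.
have h : 0 <= l * (a - l^-1 * b) ^+ 2 by rewrite mulr_ge0 ?sqr_ge0// ltW.
have E1 : l * (a - l^-1 * b) ^+ 2 = l * a ^+ 2 + l^-1 * b ^+ 2 - 2 * (a * b).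
  by field; rewrite gt_eqF.
have ab : 0 <= a * b by exact: mulr_ge0.
by rewrite E1 in h; lra.
Qed.

(** The law of the pair [(f, g)] agrees with the product of the laws on
    rectangles, hence everywhere; Fubini then splits the expectation. *)
Lemma indep_mul f g : L1 f -> L1 g ->
  (forall U V, measurable U -> measurable V ->
     P (f @^-1` U `&` g @^-1` V) = (P (f @^-1` U) * P (g @^-1` V))%E) ->
  L1 (fun w => f w * g w) /\ Ex (fun w => f w * g w) = Ex f * Ex g.
Proof.
move=> hf hg ind.
have mf := L1_measurable _ hf; have mg := L1_measurable _ hg.
pose F : {mfun T >-> R} := mfun_Sub (mem_set mf).
pose G : {mfun T >-> R} := mfun_Sub (mem_set mg).
have mFG : measurable_fun setT (fun w => (f w, g w)).
  exact: measurable_fun_pair.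
pose FG : {mfun T >-> (R * R)%type} := mfun_Sub (mem_set mFG).
pose p := distribution P F; pose q := distribution P G.
pose pq := distribution P FG.
have pqE X : measurable X -> (p \x q)%E X = pq X.
  apply: product_measure_unique => A B mA mB.
  by rewrite /pq /p /q /distribution /pushforward /= -ind//; congr (P _).
pose h (xy : R * R) := (xy.1 * xy.2)%:E.
have mh : measurable_fun setT h.
  by apply/measurable_EFinP; apply: measurable_funM;
     [exact: measurable_fst|exact: measurable_snd].
have pint : p.-integrable setT EFin.
  by apply: integrable_pushforward => //; rewrite preimage_setT.
have qint : q.-integrable setT EFin.
  by apply: integrable_pushforward => //; rewrite preimage_setT.
have pE : (\int[p]_x x%:E = (Ex f)%:E)%E.
  by rewrite EFin_Ex// integral_pushforward// ?preimage_setT.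
have qE : (\int[q]_x x%:E = (Ex g)%:E)%E.
  by rewrite EFin_Ex// integral_pushforward// ?preimage_setT.
have hint : (p \x q)%E.-integrable setT h.
  apply/integrable12ltyP => //; rewrite /h /=.
  under eq_integral => x _.
    under eq_integral do rewrite normrM EFinM.
    rewrite ge0_integralZl//=; last first.
      by apply/measurable_EFinP; exact: normr_measurable.
    over.
  have /integrableP[_ q1] := qint; have /integrableP[_ p1] := pint.
  rewrite /= ge0_integralZr//=.
  - apply: lte_mul_pinfty => //; first exact: integral_ge0.
    by rewrite ge0_fin_numE//; exact: integral_ge0.
  - by apply/measurable_EFinP; exact: normr_measurable.
  - exact: integral_ge0.
have hint' : pq.-integrable setT h.
  have /integrableP[_ hi] := hint.
  apply/integrableP; split => //.
  rewrite (eq_measure_integral (p \x q)%E)// => A mA _; exact/esym/pqE.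
have i1 : L1 (fun w => f w * g w).
  have /integrableP[_ hi] := hint'.
  apply/integrableP; split; first exact/measurable_EFinP/measurable_funM.
  move: hi; rewrite ge0_integral_distribution//.
  exact: measurableT_comp.
split => //; apply: EFin_inj; rewrite EFin_Ex// EFinM.
rewrite -[LHS](@integral_distribution _ _ _ _ _ _ FG h)//.
rewrite (eq_measure_integral (p \x q)%E); last by move=> A mA _; exact/esym/pqE.
rewrite -integral12_prod_meas1//= /fubini_F /h/=.
under eq_integral => x _.
  under eq_integral do rewrite EFinM.
  by rewrite integralZl//= qE; over.
by rewrite /= integralZr// pE.
Qed.

End Expectations.

(** * Moments of centred normal laws *)

Section NormalMoments.
Context {R : realType}.
Local Notation mu := (@lebesgue_measure R).

Lemma ge0_integral_normal (m s : R) (h : R -> R) :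
  measurable_fun setT h -> (forall x, 0 <= h x) ->
  (\int[normal_prob m s]_x (h x)%:E =
   \int[mu]_x (h x * normal_pdf m s x)%:E)%E.
Proof.
move=> mh h0.
pose nu : {finite_measure set _ -> \bar R} := normal_prob m s.
have dom := @normal_prob_dominates R m s.
have mh' : measurable_fun setT (fun x => (h x)%:E) by exact/measurable_EFinP.
have h0' x : (0 <= (h x)%:E)%E by rewrite lee_fin.
rewrite -(@Radon_Nikodym_SigmaFinite.change_of_variables _ _ _ nu mu dom _ _
  h0' measurableT mh').
apply: ae_eq_integral => //.
- apply: emeasurable_funM => //.
  by apply: measurable_int; exact: Radon_Nikodym_SigmaFinite.f_integrable.
- apply/measurable_EFinP; apply: measurable_funM => //.
  exact: measurable_normal_pdf.
- have : ae_eq mu setT (Radon_Nikodym_SigmaFinite.f nu mu)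
      (fun x => (normal_pdf m s x)%:E).
    apply: integral_ae_eq => //.
    + exact: Radon_Nikodym_SigmaFinite.f_integrable.
    + by apply/measurable_EFinP; exact: measurable_normal_pdf.
    + by move=> E _ mE; rewrite -Radon_Nikodym_SigmaFinite.f_integral.
  by apply: filterS => x /= H _; rewrite H// EFinM.
Qed.

(** The scaling of the density is what makes the variance of a normal law
    proportional to the square of its standard deviation. *)
Lemma normal_pdf_scale (s x : R) : 0 < s ->
  normal_pdf 0 s (s * x) * s = normal_pdf 0 1 x.
Proof.
move=> s0; rewrite !normal_pdfE ?gt_eqF//.
rewrite /normal_peak /normal_fun !subr0 expr1n mul1r -mulrnAr sqrtrM ?sqr_ge0//.
rewrite sqrtr_sqr gtr0_norm// mulrAC.
have s2 : s != 0 by rewrite gt_eqF.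
congr (_ * expR _); first by rewrite invfM mulrAC mulVf// mul1r.
by rewrite exprMn; field.
Qed.

Lemma normal_pdfN (s x : R) : s != 0 -> normal_pdf 0 s (- x) = normal_pdf 0 s x.
Proof. by move=> s0; rewrite !normal_pdfE// /normal_fun !subr0 sqrrN. Qed.

Lemma integral_normal_sqr (s : R) : 0 < s ->
  (\int[normal_prob 0 s]_x (x ^+ 2)%:E =
   (s ^+ 2)%:E * \int[normal_prob 0 1]_x (x ^+ 2)%:E)%E.
Proof.
move=> s0.
have msq : measurable_fun setT (fun x : R => x ^+ 2) by exact: exprn_measurable.
rewrite !ge0_integral_normal//; try by move=> x; rewrite sqr_ge0.
have dF (x : R) : is_derive x (1 : R) (fun y : R => s * y) s.
  apply: is_derive_eq. by rewrite /GRing.scale /= mulr1.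
have F'E : derive1 (fun y : R => s * y) = cst s.
  by apply/funext => x; rewrite derive1E derive_val.
have cG : continuous (fun x : R => x ^+ 2 * normal_pdf 0 s x).
  move=> x; apply: cvgM; first exact: exprn_continuous.
  by apply: continuous_normal_pdf; rewrite gt_eqF.
rewrite (@increasing_ge0_integration_by_substitutionT _ (fun y : R => s * y)) //.
- rewrite -ge0_integralZl//=.
  + by rewrite F'E; apply: eq_integral => x _; rewrite -EFinM -(@normal_pdf_scale s x s0)
       -[LHS]/(((s * x) ^+ 2 * normal_pdf 0 s (s * x) * s)%:E); congr EFin; ring.
  + apply/measurable_EFinP; apply: measurable_funM => //.
    exact: measurable_normal_pdf.
  + by move=> x _; rewrite lee_fin mulr_ge0 ?sqr_ge0 ?normal_pdf_ge0.
  + by rewrite lee_fin sqr_ge0.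
- by move=> x y xy; rewrite ltr_pM2l.
- by rewrite F'E => x; exact: cvg_cst.
- by rewrite F'E; exact: is_cvg_cst.
- by rewrite F'E; exact: is_cvg_cst.
- exact: gt0_cvgMrNy.
- exact: gt0_cvgMry.
- by move=> x; rewrite mulr_ge0 ?sqr_ge0 ?normal_pdf_ge0.
Qed.

(** A multiple of the density of variance 2 dominates [x ^+ 2] times the density
    of variance 1, because [x ^+ 2 / 4 <= expR (x ^+ 2 / 4)]. *)
Lemma integral_normal_sqr_lty : (\int[normal_prob 0 1]_x ((x : R) ^+ 2)%:E < +oo)%E.
Proof.
have msq : measurable_fun setT (fun x : R => x ^+ 2) by exact: exprn_measurable.
rewrite ge0_integral_normal//; last by move=> x; rewrite sqr_ge0.
pose s : R := Num.sqrt 2; have s0 : 0 < s by rewrite sqrtr_gt0.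
pose C : R := 4 * normal_peak 1 / normal_peak s.
have p0 : 0 < normal_peak s by rewrite normal_peak_gt0// gt_eqF.
have C0 : 0 <= C by rewrite !mulr_ge0 ?invr_ge0 ?normal_peak_ge0// ltW.
apply: (@le_lt_trans _ _ (\int[mu]_x (C%:E * (normal_pdf 0 s x)%:E))%E).
  apply: ge0_le_integral => //.
  - by move=> x _; rewrite lee_fin mulr_ge0 ?sqr_ge0 ?normal_pdf_ge0.
  - apply/measurable_EFinP; apply: measurable_funM => //.
    exact: measurable_normal_pdf.
  - apply/measurable_EFinP; apply: measurable_funM => //.
    exact: measurable_normal_pdf.
  - move=> x _; rewrite -EFinM lee_fin !normal_pdfE ?gt_eqF//.
    rewrite /normal_fun !subr0 expr1n /s sqr_sqrtr// /C.
    have -> : 4 * normal_peak 1 / normal_peak s * (normal_peak s *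
      expR (- x ^+ 2 / (2 *+ 2))) = normal_peak 1 * (4 * expR (- x ^+ 2 / (2 *+ 2))).
      by field; rewrite gt_eqF.
    rewrite mulrCA ler_wpM2l ?normal_peak_ge0//.
    have -> : - x ^+ 2 / (1 *+ 2) = - x ^+ 2 / (2 *+ 2) - x ^+ 2 / 4 by field.
    rewrite expRD mulrCA [4 * _]mulrC ler_wpM2l ?expR_ge0//.
    have h : x ^+ 2 / 4 <= expR (x ^+ 2 / 4).
      by apply: le_trans (expR_ge1Dx _); rewrite lerDr.
    have : expR (x ^+ 2 / 4) * expR (- (x ^+ 2 / 4)) = 1.
      by rewrite -expRD subrr expR0.
    have := expR_gt0 (- (x ^+ 2 / 4)).
    move: h; set a := expR (_ / _); set b := expR _ => h b0 ab; nra.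
rewrite ge0_integralZl//=.
- by rewrite integral_normal_pdf mule1 ltry.
- by apply/measurable_EFinP; exact: measurable_normal_pdf.
- by move=> x _; rewrite lee_fin normal_pdf_ge0.
Qed.

(** The variance of the standard normal law. Its finiteness is all that the
    convergence rate depends on, so its value is left as a constant. *)
Definition normal_var : R := fine (\int[normal_prob 0 1]_x ((x : R) ^+ 2)%:E)%E.

Lemma normal_var_ge0 : 0 <= normal_var.
Proof. by apply: fine_ge0; apply: integral_ge0 => x _; rewrite lee_fin sqr_ge0. Qed.

Lemma L2_normal (s : R) : 0 < s -> L2 (normal_prob 0 s) id.
Proof.
move=> s0; split; first exact: measurable_id.
apply/integrableP; split.
  by apply/measurable_EFinP; exact: exprn_measurable.
under eq_integral do rewrite /= ger0_norm ?sqr_ge0//.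
rewrite integral_normal_sqr// lte_mul_pinfty ?lee_fin ?sqr_ge0//.
exact: integral_normal_sqr_lty.
Qed.

Lemma Ex_normal_sqr (s : R) : 0 < s ->
  Ex (normal_prob 0 s) (fun x => x ^+ 2) = normal_var * s ^+ 2.
Proof.
move=> s0; rewrite /Ex /Rintegral integral_normal_sqr// fineM 1?mulrC//.
rewrite ge0_fin_numE ?integral_normal_sqr_lty//.
by apply: integral_ge0 => x _; rewrite lee_fin sqr_ge0.
Qed.

(** The density is even, so the positive and negative parts of the identity
    have the same integral. *)
Lemma Ex_normal (s : R) : 0 < s -> Ex (normal_prob 0 s) id = 0.
Proof.
move=> s0.
have s2 : s != 0 by rewrite gt_eqF.
have mp : measurable_fun setT (fun x : R => Num.max x 0).
  by apply: measurable_maxr => //; exact: measurable_cst.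
have mn : measurable_fun setT (fun x : R => Num.max (- x) 0).
  by apply: measurable_maxr => //; exact: measurable_cst.
rewrite /Ex /Rintegral integralE.
have -> : (\int[normal_prob 0 s]_x (fun x : R => x%:E)^\- x =
   \int[normal_prob 0 s]_x (fun x : R => x%:E)^\+ x)%E.
  under eq_integral do rewrite funenegE -EFinN -EFin_max.
  under [RHS]eq_integral do rewrite funeposE -EFin_max.
  rewrite !ge0_integral_normal//; try by move=> x; rewrite le_max lexx orbT.
  pose G x := (Num.max (- x) 0 * normal_pdf 0 s x)%:E.
  have mG : measurable_fun setT G.
    by apply/measurable_EFinP; apply: measurable_funM => //;
       exact: measurable_normal_pdf.
  have G0 x : (0 <= G x)%E.
    by rewrite lee_fin mulr_ge0 ?normal_pdf_ge0// le_max lexx orbT.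
  transitivity (\int[pushforward mu (-%R : _ -> measurableTypeR R)]_x G x)%E.
    apply: eq_measure_integral => A mA _; exact/esym/lebesgue_measureN.
  have mN : measurable_fun [set: measurableTypeR R] (-%R : _ -> measurableTypeR R).
    by apply: (@measurable_funN _ (measurableTypeR R)); exact: measurable_id.
  have -> := ge0_integral_pushforward mN mu measurableT mG (fun x _ => G0 x).
  rewrite preimage_setT; apply: eq_integral => x _ /=.
  by rewrite /G /= opprK normal_pdfN.
set I := (\int[_]_x _)%E; have : I \is a fin_num.
  apply: integrable_pos_fin_num => //.
  by have := L2_L1 _ _ (L2_normal s s0).
by move=> h; rewrite subee.
Qed.

End NormalMoments.

(** * Increments of Brownian motion *)

Section Brownian.
Context {R : realType} {d : nat} {dO : measure_display} {O : measurableType dO}.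
Variables (P : probability O R) (B : R -> O -> 'cV[R]_d).
Hypothesis hB : brownian_motion P B.
Local Notation F := (augmented_filtration P B).

Definition Fmeas (s : R) (Y : O -> R) : Prop :=
  forall U, measurable U -> F s (Y @^-1` U).

Lemma FmeasE s Y : Fmeas s Y <->
  measurable_fun [set: g_sigma_algebraType
     (past B s `|` [set N | measurable N /\ P N = 0%E])] Y.
Proof.
split; first by move=> h _ U mU; rewrite setTI; exact: h.
by move=> h U mU; have := h measurableT _ mU; rewrite setTI.
Qed.

Lemma past_measurable s A : past B s A -> measurable A.
Proof.
move=> [u [i [U [/andP[u0 _] mU ->]]]]; have [mB _ _ _] := hB.
exact: mB.
Qed.

Lemma filtration_measurable s A : F s A -> measurable A.
Proof.
apply: smallest_sub; first exact: sigma_algebra_measurable.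
by move=> X [|[]//]; exact: past_measurable.
Qed.

Lemma Fmeas_measurable s Y : Fmeas s Y -> measurable_fun setT Y.
Proof.
by move=> h _ U mU; rewrite setTI; apply: filtration_measurable; exact: h.
Qed.

Lemma filtration_le s t A : s <= t -> F s A -> F t A.
Proof.
move=> st; apply: sub_smallest2r; first exact: smallest_sigma_algebra.
apply: setUSS => // X [u [i [U [/andP[u0 us] mU ->]]]].
by exists u, i, U; split => //; rewrite u0 (le_trans us).
Qed.

Lemma Fmeas_le s t Y : s <= t -> Fmeas s Y -> Fmeas t Y.
Proof. by move=> st h U mU; apply: filtration_le st _; exact: h. Qed.

Lemma Fmeas_cst s c : Fmeas s (cst c).
Proof. by apply/FmeasE; exact: measurable_cst. Qed.

Lemma FmeasM s X Y : Fmeas s X -> Fmeas s Y -> Fmeas s (fun w => X w * Y w).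
Proof. by rewrite !FmeasE => hX hY; exact: measurable_funM. Qed.

Lemma FmeasB s X Y : Fmeas s X -> Fmeas s Y -> Fmeas s (fun w => X w - Y w).
Proof. by rewrite !FmeasE => hX hY; exact: measurable_funB. Qed.

Lemma Fmeas_brownian s i : 0 <= s -> Fmeas s (fun w => B s w i ord0).
Proof.
move=> s0 U mU; apply: sub_sigma_algebra; left.
by exists s, i, U; split => //; rewrite s0 lexx.
Qed.

(** The sets that differ from a member of the natural filtration within a null
    set form a sigma-algebra. *)
Lemma filtration_natural s A : F s A ->
  exists A' N, [/\ natural_filtration B s A', measurable N, P N = 0%E &
    forall w, ~ N w -> (A w <-> A' w)].
Proof.
pose S : set (set O) := [set A | exists A' N, [/\ natural_filtration B s A',
  measurable N, P N = 0%E & forall w, ~ N w -> (A w <-> A' w)]].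
suff : F s `<=` S by apply.
apply: smallest_sub; last first.
  move=> X [Xp|[mX X0]].
    exists X, set0; split => //; exact: sub_sigma_algebra.
  exists set0, X; split => //.
  by have [] := smallest_sigma_algebra setT (past B s).
have [n0 nC nU] := smallest_sigma_algebra setT (past B s).
split.
- by exists set0, set0; split.
- move=> X [X' [N [hX' mN N0 hX]]]; exists (setT `\` X'), N; split => //.
    exact: nC.
  move=> w Nw; have := hX _ Nw => -[h1 h2]; split => -[_ h]; split => // ?;
    by apply: h; tauto.
- move=> X hX.
  have {hX} /choice[Y hY] : forall n, exists Y : set O * set O,
    [/\ natural_filtration B s Y.1, measurable Y.2, P Y.2 = 0%E &
      forall w, ~ Y.2 w -> (X n w <-> Y.1 w)].
    by move=> n; have [A' [N hN]] := hX n; exists (A', N).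
  exists (\bigcup_n (Y n).1), (\bigcup_n (Y n).2); split.
  + by apply: nU => n; have [] := hY n.
  + by apply: bigcup_measurable => n _; have [] := hY n.
  + apply: measure_negligible.
      by apply: bigcup_measurable => n _; have [] := hY n.
    by apply: negligible_bigcup => n; apply/negligibleP; have [] := hY n.
  + move=> w Nw; split => -[n _ hn]; exists n => //; have [_ _ _ h] := hY n;
      by apply/(h w) => // Yw; apply: Nw; exists n.
Qed.

(** The definition of Brownian motion speaks of the natural filtration, whereas
    solutions are adapted to the augmented one. *)
Lemma increment_indep s t i A U : 0 <= s -> s < t -> F s A -> measurable U ->
  P (A `&` (fun w => B t w i ord0 - B s w i ord0) @^-1` U) =
  (P A * normal_prob 0 (Num.sqrt (t - s)) U)%E.
Proof.
move=> s0 st FA mU.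
have [mB _ _ indB] := hB.
have t0 : 0 <= t by rewrite (le_trans s0)// ltW.
have mD : measurable_fun setT (fun w => B t w i ord0 - B s w i ord0).
  apply: measurable_funB => _ V mV; rewrite setTI; exact: mB.
have [A' [N [nA' mN N0 AA']]] := filtration_natural _ _ FA.
have mA := filtration_measurable _ _ FA.
have mA' : measurable A'.
  by move: nA'; apply: smallest_sub; [exact: sigma_algebra_measurable|
     exact: past_measurable].
have ae_meas (X Y : set O) : measurable X -> measurable Y ->
    (forall w, ~ N w -> (X w <-> Y w)) -> P X = P Y.
  move=> mX mY XY; rewrite (measureDI P mX mN) (measureDI P mY mN).
  have z Z : measurable Z -> P (Z `&` N) = 0%E.
    move=> mZ; apply: (subset_measure0 _ _ _ N0) => //; exact: measurableI.
  congr (_ + _)%E; last exact: etrans (z _ mX) (esym (z _ mY)).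
  congr (P _); by apply/seteqP; split => w [/= h Nw]; split => //; apply/XY.
have mDU : measurable ((fun w => B t w i ord0 - B s w i ord0) @^-1` U).
  by rewrite -[X in measurable X]setTI; exact: mD.
rewrite (ae_meas _ (A' `&` (fun w => B t w i ord0 - B s w i ord0) @^-1` U)).
- rewrite (ae_meas A A')//.
  have := indB s t s0 st A' (fun j => if j == i then U else setT) nA'.
  rewrite (bigD1 i)//= eqxx big1 ?mule1 => [<-|j /negbTE ->]; last first.
  + exact: (@probability_setT _ _ _ (normal_prob 0 (Num.sqrt (t - s)))).
  + by move=> j; case: ifP.
  congr (P (_ `&` _)); apply/seteqP; split => w /=.
    by move=> h j; case: ifP => [/eqP ->|].
  by move=> /(_ i); rewrite eqxx.
- exact: measurableI.
- exact: measurableI.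
- by move=> w Nw; have := AA' _ Nw => -[h1 h2]; split => -[? ?]; split => //; auto.
Qed.

Lemma filtrationT s : F s setT.
Proof.
have [n0 nC nU] := smallest_sigma_algebra setT
  (past B s `|` [set N | measurable N /\ P N = 0%E]).
by rewrite -[setT]setD0; exact: nC.
Qed.

Lemma measurable_brownian t i : 0 <= t -> measurable_fun setT (fun w => B t w i ord0).
Proof. by move=> t0 _ V mV; rewrite setTI; have [mB _ _ _] := hB; exact: mB. Qed.

Definition dB s t i w := B t w i ord0 - B s w i ord0.

Lemma measurable_dB s t i : 0 <= s -> 0 <= t -> measurable_fun setT (dB s t i).
Proof. by move=> s0 t0; apply: measurable_funB; exact: measurable_brownian. Qed.

Lemma Fmeas_dB s t u i : 0 <= s -> s <= u -> 0 <= t -> t <= u ->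
  Fmeas u (dB s t i).
Proof.
move=> s0 su t0 tu; apply: FmeasB; apply: Fmeas_le (Fmeas_brownian _ _ _) => //.
Qed.

Lemma dB_law s t i U : 0 <= s -> s < t -> measurable U ->
  P (dB s t i @^-1` U) = normal_prob 0 (Num.sqrt (t - s)) U.
Proof.
move=> s0 st mU; have := increment_indep s t i setT U s0 st (filtrationT s) mU.
by rewrite setTI probability_setT mul1e.
Qed.

Lemma Ex_dB (h : R -> R) s t i : 0 <= s -> s < t -> measurable_fun setT h ->
  L1 (normal_prob 0 (Num.sqrt (t - s))) h ->
  L1 P (fun w => h (dB s t i w)) /\
  Ex P (fun w => h (dB s t i w)) = Ex (normal_prob 0 (Num.sqrt (t - s))) h.
Proof.
move=> s0 st mh ih.
have t0 : 0 <= t by rewrite (le_trans s0)// ltW.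
have mD : @measurable_fun _ _ O (measurableTypeR R) setT (dB s t i).
  exact: measurable_dB.
pose X := @mfun_Sub _ _ O (measurableTypeR R) (dB s t i) (mem_set mD).
have E A : measurable A -> normal_prob 0 (Num.sqrt (t - s)) A = distribution P X A.
  by move=> mA; rewrite -(dB_law s t i)//.
have mh' : measurable_fun setT (EFin \o h) by exact/measurable_EFinP.
have i1 : L1 P (fun w => h (dB s t i w)).
  have /integrableP[_ hi] := ih.
  apply/integrableP; split; first exact/measurable_EFinP/measurableT_comp.
  have mah : measurable_fun setT (abse \o (EFin \o h)) by exact: measurableT_comp.
  apply: le_lt_trans hi; rewrite le_eqVlt; apply/orP; left; apply/eqP.
  transitivity (\int[distribution P X]_x (abse \o (EFin \o h)) x)%E.
    by rewrite ge0_integral_distribution// => y; exact: abse_ge0.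
  by apply: eq_measure_integral => A mA _; apply/esym; exact: E.
split => //; rewrite /Ex /Rintegral; congr fine.
rewrite -(@integral_distribution _ _ _ _ _ P X (EFin \o h))//.
by apply: eq_measure_integral => A mA _; apply/esym; exact: E.
Qed.

Lemma L2_dB s t i : 0 <= s -> s <= t -> L2 P (dB s t i).
Proof.
move=> s0; rewrite le_eqVlt => /predU1P[<-|st].
  rewrite (_ : dB s s i = cst 0); first exact: L2_cst.
  by apply/funext => w; rewrite /dB subrr.
split; first by apply: measurable_dB => //; rewrite (le_trans s0)// ltW.
apply: (Ex_dB (fun x => x ^+ 2) s t i s0 st _ _).1.
  exact: exprn_measurable.
by have [] := L2_normal (Num.sqrt (t - s)); rewrite ?sqrtr_gt0 ?subr_gt0.
Qed.

Lemma Ex_Fmeas_comp_dB (h : R -> R) s t i Y : 0 <= s -> s < t ->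
  measurable_fun setT h -> L1 (normal_prob 0 (Num.sqrt (t - s))) h ->
  Fmeas s Y -> L1 P Y ->
  L1 P (fun w => Y w * h (dB s t i w)) /\
  Ex P (fun w => Y w * h (dB s t i w)) =
    Ex P Y * Ex (normal_prob 0 (Num.sqrt (t - s))) h.
Proof.
move=> s0 st mh ih FY iY; have [i1 <-] := Ex_dB h s t i s0 st mh ih.
apply: indep_mul => // U V mU mV.
have mhV : measurable (h @^-1` V) by rewrite -[X in measurable X]setTI; exact: mh.
rewrite (increment_indep s t i _ _ s0 st (FY _ mU) mhV); congr (_ * _)%E.
by rewrite -(dB_law s t i).
Qed.

(** The measurability of the weight is required only on nondegenerate
    intervals: truncating a simple process at a fixed time produces empty
    intervals whose left end point precedes the time at which the coefficient
    becomes known. *)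
Lemma Ex_Fmeas_dB s t i Y : 0 <= s -> s <= t -> (s < t -> Fmeas s Y) ->
  L2 P Y -> Ex P (fun w => Y w * dB s t i w) = 0.
Proof.
move=> s0; rewrite le_eqVlt => /predU1P[<-|st] FY iY.
  rewrite (_ : (fun _ => _) = cst 0); first exact: Ex_cst.
  by apply/funext => w; rewrite /dB subrr mulr0.
have n0 : 0 < Num.sqrt (t - s) by rewrite sqrtr_gt0 subr_gt0.
have [_] := Ex_Fmeas_comp_dB id s t i Y s0 st (@measurable_id _ _ _)
  (L2_L1 _ _ (L2_normal _ n0)) (FY st) (L2_L1 _ _ iY).
by rewrite /= Ex_normal// mulr0.
Qed.

Lemma Ex_Fmeas_dB_sqr s t i Y : 0 <= s -> s <= t -> (s < t -> Fmeas s Y) ->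
  L1 P Y -> L1 P (fun w => Y w * dB s t i w ^+ 2) /\
  Ex P (fun w => Y w * dB s t i w ^+ 2) = normal_var * (t - s) * Ex P Y.
Proof.
move=> s0; rewrite le_eqVlt => /predU1P[<-|st] FY iY.
  rewrite subrr mulr0 mul0r (_ : (fun _ => _) = cst 0).
    by split; [exact: L1_cst|exact: Ex_cst].
  by apply/funext => w; rewrite /dB subrr expr0n mulr0.
have n0 : 0 < Num.sqrt (t - s) by rewrite sqrtr_gt0 subr_gt0.
have msq : measurable_fun setT (fun x : R => x ^+ 2) by exact: exprn_measurable.
have [h1] := Ex_Fmeas_comp_dB _ s t i Y s0 st msq
  (L2_sqr _ _ (L2_normal _ n0)) (FY st) iY.
rewrite Ex_normal_sqr// sqr_sqrtr ?subr_ge0 1?ltW// => ->.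
by split => //; rewrite mulrC.
Qed.

Definition overlap (s1 t1 s2 t2 : R) : R :=
  Num.max 0 (Num.min t1 t2 - Num.max s1 s2).

Lemma overlapC s1 t1 s2 t2 : overlap s1 t1 s2 t2 = overlap s2 t2 s1 t1.
Proof. by rewrite /overlap minC maxC [X in _ = Num.max _ (_ - X)]maxC maxC. Qed.

Section TwoIntervals.
Variables (K : R) (i : 'I_d).
Definition bdd_coef s t (C : O -> R) : Prop :=
  [/\ measurable_fun setT C, forall w, `|C w| <= K & s < t -> Fmeas s C].

Lemma L2_coef s t C : bdd_coef s t C -> L2 P C.
Proof.
case=> mC CK _; have := L2_bounded_mul P K C _ mC CK (L2_cst P 1).
by under eq_fun do rewrite mulr1.
Qed.

Lemma L2_coef_dB a b s t C : bdd_coef a b C -> 0 <= s -> s <= t ->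
  L2 P (fun w => C w * dB s t i w).
Proof.
move=> [mC CK _] s0 st; apply: (L2_bounded_mul P K) => //; exact: L2_dB.
Qed.

Lemma dB_chasles s u t w : dB s t i w = dB s u i w + dB u t i w.
Proof. by rewrite /dB; ring. Qed.

Let same_start s t1 t2 A C : 0 <= s -> s < t1 -> t1 <= t2 ->
  bdd_coef s t1 A -> bdd_coef s t2 C ->
  Ex P (fun w => A w * dB s t1 i w * (C w * dB s t2 i w)) =
  normal_var * (t1 - s) * Ex P (fun w => A w * C w).
Proof.
move=> s0 st1 t12 hA hC.
have FA : Fmeas s A by case: hA => _ _; exact.
have FC : Fmeas s C by case: hC => _ _; apply; exact: lt_le_trans t12.
have iAC : L1 P (fun w => A w * C w).
  by apply: L2_mul; [exact: L2_coef hA|exact: L2_coef hC].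
have [i1 E1] := Ex_Fmeas_dB_sqr s t1 i _ s0 (ltW st1) (fun _ => FmeasM _ _ _ FA FC) iAC.
have t10 : 0 <= t1 by rewrite (le_trans s0)// ltW.
have [mC CK _] := hC.
pose Y w := C w * (A w * dB s t1 i w).
have hY : L2 P Y.
  by apply: (L2_bounded_mul P K) => //; apply: L2_coef_dB hA _ _ => //; exact: ltW.
have FY : Fmeas t1 Y.
  apply: FmeasM; first exact: Fmeas_le (ltW st1) FC.
  by apply: FmeasM; [exact: Fmeas_le (ltW st1) FA|apply: Fmeas_dB => //; exact: ltW].
rewrite -E1 -[RHS]addr0 -(Ex_Fmeas_dB t1 t2 i Y)//.
rewrite -ExD//.
  by congr (Ex _ _); apply/funext => w; rewrite (dB_chasles s t1 t2) /Y; ring.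
by apply: L2_mul => //; exact: L2_dB.
Qed.

Let ordered s1 t1 s2 t2 A C : 0 <= s1 -> s1 <= s2 -> s1 <= t1 -> s2 <= t2 ->
  bdd_coef s1 t1 A -> bdd_coef s2 t2 C ->
  Ex P (fun w => A w * dB s1 t1 i w * (C w * dB s2 t2 i w)) =
  normal_var * overlap s1 t1 s2 t2 * Ex P (fun w => A w * C w).
Proof.
move=> s10 s12 st1 st2 hA hC.
have s20 : 0 <= s2 by exact: le_trans s12.
have t10 : 0 <= t1 by exact: le_trans st1.
have [mA AK FA] := hA; have [mC CK FC] := hC.
have [st2'|] := eqVneq s2 t2.
  rewrite /overlap -st2' (_ : (fun _ => _) = cst 0); last first.
    by apply/funext => w; rewrite /dB subrr !mulr0.
  rewrite Ex_cst (_ : Num.max _ _ = 0) ?mulr0 ?mul0r//.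
  apply/max_idPl; rewrite subr_le0 le_max; apply/orP; right.
  by rewrite ge_min lexx orbT.
rewrite neq_lt [X in _ || X]ltNge st2 orbF => lt2.
have [st1'|] := eqVneq s1 t1.
  rewrite /overlap -st1' (_ : (fun _ => _) = cst 0); last first.
    by apply/funext => w; rewrite /dB subrr !mulr0 mul0r.
  rewrite Ex_cst (_ : Num.max _ _ = 0) ?mulr0 ?mul0r//.
  apply/max_idPl; rewrite subr_le0 le_max; apply/orP; left.
  by rewrite ge_min lexx.
rewrite neq_lt [X in _ || X]ltNge st1 orbF => lt1.
have [t1s2|s2t1] := leP t1 s2.
  rewrite (_ : overlap _ _ _ _ = 0) ?mulr0 ?mul0r; last first.
    rewrite /overlap (max_idPr s12) (min_idPl (le_trans t1s2 st2)).
    by apply/max_idPl; rewrite subr_le0.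
  rewrite (_ : (fun _ => _) = fun w => C w * (A w * dB s1 t1 i w) * dB s2 t2 i w).
    apply: Ex_Fmeas_dB => //; last first.
      by apply: (L2_bounded_mul P K) => //; exact: L2_coef_dB hA _ _.
    move=> _; apply: FmeasM; first exact: FC.
    by apply: FmeasM; [exact: Fmeas_le s12 (FA lt1)|exact: Fmeas_dB].
  by apply/funext => w; ring.
have hA2 t : bdd_coef s2 t A by split => // _; exact: Fmeas_le s12 (FA lt1).
pose Y w := C w * (A w * dB s1 s2 i w).
have hY : L2 P Y by apply: (L2_bounded_mul P K) => //; exact: L2_coef_dB hA _ _.
have FY : Fmeas s2 Y.
  apply: FmeasM; first exact: FC.
  by apply: FmeasM; [exact: Fmeas_le s12 (FA lt1)|exact: Fmeas_dB].
have E0 := Ex_Fmeas_dB s2 t2 i Y s20 st2 (fun _ => FY) hY.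
have iY : L1 P (fun w => Y w * dB s2 t2 i w) by apply: L2_mul => //; exact: L2_dB.
have iZ : L1 P (fun w => A w * dB s2 t1 i w * (C w * dB s2 t2 i w)).
  by apply: L2_mul; [exact: L2_coef_dB hA _ (ltW _)|exact: L2_coef_dB hC _ _].
rewrite (_ : (fun _ => _) = fun w => Y w * dB s2 t2 i w +
    A w * dB s2 t1 i w * (C w * dB s2 t2 i w)); last first.
  by apply/funext => w; rewrite (dB_chasles s1 s2 t1) /Y; ring.
rewrite ExD// E0 add0r /overlap (max_idPr s12).
have [t12|/ltW t21] := leP t1 t2.
  by rewrite same_start// (max_idPr _)// subr_ge0 ltW.
rewrite (max_idPr _) ?subr_ge0//.
rewrite (_ : (fun w => _) = fun w => C w * dB s2 t2 i w * (A w * dB s2 t1 i w)).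
  rewrite same_start//; congr (_ * Ex _ _).
  by apply/funext => w; rewrite mulrC.
by apply/funext => w; rewrite mulrC.
Qed.

(** The isometry of stochastic integrals, in bilinear form. The interval that
    starts first is split where the other one starts; the early piece is
    orthogonal to the other increment, and of the two increments that then start
    together, the longer is split where the shorter ends. *)
Lemma Ex_two_increments s1 t1 s2 t2 A C : 0 <= s1 -> 0 <= s2 ->
  s1 <= t1 -> s2 <= t2 -> bdd_coef s1 t1 A -> bdd_coef s2 t2 C ->
  Ex P (fun w => A w * dB s1 t1 i w * (C w * dB s2 t2 i w)) =
  normal_var * overlap s1 t1 s2 t2 * Ex P (fun w => A w * C w).
Proof.
move=> s10 s20 st1 st2 hA hC; have [s12|/ltW s21] := leP s1 s2.
  exact: ordered.
rewrite overlapC (_ : (fun w => A w * C w) = fun w => C w * A w); last first.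
  by apply/funext => w; rewrite mulrC.
rewrite -ordered//; congr (Ex _ _).
by apply/funext => w; rewrite mulrC.
Qed.
End TwoIntervals.
End Brownian.

(** * Scalar elementary stochastic integrals *)

Section Elementary.
Context {R : realType} {d : nat} {dO : measure_display} {O : measurableType dO}.
Variables (P : probability O R) (B : R -> O -> 'cV[R]_d).
Hypothesis hB : brownian_motion P B.
Local Notation mu := (@lebesgue_measure R).

Lemma integral_indic_overlap p q s1 t1 s2 t2 : p <= s1 -> t1 <= q ->
  (\int[mu]_(u in `]p, q]) (\1_`]s1, t1] u * \1_`]s2, t2] u)%:E =
   (overlap s1 t1 s2 t2)%:E)%E.
Proof.
move=> ps tq.
under eq_integral do rewrite -[_ * _]/((\1_`]s1, t1] \* \1_`]s2, t2]) _) -indicI.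
rewrite integral_indic//; last exact: measurableI.
rewrite (_ : (_ `&` _) = `]Num.max s1 s2, Num.min t1 t2]%classic); last first.
  apply/seteqP; split => u /=; rewrite !in_itv/= gt_max le_min.
    by move=> [/andP[h1 h2] /andP[h3 h4]]; rewrite h1 h2 h3 h4.
  by move=> /andP[/andP[h1 h2] /andP[h3 h4]]; rewrite h1 h2 h3 h4.
rewrite setIidl; last first.
  move=> u /=; rewrite !in_itv/= gt_max le_min.
  move=> /andP[/andP[h1 h2] /andP[h3 h4]].
  by rewrite (le_lt_trans ps h1) (le_trans h3 tq).
rewrite -[LHS]/(mu _) lebesgue_measure_itv/= lte_fin /overlap.
case: ltP => h; congr EFin; apply/esym.
  by apply/max_idPr; rewrite subr_ge0 ltW.
by apply/max_idPl; rewrite subr_le0.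
Qed.

Variables (I : finType) (a b : I -> R) (C : I -> O -> R) (K : R) (j : 'I_d).
Hypothesis a0 : forall k, 0 <= a k.
Hypothesis ab : forall k, a k <= b k.
Hypothesis hC : forall k, bdd_coef P B K (a k) (b k) (C k).

Definition elem_int w := \sum_k C k w * dB B (a k) (b k) j w.
Definition elem_fun u w := \sum_k C k w * \1_`]a k, b k] u.

Lemma L2_elem_int : L2 P elem_int.
Proof.
by apply: L2_sum => k; apply: L2_coef_dB (hC k) (a0 k) (ab k).
Qed.

Let L1CC k l : L1 P (fun w => C k w * C l w).
Proof. by apply: L2_mul; [exact: L2_coef (hC k)|exact: L2_coef (hC l)]. Qed.

Let sqr_sum (G : I -> R) : (\sum_k G k) ^+ 2 = \sum_k \sum_l G k * G l.
Proof.
rewrite expr2 mulr_suml; apply: eq_bigr => k _; by rewrite mulr_sumr.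
Qed.

Lemma elem_fun_energy p q w : (forall k, p <= a k) -> (forall k, b k <= q) ->
  (\int[mu]_(u in `]p, q]) (elem_fun u w ^+ 2)%:E =
   (\sum_k \sum_l overlap (a k) (b k) (a l) (b l) * (C k w * C l w))%:E)%E.
Proof.
move=> pa bq.
under eq_integral do rewrite /elem_fun sqr_sum pair_big -sumEFin.
have iD (k l : I) c : mu.-integrable `]p, q]
    (fun u => (c * (\1_`]a k, b k] u * \1_`]a l, b l] u))%:E).
  have -> : (fun u => (c * (\1_`]a k, b k] u * \1_`]a l, b l] u))%:E) =
      (fun u => c%:E * (\1_(`]a k, b k] `&` `]a l, b l]) u)%:E)%E.
    by apply/funext => u; rewrite indicI EFinM.
  apply: integrableZl => //.
  have mS : measurable (`]a k, b k] `&` `]a l, b l] : set R) by exact: measurableI.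
  apply/integrableP; split; first exact/measurable_EFinP/measurable_indic.
  under eq_integral do rewrite gee0_abs ?lee_fin//.
  rewrite integral_indic//; apply: (@le_lt_trans _ _ (mu `]p, q]%classic)).
    by apply: le_measure; rewrite ?inE//; exact: measurableI.
  by rewrite lebesgue_measure_itv/=; case: ifP; rewrite -?EFinB ltry.
rewrite integral_sum//; last first.
  move=> [k l]; have := iD k l (C k w * C l w); congr (integrable _ _ _).
  by apply/funext => u /=; congr EFin; ring.
rewrite pair_big -sumEFin; apply: eq_bigr => -[k l] _ /=.
transitivity (\int[mu]_(u in `]p, q]) ((C k w * C l w)%:E *
    (\1_`]a k, b k] u * \1_`]a l, b l] u)%:E))%E.
  by apply: eq_integral => u _; rewrite -EFinM; congr EFin; ring.
rewrite integralZl//.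
  by rewrite integral_indic_overlap// -EFinM mulrC.
by have := iD k l 1; under [X in integrable _ _ X -> _]eq_fun do rewrite mul1r.
Qed.

(** The intervals may overlap; this spares the refinement of two subdivisions to
    a common one when the difference of two simple processes is integrated. *)
Lemma elem_isometry p q : (forall k, p <= a k) -> (forall k, b k <= q) ->
  (\int[P]_w (elem_int w ^+ 2)%:E = normal_var%:E *
    \int[P]_w \int[mu]_(u in `]p, q]) (elem_fun u w ^+ 2)%:E)%E.
Proof.
move=> pa bq; under [in RHS]eq_integral do rewrite elem_fun_energy//.
have iG k l : L1 P (fun w => overlap (a k) (b k) (a l) (b l) * (C k w * C l w)).
  exact: L1Z.
rewrite -EFin_Ex; last exact: L2_sqr L2_elem_int.
rewrite -EFin_Ex; last by do 2 (apply: L1_sum => ?).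
rewrite -EFinM; congr EFin.
rewrite Ex_sum; last by move=> k; exact: L1_sum.
rewrite [in LHS](_ : (fun w => _) = fun w => \sum_k \sum_l
   (C k w * dB B (a k) (b k) j w) * (C l w * dB B (a l) (b l) j w)); last first.
  by apply/funext => w; rewrite /elem_int sqr_sum.
have iN k l : L1 P (fun w => (C k w * dB B (a k) (b k) j w) *
    (C l w * dB B (a l) (b l) j w)).
  by apply: L2_mul; [exact: L2_coef_dB (hC k) _ _|exact: L2_coef_dB (hC l) _ _].
rewrite Ex_sum; last by move=> k; exact: L1_sum.
rewrite mulr_sumr; apply: eq_bigr => k _.
rewrite Ex_sum// Ex_sum// mulr_sumr; apply: eq_bigr => l _.
by rewrite (Ex_two_increments P B hB K)// ExZ// mulrA.
Qed.

Lemma elem_orthogonal p Y : 0 <= p -> (forall k, p <= a k) -> Fmeas P B p Y -> L2 P Y ->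
  Ex P (fun w => Y w * elem_int w) = 0.
Proof.
move=> p0 pa FY hY.
under [X in Ex _ X]eq_fun do rewrite /elem_int mulr_sumr.
rewrite Ex_sum; last first.
  by move=> k; apply: L2_mul => //; apply: L2_coef_dB (hC k) _ _.
apply: big1 => k _.
under [X in Ex _ X]eq_fun do rewrite mulrA.
apply: Ex_Fmeas_dB => //; last first.
  have [mC CK _] := hC k.
  under [X in L2 _ X]eq_fun do rewrite mulrC.
  exact: (L2_bounded_mul P K).
move=> kab; apply: FmeasM; first exact: Fmeas_le (pa k) FY.
by have [_ _] := hC k; exact.
Qed.

End Elementary.

(** * Euclidean norms and the energy of a process *)

Section Enorm.
Context {R : realType}.

Lemma enorm_sqr m n (A : 'M[R]_(m, n)) : enorm A ^+ 2 = \sum_i \sum_j A i j ^+ 2.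
Proof.
rewrite /enorm sqr_sqrtr//; apply: sumr_ge0 => i _; apply: sumr_ge0 => j _.
exact: sqr_ge0.
Qed.

Lemma enorm_ge0 m n (A : 'M[R]_(m, n)) : 0 <= enorm A.
Proof. exact: sqrtr_ge0. Qed.

Lemma enorm_col_sqr n (x : 'cV[R]_n) : enorm x ^+ 2 = \sum_i x i ord0 ^+ 2.
Proof. by rewrite enorm_sqr; apply: eq_bigr => i _; rewrite big_ord1. Qed.

Lemma entry_le_enorm m n (A : 'M[R]_(m, n)) i j : `|A i j| <= enorm A.
Proof.
rewrite -(ler_pXn2r (_ : (0 < 2)%N)) ?nnegrE ?enorm_ge0// real_normK ?num_real//.
rewrite enorm_sqr (bigD1 i)//= (bigD1 j)//= -addrA lerDl.
by rewrite addr_ge0// sumr_ge0// => *; rewrite ?sumr_ge0// => *; rewrite sqr_ge0.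
Qed.

Lemma sqr_entry_le n (x : 'cV[R]_n) i : x i ord0 ^+ 2 <= enorm x ^+ 2.
Proof. by rewrite -real_normK ?num_real// lerXn2r ?nnegrE ?entry_le_enorm ?enorm_ge0. Qed.

Lemma enorm_sqrZ m n (c : R) (A : 'M[R]_(m, n)) :
  enorm (c *: A) ^+ 2 = c ^+ 2 * enorm A ^+ 2.
Proof.
rewrite !enorm_sqr mulr_sumr; apply: eq_bigr => i _.
by rewrite mulr_sumr; apply: eq_bigr => j _; rewrite mxE exprMn.
Qed.

Lemma enorm_sqrD m n (A B : 'M[R]_(m, n)) :
  enorm (A + B) ^+ 2 <= 2 * enorm A ^+ 2 + 2 * enorm B ^+ 2.
Proof.
rewrite !enorm_sqr !mulr_sumr -big_split; apply: ler_sum => i _ /=.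
rewrite !mulr_sumr -big_split; apply: ler_sum => j _ /=; rewrite mxE.
have := sqr_ge0 (A i j - B i j); nra.
Qed.

Lemma enorm_sqrN m n (A : 'M[R]_(m, n)) : enorm (- A) ^+ 2 = enorm A ^+ 2.
Proof. by rewrite -scaleN1r enorm_sqrZ sqrrN expr1n mul1r. Qed.

Lemma enorm_sqrB m n (A B : 'M[R]_(m, n)) :
  enorm (A - B) ^+ 2 <= 2 * enorm A ^+ 2 + 2 * enorm B ^+ 2.
Proof. by have := enorm_sqrD _ _ A (- B); rewrite enorm_sqrN. Qed.

(** Cauchy-Schwarz against the constant vector, obtained by expanding the sum of
    all the squares [(x i - x j) ^+ 2]. *)
Lemma sqr_sum_le n (x : 'I_n -> R) : (\sum_i x i) ^+ 2 <= n%:R * \sum_i x i ^+ 2.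
Proof.
have h : 0 <= \sum_i \sum_j (x i - x j) ^+ 2.
  by apply: sumr_ge0 => i _; apply: sumr_ge0 => j _; exact: sqr_ge0.
have E : \sum_i \sum_j (x i - x j) ^+ 2 =
    2 * (n%:R * (\sum_i x i ^+ 2)) - 2 * (\sum_i x i) ^+ 2.
  transitivity (\sum_i (n%:R * x i ^+ 2 - 2 * x i * (\sum_j x j) +
      \sum_j x j ^+ 2)).
    apply: eq_bigr => i _.
    under eq_bigr do rewrite sqrrB.
    rewrite big_split sumrB /= sumr_const card_ord mulr_natl; congr (_ - _ + _).
    by rewrite mulr_sumr; apply: eq_bigr => j _; rewrite mulr_natl mulrnAl.
  rewrite big_split sumrB /= sumr_const card_ord -!mulr_sumr -mulr_suml.
  by rewrite -mulr_sumr -mulr_natl; ring.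
by rewrite E in h; lra.
Qed.
End Enorm.

Section TimeOmega.
Context {R : realType} {dO : measure_display} {O : measurableType dO}.
Variable P : probability O R.
Local Notation mu := (@lebesgue_measure R).

Lemma measurable_integral_param (g : R * O -> R) (D : set R) : measurable D ->
  measurable_fun setT g -> (forall p, 0 <= g p) ->
  measurable_fun setT (fun w => \int[mu]_(u in D) (g (u, w))%:E)%E.
Proof.
move=> mD mg g0.
pose f (p : R * O) := (\1_D p.1 * g p)%:E.
have mf : measurable_fun setT f.
  apply/measurable_EFinP; apply: measurable_funM => //.
  by apply: measurableT_comp; [exact: measurable_indic|exact: measurable_fst].
have f0 p : (0 <= f p)%E by rewrite lee_fin mulr_ge0.
have := @measurable_fun_fubini_tonelli_G _ _ _ _ _ mu f mf f0.
rewrite (_ : (fun w => _) = fubini_G mu f)//.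
apply/funext => w; rewrite /fubini_G [LHS]integral_mkcond; apply: eq_integral => u _.
by rewrite patchE /f indicE/=; case: ifP; rewrite ?mul1r ?mul0r.
Qed.

Lemma tonelli_param (g : R * O -> R) (D : set R) : measurable D ->
  measurable_fun setT g -> (forall p, 0 <= g p) ->
  (\int[P]_w \int[mu]_(u in D) (g (u, w))%:E =
   \int[mu]_(u in D) \int[P]_w (g (u, w))%:E)%E.
Proof.
move=> mD mg g0.
pose f (p : R * O) := (\1_D p.1 * g p)%:E.
have mf : measurable_fun setT f.
  apply/measurable_EFinP; apply: measurable_funM => //.
  by apply: measurableT_comp; [exact: measurable_indic|exact: measurable_fst].
have f0 p : (0 <= f p)%E by rewrite lee_fin mulr_ge0.
have E := @fubini_tonelli _ _ _ _ _ mu P f mf f0; rewrite [RHS]integral_mkcond.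
transitivity (\int[P]_w \int[mu]_u f (u, w))%E.
  apply: eq_integral => w _; rewrite [LHS]integral_mkcond; apply: eq_integral => u _.
  by rewrite patchE /f indicE/=; case: ifP; rewrite ?mul1r ?mul0r.
rewrite -E; apply: eq_integral => u _; rewrite patchE.
case: ifP => uD.
  by apply: eq_integral => w _; rewrite /f indicE/= uD mul1r.
by rewrite -[RHS](integral0 P setT); apply: eq_integral => w _;
  rewrite /f indicE/= uD mul0r.
Qed.

Definition jmeas m n (Psi : R -> O -> 'M[R]_(m, n)) : Prop :=
  forall i j, measurable_fun setT (fun p : R * O => Psi p.1 p.2 i j).

Lemma jmeas_enorm m n (Psi : R -> O -> 'M[R]_(m, n)) : jmeas _ _ Psi ->
  measurable_fun setT (fun p : R * O => enorm (Psi p.1 p.2) ^+ 2).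
Proof.
move=> h; under eq_fun do rewrite enorm_sqr.
apply: measurable_sum => i; apply: measurable_sum => j.
by apply: measurable_funX; exact: h.
Qed.

Lemma jmeasD m n (Psi Phi : R -> O -> 'M[R]_(m, n)) :
  jmeas _ _ Psi -> jmeas _ _ Phi -> jmeas _ _ (fun u w => Psi u w + Phi u w).
Proof.
move=> h1 h2 i j; under eq_fun do rewrite mxE; exact: measurable_funD.
Qed.

Lemma jmeasN m n (Psi : R -> O -> 'M[R]_(m, n)) :
  jmeas _ _ Psi -> jmeas _ _ (fun u w => - Psi u w).
Proof. by move=> h1 i j; under eq_fun do rewrite mxE; exact: measurable_funN. Qed.

(** The squared norm of [L^2(P x dt)] restricted to a set of times, with values
    in [\bar R] so that it makes sense before square integrability is known. *)
Definition energy (D : set R) m n (Psi : R -> O -> 'M[R]_(m, n)) : \bar R :=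
  (\int[P]_w \int[mu]_(u in D) (enorm (Psi u w) ^+ 2)%:E)%E.

Let menergy D m n (Psi : R -> O -> 'M[R]_(m, n)) : measurable D ->
  jmeas _ _ Psi ->
  measurable_fun setT (fun w => \int[mu]_(u in D) (enorm (Psi u w) ^+ 2)%:E)%E.
Proof.
move=> mD h; apply: (@measurable_integral_param
  (fun p => enorm (Psi p.1 p.2) ^+ 2)) => //; first exact: jmeas_enorm.
by move=> p; exact: sqr_ge0.
Qed.

Let msec D m n (Psi : R -> O -> 'M[R]_(m, n)) w : jmeas _ _ Psi ->
  measurable_fun D (fun u => (enorm (Psi u w) ^+ 2)%:E).
Proof.
move=> h; apply/measurable_EFinP; apply: measurable_funTS.
have := measurableT_comp (jmeas_enorm _ _ _ h) (@measurable_pair2 _ _ R O w).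
exact.
Qed.

Lemma energy_le_combination D m n (Psi Phi Xi : R -> O -> 'M[R]_(m, n)) (k l : R) :
  measurable D -> 0 <= k -> 0 <= l ->
  jmeas _ _ Psi -> jmeas _ _ Phi -> jmeas _ _ Xi ->
  (forall u w, D u -> enorm (Xi u w) ^+ 2 <=
     k * enorm (Psi u w) ^+ 2 + l * enorm (Phi u w) ^+ 2) ->
  (energy D _ _ Xi <= k%:E * energy D _ _ Psi + l%:E * energy D _ _ Phi)%E.
Proof.
move=> mD k0 l0 h1 h2 h3 le; rewrite /energy.
have i0 m' n' (A : R -> O -> 'M[R]_(m', n')) w :
    (0 <= \int[mu]_(u in D) (enorm (A u w) ^+ 2)%:E)%E.
  by apply: integral_ge0 => u _; rewrite lee_fin sqr_ge0.
rewrite -ge0_integralZl//; last exact: menergy.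
rewrite -ge0_integralZl//; last exact: menergy.
rewrite -ge0_integralD//=; last 4 first.
- by move=> w _; rewrite mule_ge0.
- by apply: measurable_funeM; exact: menergy.
- by move=> w _; rewrite mule_ge0.
- by apply: measurable_funeM; exact: menergy.
apply: ge0_le_integral => //; first exact: menergy.
- by apply: emeasurable_funD; apply: measurable_funeM; exact: menergy.
move=> w _.
rewrite -!ge0_integralZl//; try exact: msec; try by move=> ? _; rewrite lee_fin sqr_ge0.
rewrite -ge0_integralD//=; last 4 first.
- by move=> ? _; rewrite -EFinM lee_fin mulr_ge0// sqr_ge0.
- by apply: measurable_funeM; exact: msec.
- by move=> ? _; rewrite -EFinM lee_fin mulr_ge0// sqr_ge0.
- by apply: measurable_funeM; exact: msec.
apply: ge0_le_integral => //.
- by move=> ? _; rewrite lee_fin sqr_ge0.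
- exact: msec.
- by apply: emeasurable_funD; apply: measurable_funeM; exact: msec.
- by move=> u Du; rewrite -!EFinM -EFinD lee_fin le.
Qed.

Lemma energy_subset D D' m n (Psi : R -> O -> 'M[R]_(m, n)) :
  measurable D -> measurable D' -> D `<=` D' -> jmeas _ _ Psi ->
  (energy D _ _ Psi <= energy D' _ _ Psi)%E.
Proof.
move=> mD mD' DD' h; apply: ge0_le_integral => //.
- by move=> w _; apply: integral_ge0 => u _; rewrite lee_fin sqr_ge0.
- exact: menergy.
- exact: menergy.
- move=> w _; apply: ge0_subset_integral => //; first exact: msec.
  by move=> u _; rewrite lee_fin sqr_ge0.
Qed.

Lemma energy_bound p q m n (Psi : R -> O -> 'M[R]_(m, n)) (K : R) : p <= q ->
  jmeas _ _ Psi -> (forall u w, p < u <= q -> enorm (Psi u w) ^+ 2 <= K) ->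
  (energy `]p, q] _ _ Psi <= (K * (q - p))%:E)%E.
Proof.
move=> pq h hK; rewrite /energy.
have -> : (K * (q - p))%:E = (\int[P]_w \int[mu]_(u in `]p, q]) K%:E)%E.
  have -> : (\int[mu]_(u in `]p, q]) K%:E = (K * (q - p))%:E)%E.
    rewrite integral_cst//= lebesgue_measure_itv/= lte_fin.
    have [//|] := ltP p q; rewrite -?EFinB// => qp.
    have -> : q = p by apply/eqP; rewrite eq_le pq qp.
    by rewrite subrr mulr0 mule0.
  by rewrite integral_cst// [X in _ = (_ * X)%E](@probability_setT _ _ _ P) mule1.
apply: ge0_le_integral => //.
- by move=> w _; apply: integral_ge0 => u _; rewrite lee_fin sqr_ge0.
- exact: menergy.
- move=> w _; apply: ge0_le_integral => //.
  + by move=> u _; rewrite lee_fin sqr_ge0.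
  + exact: msec.
  + by move=> u /=; rewrite in_itv/= => hu; rewrite lee_fin; exact: hK.
Qed.
End TimeOmega.

(** * Vector-valued elementary stochastic integrals *)

Section VectorElementary.
Context {R : realType} {d : nat} {dO : measure_display} {O : measurableType dO}.
Variables (P : probability O R) (B : R -> O -> 'cV[R]_d).
Hypothesis hB : brownian_motion P B.
Local Notation mu := (@lebesgue_measure R).

Variables (I : finType) (a b : I -> R) (C : I -> O -> 'M[R]_d) (K : R).
Hypothesis a0 : forall k, 0 <= a k.
Hypothesis ab : forall k, a k <= b k.
Hypothesis hC : forall k i j, bdd_coef P B K (a k) (b k) (fun w => C k w i j).

Definition vint w : 'cV[R]_d := \sum_k C k w *m (B (b k) w - B (a k) w).
Definition vfun u w : 'M[R]_d := \sum_k (\1_`]a k, b k] u : R) *: C k w.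

Let N i j := elem_int B I a b (fun k w => C k w i j) j.

Lemma vint_entry w i : vint w i ord0 = \sum_j N i j w.
Proof.
rewrite /vint summxE /N /elem_int exchange_big /=; apply: eq_bigr => k _.
by rewrite mxE; apply: eq_bigr => j _; rewrite !mxE.
Qed.

Lemma vfun_entry u w i j :
  vfun u w i j = elem_fun I a b (fun k w => C k w i j) u w.
Proof.
rewrite /vfun summxE /elem_fun; apply: eq_bigr => k _.
by rewrite mxE mulrC.
Qed.

Lemma jmeas_vfun : jmeas d d vfun.
Proof.
move=> i j; under eq_fun do rewrite vfun_entry /elem_fun.
apply: measurable_sum => k; apply: measurable_funM.
  have [mC _ _] := hC k i j.
  exact: measurableT_comp mC measurable_snd.
by apply: measurableT_comp; [exact: measurable_indic|exact: measurable_fst].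
Qed.

Let L2N i j : L2 P (N i j).
Proof. exact: (L2_elem_int P B hB I a b _ K). Qed.

Lemma L2_vint i : L2 P (fun w => vint w i ord0).
Proof. by under [X in L2 _ X]eq_fun do rewrite vint_entry; exact: L2_sum. Qed.

(** Each coordinate of the integral is a sum of [d] scalar integrals, one for
    each coordinate of the Brownian motion. Bounding the square of that sum by
    [d] times the sum of the squares avoids any use of the independence of the
    coordinates, at the price of the constant [d]. *)
Lemma vint_energy p q : (forall k, p <= a k) -> (forall k, b k <= q) ->
  (\int[P]_w (enorm (vint w) ^+ 2)%:E <=
   (d%:R * normal_var)%:E * energy P `]p, q] d d vfun)%E.
Proof.
move=> pa bq.
have mN i j : measurable_fun setT (fun w => (N i j w ^+ 2)%:E).
  by apply/measurable_EFinP; apply: measurable_funX; case: (L2N i j).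
have mE i j : measurable_fun setT (fun w => \int[mu]_(u in `]p, q])
    (vfun u w i j ^+ 2)%:E)%E.
  apply: (@measurable_integral_param _ _ _ (fun p => vfun p.1 p.2 i j ^+ 2)) => //.
    by apply: measurable_funX; exact: jmeas_vfun.
  by move=> ?; exact: sqr_ge0.
have E0 i j w : (0 <= \int[mu]_(u in `]p, q]) (vfun u w i j ^+ 2)%:E)%E.
  by apply: integral_ge0 => u _; rewrite lee_fin sqr_ge0.
have -> : (energy P `]p, q] d d vfun =
    \sum_i \sum_j \int[P]_w \int[mu]_(u in `]p, q]) (vfun u w i j ^+ 2)%:E)%E.
  under [RHS]eq_bigr do rewrite -ge0_integral_sum//.
  rewrite -ge0_integral_sum//; last 2 first.
  - by move=> i; apply: emeasurable_sum => j.
  - by move=> i w _; apply: sume_ge0 => j _.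
  apply: eq_integral => w _.
  have ms i j : measurable_fun `]p, q] (fun u => (vfun u w i j ^+ 2)%:E).
    apply/measurable_EFinP; apply: measurable_funTS; apply: measurable_funX.
    exact: measurableT_comp (jmeas_vfun i j) (@measurable_pair2 _ _ R O w).
  have inner i : (\sum_j \int[mu]_(u in `]p, q]) (vfun u w i j ^+ 2)%:E =
      \int[mu]_(u in `]p, q]) \sum_j (vfun u w i j ^+ 2)%:E)%E.
    have nn j u : `]p, q]%classic u -> (0 <= (vfun u w i j ^+ 2)%:E)%E.
      by move=> _; rewrite lee_fin sqr_ge0.
    exact/esym/(ge0_integral_sum mu _ (ms i) nn).
  under [RHS]eq_bigr do rewrite inner.
  rewrite -ge0_integral_sum//; last 2 first.
  - by move=> i; apply: emeasurable_sum => j; exact: ms.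
  - by move=> i u _; apply: sume_ge0 => j _; rewrite lee_fin sqr_ge0.
  apply: eq_integral => u _; rewrite enorm_sqr -sumEFin.
  by apply: eq_bigr => i _; rewrite -sumEFin.
apply: (@le_trans _ _ (\int[P]_w (d%:R%:E * \sum_i \sum_j (N i j w ^+ 2)%:E))%E).
  apply: ge0_le_integral => //.
  - by move=> w _; rewrite lee_fin sqr_ge0.
  - apply/measurable_EFinP; under eq_fun do rewrite enorm_col_sqr.
    apply: measurable_sum => i; apply: measurable_funX; by case: (L2_vint i).
  - apply: measurable_funeM; apply: emeasurable_sum => i.
    by apply: emeasurable_sum => j.
  - move=> w _; rewrite enorm_col_sqr.
    under [X in (_ * X)%E]eq_bigr do rewrite sumEFin.
    rewrite sumEFin -EFinM lee_fin mulr_sumr; apply: ler_sum => i _.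
    by rewrite vint_entry; exact: sqr_sum_le.
rewrite ge0_integralZl//; last 2 first.
- by apply: emeasurable_sum => i; apply: emeasurable_sum => j.
- by move=> w _; apply: sume_ge0 => i _; apply: sume_ge0 => j _; rewrite lee_fin sqr_ge0.
rewrite EFinM -muleA lee_wpmul2l ?lee_fin//.
rewrite ge0_integral_sum//; last 2 first.
- by move=> i; apply: emeasurable_sum => j.
- by move=> i w _; apply: sume_ge0 => j _; rewrite lee_fin sqr_ge0.
rewrite le_eqVlt; apply/orP; left; apply/eqP.
have e0 i j : (0 <= \int[P]_w \int[mu]_(u in `]p, q]) (vfun u w i j ^+ 2)%:E)%E.
  by apply: integral_ge0.
rewrite ge0_sume_distrr; last by move=> i _; apply: sume_ge0.
apply: eq_bigr => i _; rewrite ge0_integral_sum//; last first.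
  by move=> j w _; rewrite lee_fin sqr_ge0.
rewrite ge0_sume_distrr//; apply: eq_bigr => j _.
have -> := elem_isometry P B hB I a b (fun k w => C k w i j) K j a0 ab
  (fun k => hC k i j) p q pa bq.
congr (_ * _)%E; apply: eq_integral => w _; apply: eq_integral => u _.
by rewrite vfun_entry.
Qed.

Lemma vint_orthogonal p Y i : 0 <= p -> (forall k, p <= a k) -> Fmeas P B p Y ->
  L2 P Y -> Ex P (fun w => Y w * vint w i ord0) = 0.
Proof.
move=> p0 pa FY hY.
under [X in Ex _ X]eq_fun do rewrite vint_entry mulr_sumr.
rewrite Ex_sum; last by move=> j; exact: L2_mul.
apply: big1 => j _; exact: (elem_orthogonal P B hB I a b _ K j _ _ _ p).
Qed.

End VectorElementary.

(** * Random vectors and simple processes *)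

Section RandomVectors.
Context {R : realType} {dO : measure_display} {O : measurableType dO}.
Variables (P : probability O R) (d : nat).
Implicit Types f g h : O -> 'cV[R]_d.

Definition vmeas f := forall i, measurable_fun setT (fun w => f w i ord0).
Definition nsq f : \bar R := (\int[P]_w (enorm (f w) ^+ 2)%:E)%E.

Lemma vmeas_enorm f : vmeas f -> measurable_fun setT (fun w => enorm (f w) ^+ 2).
Proof.
move=> h; under eq_fun do rewrite enorm_col_sqr.
by apply: measurable_sum => i; apply: measurable_funX; exact: h.
Qed.

Lemma vmeasD f g : vmeas f -> vmeas g -> vmeas (fun w => f w + g w).
Proof. by move=> hf hg i; under eq_fun do rewrite mxE; exact: measurable_funD. Qed.

Lemma vmeasN f : vmeas f -> vmeas (fun w => - f w).
Proof. by move=> hf i; under eq_fun do rewrite mxE; exact: measurable_funN. Qed.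

Lemma vmeasB f g : vmeas f -> vmeas g -> vmeas (fun w => f w - g w).
Proof. by move=> hf hg; apply: vmeasD => //; exact: vmeasN. Qed.

Lemma nsq_le_combination f g h (k l : R) : 0 <= k -> 0 <= l ->
  vmeas f -> vmeas g -> vmeas h ->
  (forall w, enorm (h w) ^+ 2 <= k * enorm (f w) ^+ 2 + l * enorm (g w) ^+ 2) ->
  (nsq h <= k%:E * nsq f + l%:E * nsq g)%E.
Proof.
move=> k0 l0 mf mg mh le; rewrite /nsq.
have m1 (x : O -> 'cV[R]_d) : vmeas x ->
    measurable_fun setT (fun w => (enorm (x w) ^+ 2)%:E).
  by move=> mx; apply/measurable_EFinP; exact: vmeas_enorm.
have p1 (x : O -> 'cV[R]_d) w : (0 <= (enorm (x w) ^+ 2)%:E)%E.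
  by rewrite lee_fin sqr_ge0.
rewrite -!ge0_integralZl//; try exact: m1.
rewrite -ge0_integralD//=; last 4 first.
- by move=> w _; rewrite -EFinM lee_fin mulr_ge0// sqr_ge0.
- by apply: measurable_funeM; exact: m1.
- by move=> w _; rewrite -EFinM lee_fin mulr_ge0// sqr_ge0.
- by apply: measurable_funeM; exact: m1.
apply: ge0_le_integral => //; first exact: m1.
- by apply: emeasurable_funD; apply: measurable_funeM; exact: m1.
- by move=> w _; rewrite -!EFinM -EFinD lee_fin.
Qed.

Lemma L2_of_nsq f i (c : R) : vmeas f -> (nsq f <= c%:E)%E ->
  L2 P (fun w => f w i ord0).
Proof.
move=> mf fc; split; first exact: mf.
have [h _] := L1_of_le P _ c (vmeas_enorm f mf) (fun w => sqr_ge0 _) fc.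
apply: (L1_le P _ _ _ h); first by apply: measurable_funX; exact: mf.
by move=> w; rewrite ger0_norm ?sqr_ge0// sqr_entry_le.
Qed.

Lemma L1_nsq f : (forall i, L2 P (fun w => f w i ord0)) ->
  L1 P (fun w => enorm (f w) ^+ 2).
Proof.
move=> h; under eq_fun do rewrite enorm_col_sqr.
by apply: L1_sum => i; exact: L2_sqr.
Qed.
End RandomVectors.

Section SimpleProcesses.
Context {R : realType} {d : nat} {dO : measure_display} {O : measurableType dO}.
Variables (P : probability O R) (B : R -> O -> 'cV[R]_d).
Hypothesis hB : brownian_motion P B.
Local Notation F := (augmented_filtration P B).

Lemma sp_time_nonneg (phi : @simple_process R d dO O F) k : 0 <= sp_time phi k.
Proof.
elim: k => [|k IH]; first exact: sp_time_ge0.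
by apply: le_trans IH _; exact: sp_time_le.
Qed.

(** The interval is arbitrary because truncating a process at a fixed time moves
    the end points of the intervals on which its coefficients act. *)
Lemma sp_coef_entry (phi : @simple_process R d dO O F) (K : R) s t k i j :
  (forall k w, enorm (sp_coef phi k w) <= K) ->
  (s < t -> sp_time phi k <= s) ->
  bdd_coef P B K s t (fun w => sp_coef phi k w i j).
Proof.
move=> hK ts.
have FC : Fmeas P B (sp_time phi k) (fun w => sp_coef phi k w i j).
  by move=> U mU; exact: sp_coef_adapted.
split.
- exact: Fmeas_measurable FC.
- by move=> w; apply: le_trans (entry_le_enorm _ _ _ i j) _.
- by move=> st; exact: Fmeas_le (ts st) FC.
Qed.

Lemma sp_eval_entry (phi : @simple_process R d dO O F) u w i j :
  sp_eval phi u w i j = \sum_(k < sp_size phi)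
    (\1_`]sp_time phi k, sp_time phi k.+1] u) * sp_coef phi k w i j.
Proof. by rewrite /sp_eval summxE; apply: eq_bigr => k _; rewrite mxE. Qed.

Lemma jmeas_sp_eval (phi : @simple_process R d dO O F) : jmeas d d (sp_eval phi).
Proof.
move=> i j; under eq_fun do rewrite sp_eval_entry.
apply: measurable_sum => k; apply: measurable_funM.
  by apply: measurableT_comp; [exact: measurable_indic|exact: measurable_fst].
have [K hK] := sp_coef_bounded phi.
have [mC _ _] := sp_coef_entry phi K (sp_time phi k) 0 k i j hK (fun=> lexx _).
exact: measurableT_comp mC measurable_snd.
Qed.
End SimpleProcesses.

(** * Increments of stochastic integrals *)

Lemma min_mono (R : realType) (x y t : R) : x <= y -> Num.min x t <= Num.min y t.
Proof. by move=> xy; rewrite le_min !ge_min lexx orbT andbT xy. Qed.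

Lemma max_mono (R : realType) (x y t : R) : x <= y -> Num.max x t <= Num.max y t.
Proof. by move=> xy; rewrite ge_max !le_max lexx orbT andbT xy. Qed.

Lemma leeD_mul2 (R : realType) (x y : \bar R) (u v : R) :
  (x <= u%:E)%E -> (y <= v%:E)%E ->
  (2%:E * x + 2%:E * y <= (2 * u + 2 * v)%:E)%E.
Proof.
move=> xu yv; rewrite [leRHS]EFinD; apply: leeD.
  by rewrite [leRHS]EFinM; apply: lee_wpmul2l => //; rewrite lee_fin.
by rewrite [leRHS]EFinM; apply: lee_wpmul2l => //; rewrite lee_fin.
Qed.

Section ItoIncrements.
Context {R : realType} {d : nat} {dO : measure_display} {O : measurableType dO}.
Variables (P : probability O R) (B : R -> O -> 'cV[R]_d).
Hypothesis hB : brownian_motion P B.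
Local Notation F := (augmented_filtration P B).
Local Notation mu := (@lebesgue_measure R).
Local Notation simple := (@simple_process R d dO O F).

Definition ito_cst : R := d%:R * normal_var.

Lemma ito_cst_ge0 : 0 <= ito_cst.
Proof. by rewrite mulr_ge0 ?normal_var_ge0. Qed.

Lemma vmeas_sp_integral (phi : simple) t : 0 <= t -> vmeas d (sp_integral phi B t).
Proof.
move=> t0 i; have [K hK] := sp_coef_bounded phi.
have -> : (fun w => sp_integral phi B t w i ord0) = fun w => \sum_(k < sp_size phi)
   \sum_j sp_coef phi k w i j * (B (Num.min (sp_time phi k.+1) t) w j ord0 -
     B (Num.min (sp_time phi k) t) w j ord0).
  apply/funext => w; rewrite summxE; apply: eq_bigr => k _.
  by rewrite mxE; apply: eq_bigr => j _; rewrite !mxE.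
apply: measurable_sum => k; apply: measurable_sum => j.
have [mC _ _] := sp_coef_entry P B hB phi K (sp_time phi k) 0 k i j hK (fun=> lexx _).
apply: measurable_funM; first exact: mC.
by apply: measurable_funB; apply: (measurable_brownian P B hB);
   rewrite le_min t0 sp_time_nonneg.
Qed.

(** Between [s] and [t] the integral of a simple process is an elementary
    integral over the intervals of the process clipped to [s, t]. *)
Lemma sp_increment_energy (phi : simple) s t : 0 <= s -> s <= t ->
  let D w := sp_integral phi B t w - sp_integral phi B s w in
  [/\ forall i, L2 P (fun w => D w i ord0),
      (nsq P d D <= ito_cst%:E * energy P `]s, t] d d (sp_eval phi))%E &
      forall i Y, Fmeas P B s Y -> L2 P Y -> Ex P (fun w => Y w * D w i ord0) = 0].
Proof.
move=> s0 st D; have [K hK] := sp_coef_bounded phi.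
pose a (k : 'I_(sp_size phi)) := Num.max (Num.min (sp_time phi k) t) s.
pose b (k : 'I_(sp_size phi)) := Num.max (Num.min (sp_time phi k.+1) t) s.
pose C (k : 'I_(sp_size phi)) := sp_coef phi k.
have sa k : s <= a k by rewrite le_max lexx orbT.
have a0 k : 0 <= a k by exact: le_trans (sa k).
have ab k : a k <= b k.
  by apply: max_mono; apply: min_mono; exact: sp_time_le.
have bt k : b k <= t by rewrite ge_max st ge_min lexx orbT.
have hC k i j : bdd_coef P B K (a k) (b k) (fun w => C k w i j).
  apply: sp_coef_entry => // hab.
  have [kt|tk] := leP (sp_time phi k) t.
    by rewrite /a (min_idPl kt) le_max lexx.
  have tk' : t <= sp_time phi k.+1 by rewrite (le_trans (ltW tk))// sp_time_le.
  by move: hab; rewrite /a /b (min_idPr tk') (min_idPr (ltW tk)) ltxx.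
have cut x w : B (Num.min x t) w - B (Num.min x s) w =
    B (Num.max (Num.min x t) s) w - B s w.
  have [xs|sx] := leP x s.
    by rewrite (min_idPl (le_trans xs st)) (max_idPr xs) !subrr.
  by rewrite (max_idPl _)// le_min (ltW sx) st.
have DE : D = vint B _ a b C.
  apply/funext => w; rewrite /D /sp_integral /vint -sumrB; apply: eq_bigr => k _.
  rewrite -mulmxBr; congr (_ *m _).
  rewrite [LHS](_ : _ = (B (Num.min (sp_time phi k.+1) t) w -
      B (Num.min (sp_time phi k.+1) s) w) - (B (Num.min (sp_time phi k) t) w -
      B (Num.min (sp_time phi k) s) w)); last by
    apply/matrixP => ? ?; rewrite !mxE; ring.
  by rewrite !cut; apply/matrixP => ? ?; rewrite !mxE; ring.
have EE : energy P `]s, t] d d (sp_eval phi) = energy P `]s, t] d d (vfun _ a b C).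
  rewrite /energy; apply: eq_integral => w _; apply: eq_integral => u.
  rewrite inE/= in_itv/= => /andP[su ut]; congr ((enorm _ ^+ 2)%:E).
  rewrite /sp_eval /vfun; apply: eq_bigr => k _; congr (_ *: _).
  rewrite !indicE; congr ((nat_of_bool _)%:R); apply/idP/idP; rewrite !inE/= !in_itv/=.
    move=> /andP[h1 h2]; rewrite gt_max gt_min le_max le_min h1 su h2 ut.
    by [].
  rewrite gt_max gt_min le_max le_min => /andP[/andP[/orP[->|]]].
    by move=> _ /orP[/andP[-> _]//|/(lt_le_trans su)]; rewrite ltxx.
  by move=> /lt_le_trans/(_ ut); rewrite ltxx.
split.
- move=> i; rewrite DE; exact: (L2_vint P B hB _ a b C K).
- rewrite EE /nsq DE.
  exact: (vint_energy P B hB _ a b C K).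
- move=> i Y FY hY; rewrite DE.
  exact: (vint_orthogonal P B hB _ a b C K _ _ _ s).
Qed.

(** The difference of two simple processes is an elementary integrand indexed by
    the disjoint union of their two subdivisions. *)
Lemma sp_integral_contraction (phi psi : simple) s : 0 <= s ->
  (nsq P d (fun w => sp_integral phi B s w - sp_integral psi B s w)%R
   <= ito_cst%:E *
      energy P `]0%R, s] d d (fun u w => sp_eval phi u w - sp_eval psi u w)%R)%E.
Proof.
move=> s0; have [K hK] := sp_coef_bounded phi; have [K' hK'] := sp_coef_bounded psi.
pose I := ('I_(sp_size phi) + 'I_(sp_size psi))%type.
pose a (k : I) := match k with inl k => Num.min (sp_time phi k) s
                          | inr k => Num.min (sp_time psi k) s end.
pose b (k : I) := match k with inl k => Num.min (sp_time phi k.+1) s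
                          | inr k => Num.min (sp_time psi k.+1) s end.
pose C (k : I) w : 'M[R]_d := match k with inl k => sp_coef phi k w
                          | inr k => - sp_coef psi k w end.
have a0 k : 0 <= a k by case: k => k /=; rewrite le_min s0 sp_time_nonneg.
have ab k : a k <= b k by case: k => k /=; apply: min_mono; exact: sp_time_le.
have bs k : b k <= s by case: k => k /=; rewrite ge_min lexx orbT.
have tr (xi : simple) k : Num.min (sp_time xi k) s < Num.min (sp_time xi k.+1) s ->
    sp_time xi k <= Num.min (sp_time xi k) s.
  have [//|sk] := leP (sp_time xi k) s.
  by rewrite lt_min ltxx andbF.
have hC k i j : bdd_coef P B (Num.max K K') (a k) (b k) (fun w => C k w i j).
  case: k => k /=.
    apply: sp_coef_entry => //; last exact: tr.
    by move=> l w; rewrite le_max hK.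
  have [m1 m2 m3] := sp_coef_entry P B hB psi K' (Num.min (sp_time psi k) s)
    (Num.min (sp_time psi k.+1) s) k i j hK' (tr psi k).
  under eq_fun do rewrite mxE -mulN1r.
  split.
  - by apply: measurable_funM => //; exact: measurable_cst.
  - by move=> w; rewrite mulN1r normrN le_max m2 orbT.
  - by move=> /m3 h; apply: FmeasM => //; exact: Fmeas_cst.
have SE : (fun w => sp_integral phi B s w - sp_integral psi B s w) = vint B I a b C.
  apply/funext => w; rewrite /vint big_sumType /= /sp_integral -sumrN.
  by congr (_ + _); apply: eq_bigr => k _; rewrite mulNmx.
have EE : energy P `]0, s] d d (fun u w => sp_eval phi u w - sp_eval psi u w) =
    energy P `]0, s] d d (vfun I a b C).
  rewrite /energy; apply: eq_integral => w _; apply: eq_integral => u.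
  rewrite inE/= in_itv/= => /andP[u0 us]; congr ((enorm _ ^+ 2)%:E).
  have ind x y : (\1_`]x, y] u : R) = \1_`]Num.min x s, Num.min y s] u.
    rewrite !indicE; congr ((nat_of_bool _)%:R); apply/idP/idP; rewrite !inE/= !in_itv/=.
      by move=> /andP[h1 h2]; rewrite gt_min h1 le_min h2 us.
    rewrite gt_min le_min us andbT => /andP[/orP[-> //|]].
    by move=> /lt_le_trans/(_ us); rewrite ltxx.
  rewrite /vfun big_sumType /= /sp_eval -sumrN.
  by congr (_ + _); apply: eq_bigr => k _; rewrite ind// scalerN.
rewrite EE SE; exact: (vint_energy P B hB I a b C (Num.max K K')).
Qed.

Lemma ito_approx (Phi : R -> O -> 'M[R]_d) t J (e : R) : 0 < e ->
  ito_integral P F B Phi t J -> exists phi : simple,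
  (energy P `[0%R, t] d d (fun u w => sp_eval phi u w - Phi u w)%R <= e%:E)%E /\
  (nsq P d (fun w => sp_integral phi B t w - J w)%R <= e%:E)%E.
Proof.
move=> e0 [_ [phi [h1 h2]]].
have e0' : (0 < e%:E)%E by rewrite lte_fin.
have n1 := h1 _ (open_ereal_lt' e0'); have n2 := h2 _ (open_ereal_lt' e0').
case: n1 => m1 _ l1; case: n2 => m2 _ l2.
exists (phi (maxn m1 m2)); split; apply: ltW.
  by apply: l1; rewrite /= leq_maxl.
by apply: l2; rewrite /= leq_maxr.
Qed.

Lemma ito_integral_modification (Phi Phi' : R -> O -> 'M[R]_d) t J (N : set O) :
  measurable N -> P N = 0%E ->
  (forall u w, 0 <= u -> ~ N w -> Phi u w = Phi' u w) ->
  ito_integral P F B Phi t J -> ito_integral P F B Phi' t J.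
Proof.
move=> mN N0 PP [mJ [phi [h1 h2]]]; split; first exact: mJ.
exists phi; split; last exact: h2.
apply: (@squeeze_cvge _ _ _ _ (cst 0%E) _ (fun n => \int[P]_w
  \int[mu]_(u in `[0%R, t]) (enorm (sp_eval (phi n) u w - Phi u w) ^+ 2)%:E)%E) => //;
  last exact: cvg_cst.
apply: nearW => n; apply/andP; split.
  by apply: integral_ge0 => w _; apply: integral_ge0 => u _; rewrite lee_fin sqr_ge0.
apply: (le_integral_off_null _ N) => //.
- by move=> w; apply: integral_ge0 => u _; rewrite lee_fin sqr_ge0.
- by move=> w; apply: integral_ge0 => u _; rewrite lee_fin sqr_ge0.
move=> w Nw; rewrite le_eqVlt; apply/orP; left; apply/eqP.
apply: eq_integral => u; rewrite inE/= in_itv/= => /andP[u0 _].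
by rewrite (PP u w).
Qed.

Lemma ito_integral_vmeas (Phi : R -> O -> 'M[R]_d) t J :
  ito_integral P F B Phi t J -> vmeas d J.
Proof.
move=> [mJ _] i; apply: (Fmeas_measurable P B hB t) => U mU; exact: mJ.
Qed.

(** The integrals at times [s] and [t] come with unrelated approximations, by
    processes [psi] and [phi]. The increment between [s] and [t] of the integral
    of [phi] approximates [It - Is]: the integrals of [phi] and [psi] up to [s]
    are close, since both processes are close to [Phi] on [0, s]. *)
Let approx_increment (Phi : R -> O -> 'M[R]_d) (q s t : R) Is It (e : R) :
  0 <= s -> s <= t -> 0 <= q -> 0 < e -> jmeas d d Phi ->
  (forall u w, s < u <= t -> enorm (Phi u w) ^+ 2 <= q) ->
  ito_integral P F B Phi s Is -> ito_integral P F B Phi t It ->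
  exists D : O -> 'cV[R]_d,
  [/\ forall i, L2 P (fun w => D w i ord0),
      (nsq P d D <= (ito_cst * (2 * e + 2 * (q * (t - s))))%:E)%E,
      forall i Y, Fmeas P B s Y -> L2 P Y -> Ex P (fun w => Y w * D w i ord0) = 0 &
      (nsq P d (fun w => It w - Is w - D w)%R <= ((8 + 8 * ito_cst) * e)%:E)%E].
Proof.
move=> s0 st q0 e0 jP hq hIs hIt.
have t0 : 0 <= t by exact: le_trans st.
have [phi [p1 p2]] := ito_approx Phi t It e e0 hIt.
have [psi [q1 q2]] := ito_approx Phi s Is e e0 hIs.
have [D1 D2 D3] := sp_increment_energy phi s t s0 st.
set D := (fun w => _) in D1 D2 D3.
have c0 := ito_cst_ge0.
have jphi := jmeas_sp_eval P B hB phi; have jpsi := jmeas_sp_eval P B hB psi.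
have j1 : jmeas d d (fun u w => sp_eval phi u w - Phi u w).
  by apply: jmeasD => //; exact: jmeasN.
have j2 : jmeas d d (fun u w => sp_eval psi u w - Phi u w).
  by apply: jmeasD => //; exact: jmeasN.
exists D; split => //.
  apply: le_trans D2 _; rewrite [leRHS]EFinM; apply: lee_wpmul2l; first by rewrite lee_fin.
  have := energy_le_combination P `]s, t] d d _ _ (sp_eval phi) 2 2
    (measurable_itv _) (ler0n _ _) (ler0n _ _) j1 jP jphi.
  move=> /(_ _)/le_trans; apply.
    by move=> u w _; apply: le_trans (enorm_sqrD _ _ _ _); rewrite subrK.
  apply: leeD_mul2.
    apply: le_trans p1; apply: energy_subset => //.
    by move=> u /=; rewrite !in_itv/= => /andP[h1 ->]; rewrite (le_trans s0)// ltW.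
  exact: energy_bound.
have mphi r : 0 <= r -> vmeas d (sp_integral phi B r) by exact: vmeas_sp_integral.
have mpsi r : 0 <= r -> vmeas d (sp_integral psi B r) by exact: vmeas_sp_integral.
have mIt := ito_integral_vmeas _ _ _ hIt; have mIs := ito_integral_vmeas _ _ _ hIs.
pose A1 w := sp_integral phi B t w - It w.
pose A2 w := sp_integral psi B s w - Is w.
pose S w := sp_integral phi B s w - sp_integral psi B s w.
have mA1 : vmeas d A1 by apply: vmeasB => //; exact: mphi.
have mA2 : vmeas d A2 by apply: vmeasB => //; exact: mpsi.
have mS : vmeas d S by apply: vmeasB; [exact: mphi|exact: mpsi].
have nS : (nsq P d S <= (ito_cst * (4 * e))%:E)%E.
  apply: le_trans (sp_integral_contraction phi psi s s0) _.
  rewrite [leRHS]EFinM; apply: lee_wpmul2l; first by rewrite lee_fin.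
  have := energy_le_combination P `]0, s] d d _ _
    (fun u w => sp_eval phi u w - sp_eval psi u w) 2 2
    (measurable_itv _) (ler0n _ _) (ler0n _ _) j1 j2.
  move=> /(_ _ _)/le_trans; apply.
  - by apply: jmeasD => //; exact: jmeasN.
  - by move=> u w _; apply: le_trans (enorm_sqrB _ _ _ _); rewrite opprB addrA subrK.
  rewrite (_ : 4 * e = 2 * e + 2 * e); last by ring.
  apply: leeD_mul2.
    apply: le_trans p1; apply: energy_subset => //.
    by move=> u /=; rewrite !in_itv/= => /andP[/ltW -> h2]; rewrite (le_trans h2).
  apply: le_trans q1; apply: energy_subset => //.
  by move=> u /=; rewrite !in_itv/= => /andP[/ltW -> ->].
have n1 : (nsq P d (fun w => A2 w - A1 w)%R <= (4 * e)%:E)%E.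
  have := nsq_le_combination P d A2 A1 (fun w => A2 w - A1 w) 2 2 (ler0n _ _) (ler0n _ _)
    mA2 mA1 (vmeasB _ _ _ mA2 mA1).
  move=> /(_ _)/le_trans; apply; first by move=> w; exact: enorm_sqrB.
  rewrite (_ : 4 * e = 2 * e + 2 * e); last by ring.
  exact: leeD_mul2.
have E w : It w - Is w - D w = (A2 w - A1 w) + S w.
  rewrite /D /A1 /A2 /S; apply/matrixP => i j; rewrite !mxE; ring.
have m21 := vmeasB _ _ _ mA2 mA1.
have mE : vmeas d (fun w => It w - Is w - D w).
  by under eq_fun do rewrite E; exact: vmeasD.
have := nsq_le_combination P d (fun w => A2 w - A1 w) S _ 2 2 (ler0n _ _) (ler0n _ _)
    m21 mS mE.
move=> /(_ _)/le_trans; apply; first by move=> w; rewrite E; exact: enorm_sqrD.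
apply: le_trans (leeD_mul2 _ _ _ _ _ n1 nS) _; rewrite lee_fin.
rewrite le_eqVlt; apply/orP; left; apply/eqP; ring.
Qed.

(** Passing to the limit in the approximations yields the two properties of
    stochastic integrals on which the convergence rate rests: an upper bound on
    the second moment of an increment, and its orthogonality to the past. The
    bound loses the constant [4 * ito_cst] with respect to the isometry. *)
Lemma ito_increment (Phi : R -> O -> 'M[R]_d) (q s t : R) Is It :
  0 <= s -> s <= t -> 0 <= q -> jmeas d d Phi ->
  (forall u w, s < u <= t -> enorm (Phi u w) ^+ 2 <= q) ->
  ito_integral P F B Phi s Is -> ito_integral P F B Phi t It ->
  [/\ forall i, L2 P (fun w => It w i ord0 - Is w i ord0),
      (nsq P d (fun w => It w - Is w)%R <= (4 * ito_cst * q * (t - s))%:E)%E &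
      forall i Y, Fmeas P B s Y -> L2 P Y ->
        Ex P (fun w => Y w * (It w i ord0 - Is w i ord0)) = 0].
Proof.
move=> s0 st q0 jP hq hIs hIt.
have c0 := ito_cst_ge0.
have ts0 : 0 <= t - s by rewrite subr_ge0.
have mIt := ito_integral_vmeas _ _ _ hIt; have mIs := ito_integral_vmeas _ _ _ hIs.
have mI := vmeasB _ _ _ mIt mIs.
have bound e : 0 < e -> (nsq P d (fun w => It w - Is w)%R <=
    (4 * ito_cst * q * (t - s) + (16 + 20 * ito_cst) * e)%:E)%E.
  move=> e0.
  have [D [D1 D2 _ D4]] := approx_increment Phi q s t Is It e s0 st q0 e0 jP hq hIs hIt.
  have mD : vmeas d D by move=> i; case: (D1 i).
  have := nsq_le_combination P d _ D (fun w => It w - Is w) 2 2 (ler0n _ _) (ler0n _ _)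
    (vmeasB _ _ _ mI mD) mD mI.
  move=> /(_ _)/le_trans; apply.
    by move=> w; apply: le_trans (enorm_sqrD _ _ _ _); rewrite subrK.
  apply: le_trans (leeD_mul2 _ _ _ _ _ D4 D2) _; rewrite lee_fin.
  set c := ito_cst in c0 *; rewrite le_eqVlt; apply/orP; left; apply/eqP; ring.
have L2I i : L2 P (fun w => It w i ord0 - Is w i ord0).
  have := L2_of_nsq P d _ i _ mI (bound 1 ltr01).
  by under [X in L2 _ X -> _]eq_fun do rewrite !mxE.
split => //.
  apply/lee_addgt0Pr => e e0.
  have c1 : 0 < 16 + 20 * ito_cst by lra.
  have := bound (e / (16 + 20 * ito_cst)) (divr_gt0 e0 c1).
  by rewrite [_ * (e / _)]mulrC divfK ?gt_eqF// EFinD.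
move=> i Y FY hY.
apply/eqP; rewrite -normr_le0; apply/ler_addgt0Pr => e e0; rewrite add0r.
set y := Ex P (fun w => Y w ^+ 2).
have y0 : 0 <= y by apply: Ex_ge0 => w; exact: sqr_ge0.
(* [l] makes the first term of the weighted Cauchy-Schwarz inequality at most
   [e / 2]; the accuracy [e1] of the approximation does so for the second. *)
pose l := e / (2 * (y + 1)).
have l0 : 0 < l by rewrite divr_gt0// mulr_gt0// ltr_wpDl.
have c1 : 0 < 8 + 8 * ito_cst by lra.
pose e1 := e * l / (2 * (8 + 8 * ito_cst)).
have e10 : 0 < e1 by apply: divr_gt0; apply: mulr_gt0.
have [D [D1 D2 D3 D4]] := approx_increment Phi q s t Is It e1 s0 st q0 e10 jP hq hIs hIt.
have mD : vmeas d D by move=> k; case: (D1 k).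
have mID := vmeasB _ _ _ mI mD.
have E : Ex P (fun w => Y w * (It w i ord0 - Is w i ord0)) =
    Ex P (fun w => Y w * (It w - Is w - D w) i ord0).
  rewrite -[LHS]subr0 -(D3 i Y FY hY) -ExB; [|exact: L2_mul..].
  by congr (Ex P _); apply/funext => w; rewrite !mxE; ring.
rewrite E; apply: le_trans (Ex_mul_le P l _ _ l0 hY (L2_of_nsq P d _ i _ mID D4)) _.
have [iE bE] := L1_of_le P _ _ (vmeas_enorm _ _ mID) (fun w => sqr_ge0 _) D4.
have h : Ex P (fun w => (It w - Is w - D w) i ord0 ^+ 2) <= (8 + 8 * ito_cst) * e1.
  apply: le_trans bE; apply: Ex_le => //.
    by case: (L2_of_nsq P d _ i _ mID D4).
  by move=> w; exact: sqr_entry_le.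
have b1 : l * y <= e / 2.
  rewrite /l; have -> : e / (2 * (y + 1)) * y = e / 2 * (y / (y + 1)).
    by field; rewrite gt_eqF// ltr_wpDl.
  rewrite ler_piMr ?divr_ge0// ?(ltW e0)//.
  by rewrite ler_pdivrMr ?mul1r ?lerDl// ltr_wpDl.
have b2 : l^-1 * ((8 + 8 * ito_cst) * e1) = e / 2.
  by rewrite /e1; field; rewrite !gt_eqF.
have := ler_wpM2l (ltW (_ : 0 < l^-1)) h; rewrite invr_gt0 b2 => /(_ l0) h'.
rewrite -/y; lra.
Qed.

End ItoIncrements.

(** * Integration over time intervals *)

(** Paths are only known to be continuous on nonnegative times; composing them
    with a retraction yields a function continuous everywhere. *)
Lemma continuous_retract {R : realType} {T : topologicalType} (A : set R)
    (rho : R -> R) (F : R -> T) :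
  continuous rho -> (forall t, A (rho t)) -> {within A, continuous F} ->
  continuous (F \o rho).
Proof.
move=> cr Ar /subspace_continuousP cF t.
move=> S FS; have h : nbhs (rho t) (fun y => A y -> S (F y)) := cF _ (Ar t) _ FS.
have h' : nbhs t (fun u => A (rho u) -> S (F (rho u))) := cr t _ h.
by apply: filterS h' => u /=; apply.
Qed.

Lemma continuous_clip {R : realType} (c : R) :
  continuous (fun t => Num.max c t) /\ continuous (fun t => Num.min t c).
Proof.
split => x; apply/cvgrPdist_lt => e e0; near=> t.
  have xt : `|x - t| < e by near: t; exact: cvgr_dist_lt.
  apply: le_lt_trans xt; have h1 := ler_norm (x - t); have h2 := ler_norm (t - x).
  rewrite distrC in h2; rewrite ler_norml.
  by have [?|?] := leP c x; have [?|?] := leP c t; apply/andP; split; lra.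
have xt : `|x - t| < e by near: t; exact: cvgr_dist_lt.
apply: le_lt_trans xt; have h1 := ler_norm (x - t); have h2 := ler_norm (t - x).
rewrite distrC in h2; rewrite ler_norml.
by have [?|?] := leP x c; have [?|?] := leP t c; apply/andP; split; lra.
Unshelve. all: end_near. Qed.

Section TimeIntegral.
Context {R : realType}.
Local Notation mu := (@lebesgue_measure R).
Implicit Types (h k : R -> R) (s t c : R).

Definition tint s t h : R := \int[mu]_(u in `[s, t]) h u.

Lemma tint_integrable s t h : continuous h ->
  mu.-integrable `[s, t] (EFin \o h).
Proof.
move=> ch; apply: continuous_compact_integrable; first exact: segment_compact.
exact: continuous_subspaceT.
Qed.

Lemma EFin_tint s t h : continuous h ->
  (tint s t h)%:E = (\int[mu]_(u in `[s, t]) (h u)%:E)%E.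
Proof.
move=> ch; rewrite fineK//; apply: integrable_fin_num => //.
exact: tint_integrable.
Qed.

Lemma tintD s t h k : continuous h -> continuous k ->
  tint s t (fun u => h u + k u) = tint s t h + tint s t k.
Proof. by move=> ch ck; rewrite /tint RintegralD//; exact: tint_integrable. Qed.

Lemma tintZ s t c h : continuous h -> tint s t (fun u => c * h u) = c * tint s t h.
Proof. by move=> ch; rewrite /tint RintegralZl//; exact: tint_integrable. Qed.

Lemma tint_cst s t c : s <= t -> tint s t (fun=> c) = c * (t - s).
Proof.
move=> st; rewrite /tint Rintegral_cst//; congr (_ * _).
rewrite -[X in fine X]/(mu _) lebesgue_measure_itv/= lte_fin.
have [_|ts] := ltP s t; first by rewrite -EFinB.
by rewrite (_ : t = s) ?subrr//; apply/eqP; rewrite eq_le st ts.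
Qed.

Lemma tint_le s t h k : continuous h -> continuous k ->
  (forall u, s <= u <= t -> h u <= k u) -> tint s t h <= tint s t k.
Proof.
move=> ch ck hk; apply: le_Rintegral => //; try exact: tint_integrable.
Qed.

Lemma tint_ge0 s t h : (forall u, 0 <= h u) -> 0 <= tint s t h.
Proof. by move=> h0; apply: Rintegral_ge0 => u _. Qed.

Lemma tint_chasles r s t h : continuous h -> r <= s -> s <= t ->
  tint r t h = tint r s h + tint s t h.
Proof.
move=> ch rs st.
have := @Rintegral_itvB R h (BLeft r) (BRight t) s (tint_integrable r t h ch).
rewrite !bnd_simp => /(_ rs st); rewrite -/(tint r t h) -/(tint r s h) => E.
have : \int[mu]_(x in `]s, t]) h x = tint s t h.
  rewrite Rintegral_itv_obnd_cbnd//.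
  apply: integrableS (tint_integrable s t h ch) => //.
  exact: subset_itv_oc_cc.
by move=> <-; rewrite -E addrC subrK.
Qed.

Lemma tint_mono s t t' h : continuous h -> (forall u, 0 <= h u) -> s <= t -> t <= t' ->
  tint s t h <= tint s t' h.
Proof.
by move=> ch h0 st tt; rewrite (tint_chasles s t t')// lerDl; exact: tint_ge0.
Qed.

(** The integral of the square of [h] minus its mean is nonnegative. *)
Lemma tint_cauchy_schwarz s t h : continuous h -> s <= t ->
  (tint s t h) ^+ 2 <= (t - s) * tint s t (fun u => h u ^+ 2).
Proof.
move=> ch st.
have ch2 : continuous (fun u => h u ^+ 2).
  move=> x; apply: (@continuous_comp _ _ _ h (fun y => y ^+ 2)); first exact: ch.
  exact: exprn_continuous.
have [->|tns] := eqVneq s t.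
  rewrite subrr mul0r /tint set_itv1 Rintegral_set1 expr0n//.
have ts : 0 < t - s by rewrite subr_gt0 lt_neqAle tns st.
pose m := tint s t h / (t - s).
have : 0 <= tint s t (fun u => (h u ^+ 2 + (- (2 * m)) * h u) + m ^+ 2).
  apply: tint_ge0 => u; have -> : h u ^+ 2 + - (2 * m) * h u + m ^+ 2 = (h u - m) ^+ 2.
    by ring.
  exact: sqr_ge0.
have c1 : continuous (fun u => - (2 * m) * h u).
  by move=> x; apply: cvgM; [exact: cvg_cst|exact: ch].
have c2 : continuous (fun u => h u ^+ 2 + - (2 * m) * h u).
  by move=> x; apply: cvgD; [exact: ch2|exact: c1].
rewrite tintD//; last by move=> x; exact: cst_continuous.
rewrite tintD// tintZ// tint_cst//.
have E : tint s t h = m * (t - s) by rewrite /m divfK// gt_eqF.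
rewrite !E; set S := tint s t _ => H.
have : 0 <= (t - s) * (S + - (2 * m) * (m * (t - s)) + m ^+ 2 * (t - s)).
  by rewrite mulr_ge0// ltW.
nra.
Qed.

Lemma tint_continuousr s h : continuous h -> continuous (fun t => tint s t h).
Proof.
move=> ch t0.
pose b := Num.max s t0 + 1.
have sb : s <= b by rewrite /b ler_wpDr// le_max lexx.
have t0b : t0 < b by rewrite /b ltr_pwDr// le_max lexx orbT.
pose rho t := Num.max s (Num.min t b).
have crho : continuous rho.
  have [c1 _] := continuous_clip s; have [_ c2] := continuous_clip b.
  by move=> x; apply: (continuous_comp (c2 x)); exact: c1.
have Arho t : `[s, b]%classic (rho t).
  by rewrite /= in_itv/= le_max lexx/= ge_max sb ge_min lexx orbT.
have := continuous_retract _ _ _ crho Arho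
  (parameterized_integral_continuous sb (tint_integrable s b h ch)).
move=> /(_ t0); rewrite /continuous_at.
have E t : t < b -> tint s (rho t) h = tint s t h.
  move=> tb; rewrite /rho (min_idPl (ltW tb)).
  have [//|ts] := leP s t.
  rewrite /tint set_itv1 Rintegral_set1 set_itv_ge ?Rintegral_set0//.
  by rewrite bnd_simp -ltNge.
rewrite -[X in _ --> X]/(tint s (rho t0) h) E//.
apply: cvg_trans; apply: near_eq_cvg.
near=> t; rewrite -[LHS]/(tint s (rho t) h) E//.
by near: t; exact: lt_nbhsl.
Unshelve. all: end_near. Qed.

End TimeIntegral.

Section MoreTint.
Context {R : realType}.

Lemma continuous_sum (I : Type) (r : seq I) (h : I -> R -> R) :
  (forall i, continuous (h i)) -> continuous (fun u => \sum_(i <- r) h i u).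
Proof.
move=> ch; elim: r => [|i r IH].
  by under eq_fun do rewrite big_nil; exact: cst_continuous.
under eq_fun do rewrite big_cons.
by move=> x; apply: cvgD; [exact: ch|exact: IH].
Qed.

Lemma continuous_mul (h k : R -> R) : continuous h -> continuous k ->
  continuous (fun u => h u * k u).
Proof. by move=> ch ck x; apply: cvgM; [exact: ch|exact: ck]. Qed.

Lemma continuous_sqr (h : R -> R) : continuous h -> continuous (fun u => h u ^+ 2).
Proof. by move=> ch; under eq_fun do rewrite expr2; exact: continuous_mul. Qed.

Lemma continuous_enorm_sqr n (Y : R -> 'cV[R]_n) :
  (forall i, continuous (fun u => Y u i ord0)) ->
  continuous (fun u => enorm (Y u) ^+ 2).
Proof.
move=> cY; under eq_fun do rewrite enorm_col_sqr.
by apply: continuous_sum => i; exact: continuous_sqr.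
Qed.

Lemma tint_sum (I : Type) (r : seq I) (h : I -> R -> R) s t :
  (forall i, continuous (h i)) ->
  tint s t (fun u => \sum_(i <- r) h i u) = \sum_(i <- r) tint s t (h i).
Proof.
move=> ch; elim: r => [|i r IH].
  under [X in tint _ _ X]eq_fun do rewrite big_nil.
  rewrite big_nil -[RHS](mul0r (tint s t (cst 0))) -tintZ; last exact: cst_continuous.
  by congr tint; apply/funext => u; rewrite mul0r.
under [X in tint _ _ X]eq_fun do rewrite big_cons.
by rewrite tintD ?IH ?big_cons//; exact: continuous_sum.
Qed.

(** The integral is taken apart into its positive and negative parts, to which
    Tonelli applies. *)
Lemma measurable_tint_param {dO} {O : measurableType dO} (g : R * O -> R) s t :
  measurable_fun setT g -> measurable_fun setT (fun w => tint s t (fun u => g (u, w))).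
Proof.
move=> mg; apply: measurableT_comp; first exact: fine_measurable.
under eq_fun do rewrite integralE.
apply: emeasurable_funB.
  under eq_fun => w.
    under eq_integral do rewrite funeposE -EFin_max.
    over.
  apply: (@measurable_integral_param _ _ _ (fun p => Num.max (g p) 0)) => //.
    by apply: measurable_maxr => //; exact: measurable_cst.
  by move=> p; rewrite le_max lexx orbT.
under eq_fun => w.
  under eq_integral do rewrite funenegE -EFinN -EFin_max.
  over.
apply: (@measurable_integral_param _ _ _ (fun p => Num.max (- g p) 0)) => //.
  by apply: measurable_maxr; [exact: measurable_funN|exact: measurable_cst].
by move=> p; rewrite le_max lexx orbT.
Qed.
End MoreTint.

(** * Energy balance along the paths *)

Section Flow.
Context {R : realType} {d : nat} {dO : measure_display} {O : measurableType dO}.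
Variable P : probability O R.
(** The setting is that of a process with continuous paths whose increments
    split as [X t - X s = noise_part - drift]. Of the stochastic differential
    equation, only the hypotheses [H1], [H2], [H3] on the noise part are used,
    and the square integrability of the initial value. *)
Variables (f : 'cV[R]_d -> R) (g : 'cV[R]_d -> 'cV[R]_d) (xs : 'cV[R]_d) (L D : R).
Hypotheses (L0 : 0 <= L) (D0 : 0 <= D).
Hypothesis gL : forall x y, enorm (g x - g y) ^+ 2 <= L * enorm (x - y) ^+ 2.
Hypothesis desc : forall x y, f y - f x <=
  \sum_i g x i ord0 * (y - x) i ord0 + D * enorm (y - x) ^+ 2.
Hypothesis fmin : forall x, f xs <= f x.
Hypothesis cf : continuous f.
Hypothesis cg : forall i, continuous (fun x => g x i ord0).
Variables (a : R -> R) (a0 : R).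
Hypothesis ca : continuous a.
Hypothesis apos : forall u, 0 <= a u.
Hypothesis aub : forall u, a u <= a0.
Hypothesis adec : forall s t, s <= t -> a t <= a s.
Variable X : R -> O -> 'cV[R]_d.
Hypothesis cX : forall w, continuous (fun t => X t w).
Hypothesis mX : forall t i, measurable_fun setT (fun w => X t w i ord0).

Definition drift s t w : 'cV[R]_d := \col_i tint s t (fun u => a u * g (X u w) i ord0).
Definition noise_part s t w : 'cV[R]_d := X t w - X s w + drift s t w.
Definition incr_sqr s t w := enorm (X t w - X s w) ^+ 2.
Definition grad_sqr t w := enorm (g (X t w)) ^+ 2.

Let cXi w i : continuous (fun t => X t w i ord0).
Proof.
move=> t; apply: (@continuous_comp _ _ _ (fun t => X t w) (fun x => x i ord0)).
  exact: cX.
exact: coord_continuous.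
Qed.
Let cgX w i : continuous (fun t => g (X t w) i ord0).
Proof.
move=> t; apply: (@continuous_comp _ _ _ (fun t => X t w) (fun x => g x i ord0)).
  exact: cX.
exact: cg.
Qed.
Let cagX w i : continuous (fun t => a t * g (X t w) i ord0).
Proof. exact: continuous_mul. Qed.
Let cQ s w : continuous (fun t => incr_sqr s t w).
Proof.
apply: continuous_enorm_sqr => i; under eq_fun do rewrite !mxE.
by move=> x; apply: cvgB; [exact: cXi|exact: cvg_cst].
Qed.
Let cG w : continuous (fun t => grad_sqr t w).
Proof. exact: continuous_enorm_sqr. Qed.
Let cnz s w i : continuous (fun t => noise_part s t w i ord0).
Proof.
under eq_fun do rewrite !mxE.
move=> x; apply: cvgD; first by apply: cvgB; [exact: cXi|exact: cvg_cst].
exact: tint_continuousr.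
Qed.
Let cn s w : continuous (fun t => enorm (noise_part s t w) ^+ 2).
Proof. exact: continuous_enorm_sqr. Qed.

Let Q0 s t w : 0 <= incr_sqr s t w. Proof. exact: sqr_ge0. Qed.
Let G0 t w : 0 <= grad_sqr t w. Proof. exact: sqr_ge0. Qed.
Let a00 : 0 <= a0. Proof. exact: le_trans (apos 0) (aub 0). Qed.

Let drift_le s u t w : s <= u -> u <= t ->
  enorm (drift s u w) ^+ 2 <= (t - s) * a0 ^+ 2 * tint s t (grad_sqr ^~ w).
Proof.
move=> su ut.
apply: (@le_trans _ _ ((t - s) * a0 ^+ 2 * tint s u (grad_sqr ^~ w))); last first.
  rewrite ler_wpM2l ?mulr_ge0 ?sqr_ge0 ?subr_ge0 ?(le_trans su)//.
  by apply: tint_mono.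
have -> : tint s u (grad_sqr ^~ w) = \sum_i tint s u (fun r => g (X r w) i ord0 ^+ 2).
  rewrite -tint_sum; last by move=> i; exact: continuous_sqr.
  by congr tint; apply/funext => r; rewrite /grad_sqr enorm_col_sqr.
rewrite enorm_col_sqr mulr_sumr; apply: ler_sum => i _; rewrite mxE.
apply: le_trans (tint_cauchy_schwarz s u _ (cagX w i) su) _.
rewrite -mulrA ler_pM ?subr_ge0 ?lerB//.
  by apply: tint_ge0 => r; exact: sqr_ge0.
rewrite -tintZ; last exact: continuous_sqr.
apply: tint_le; first exact: continuous_sqr.
  by apply: continuous_mul; [exact: cst_continuous|exact: continuous_sqr].
move=> r _; rewrite exprMn ler_wpM2r ?sqr_ge0// lerXn2r// nnegrE//.
Qed.

Let G_le s r w : grad_sqr r w <= 2 * grad_sqr s w + 2 * L * incr_sqr s r w.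
Proof.
have := enorm_sqrD _ _ (g (X s w)) (g (X r w) - g (X s w)).
rewrite [X in enorm X]addrC subrK => h; apply: le_trans h _.
rewrite lerD2l -mulrA ler_wpM2l//; exact: gL.
Qed.

Let intG_le s t w : s <= t ->
  tint s t (grad_sqr ^~ w) <=
    2 * (t - s) * grad_sqr s w + 2 * L * tint s t (fun r => incr_sqr s r w).
Proof.
move=> st; rewrite -tintZ// mulrAC -tint_cst//.
rewrite -tintD; last 2 first.
- exact: cst_continuous.
- by apply: continuous_mul; [exact: cst_continuous|exact: cQ].
apply: tint_le; [exact: cG| |by move=> r _; exact: G_le].
move=> x; apply: cvgD; first exact: cvg_cst.
by apply: cvgM; [exact: cvg_cst|exact: cQ].
Qed.

Let Q_le s u t w : s <= u -> u <= t ->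
  incr_sqr s u w <= 4 * (t - s) ^+ 2 * a0 ^+ 2 * grad_sqr s w +
    4 * (t - s) * a0 ^+ 2 * L * tint s t (fun r => incr_sqr s r w) +
    2 * enorm (noise_part s u w) ^+ 2.
Proof.
move=> su ut; have st := le_trans su ut.
have h1 : incr_sqr s u w <= 2 * enorm (noise_part s u w) ^+ 2 + 2 * enorm (drift s u w) ^+ 2.
  rewrite /incr_sqr (_ : X u w - X s w = noise_part s u w - drift s u w); last first.
    by rewrite /noise_part addrK.
  exact: enorm_sqrB.
have h2 := drift_le s u t w su ut; have h3 := intG_le s t w st.
have c0 : 0 <= (t - s) * a0 ^+ 2 by rewrite mulr_ge0 ?sqr_ge0 ?subr_ge0.
have h4 := ler_wpM2l c0 h3; nra.
Qed.

(** Integrating [Q_le] over a short interval, the displacement on the right is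
    absorbed by the one on the left: a Gronwall argument in one step. *)
Let intQ_le s t w : s <= t -> 8 * (t - s) ^+ 2 * a0 ^+ 2 * L <= 1 ->
  tint s t (fun r => incr_sqr s r w) <= 8 * (t - s) ^+ 3 * a0 ^+ 2 * grad_sqr s w +
    4 * tint s t (fun r => enorm (noise_part s r w) ^+ 2).
Proof.
move=> st small; set I := tint s t (fun r => incr_sqr s r w).
set n := tint s t (fun r => enorm (noise_part s r w) ^+ 2).
pose c1 := 4 * (t - s) ^+ 2 * a0 ^+ 2 * grad_sqr s w + 4 * (t - s) * a0 ^+ 2 * L * I.
have h : I <= c1 * (t - s) + 2 * n.
  rewrite -tint_cst// /n -tintZ// -tintD; last 2 first.
  - exact: cst_continuous.
  - by apply: continuous_mul; [exact: cst_continuous|exact: cn].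
  apply: tint_le => //.
    move=> x; apply: cvgD; first exact: cvg_cst.
    by apply: cvgM; [exact: cvg_cst|exact: cn].
  by move=> r /andP[sr rt]; exact: Q_le.
have I0 : 0 <= I by exact: tint_ge0.
have := ler_wpM2r I0 small; rewrite mul1r => h2.
have E : c1 * (t - s) = 4 * (t - s) ^+ 3 * a0 ^+ 2 * grad_sqr s w +
  (8 * (t - s) ^+ 2 * a0 ^+ 2 * L * I) / 2 by rewrite /c1; field.
rewrite E in h; lra.
Qed.

(** The drift is aligned with the gradient at time [s] up to the displacement.
    By polarisation, the inner product of two gradients is half the sum of
    their squares minus half the square of their difference, and that
    difference is controlled by the Lipschitz constant. This keeps half of the
    dissipation and needs no smallness. *)
Let drift_corr s t w : s <= t ->
  (t - s) * a t / 2 * grad_sqr s w - a0 * L / 2 * tint s t (fun r => incr_sqr s r w) <=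
  \sum_i g (X s w) i ord0 * drift s t w i ord0.
Proof.
move=> st.
have -> : \sum_i g (X s w) i ord0 * drift s t w i ord0 =
    tint s t (fun u => \sum_i g (X s w) i ord0 * (a u * g (X u w) i ord0)).
  rewrite tint_sum; last first.
    by move=> i; apply: continuous_mul; [exact: cst_continuous|exact: cagX].
  by apply: eq_bigr => i _; rewrite mxE tintZ.
have -> : (t - s) * a t / 2 * grad_sqr s w = (a t / 2 * grad_sqr s w) * (t - s) by ring.
rewrite -tint_cst// -mulNr -tintZ// -tintD; last 2 first.
- exact: cst_continuous.
- by apply: continuous_mul; [exact: cst_continuous|exact: cQ].
apply: tint_le.
- move=> x; apply: cvgD; first exact: cvg_cst.
  by apply: cvgM; [exact: cvg_cst|exact: cQ].
- apply: continuous_sum => i.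
  by apply: continuous_mul; [exact: cst_continuous|exact: cagX].
move=> u /andP[su ut].
have E : \sum_i g (X s w) i ord0 * (a u * g (X u w) i ord0) =
   a u / 2 * (grad_sqr s w + grad_sqr u w - enorm (g (X u w) - g (X s w)) ^+ 2).
  rewrite /grad_sqr !enorm_col_sqr -big_split/= -sumrB mulr_sumr.
  by apply: eq_bigr => i _; rewrite !mxE; field.
rewrite E.
have h1 := gL (X u w) (X s w); rewrite -/(incr_sqr s u w) in h1.
have h2 := adec _ _ ut; have h3 := apos u; have h4 := aub u.
have h5 := G0 u w; have h6 := G0 s w; have h7 := Q0 s u w.
have LQ : 0 <= L * incr_sqr s u w by exact: mulr_ge0.
have k1 : a t * grad_sqr s w <= a u * grad_sqr s w by rewrite ler_wpM2r.
have k2 : a u * (L * incr_sqr s u w) <= a0 * (L * incr_sqr s u w) by rewrite ler_wpM2r.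
have k3 : 0 <= a u * grad_sqr u w by rewrite mulr_ge0.
have k4 := ler_wpM2l h3 h1.
lra.
Qed.

Let mgX t i : measurable_fun setT (fun w => g (X t w) i ord0).
Proof. by apply: (measurable_continuous_comp (fun x => g x i ord0)). Qed.

Let mdrift s t i : measurable_fun setT (fun w => drift s t w i ord0).
Proof.
under eq_fun do rewrite mxE.
apply: (measurable_tint_param (fun p => a p.1 * g (X p.1 p.2) i ord0)).
apply: measurable_funM.
  by apply: measurableT_comp; [exact: continuous_measurable_fun|exact: measurable_fst].
exact: (measurable_continuous_process (fun t w => g (X t w) i ord0)).
Qed.

Let mnz s t : vmeas d (noise_part s t).
Proof.
move=> i; under eq_fun do rewrite !mxE -/(drift s t _).
apply: measurable_funD; first exact: measurable_funB.
by have := mdrift s t i; under eq_fun do rewrite mxE.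
Qed.

Let mQ s t : measurable_fun setT (incr_sqr s t).
Proof. by apply: vmeas_enorm => i; under eq_fun do rewrite !mxE; exact: measurable_funB. Qed.
Let mG t : measurable_fun setT (grad_sqr t).
Proof. by apply: vmeas_enorm => i. Qed.

Let mint (h : R -> O -> R) s t : (forall u, measurable_fun setT (h u)) ->
  (forall w, continuous (h ^~ w)) ->
  measurable_fun setT (fun w => tint s t (h ^~ w)).
Proof.
move=> mh ch; apply: (measurable_tint_param (fun p => h p.1 p.2)).
exact: measurable_continuous_process.
Qed.

Variable c : R.
Hypothesis c0 : 0 <= c.
Hypothesis H1 : forall s t i, 0 <= s -> s <= t -> L2 P (fun w => noise_part s t w i ord0).
Hypothesis H2 : forall s t, 0 <= s -> s <= t ->
  (nsq P d (noise_part s t) <= (c * a s ^+ 2 * (t - s))%:E)%E.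
Hypothesis H3 : forall s t i, 0 <= s -> s <= t -> L2 P (fun w => g (X s w) i ord0) ->
  Ex P (fun w => g (X s w) i ord0 * noise_part s t w i ord0) = 0.

Definition sqint_at t := forall i, L2 P (fun w => X t w i ord0).

Let int_n s t : 0 <= s -> s <= t ->
  L1 P (fun w => tint s t (fun r => enorm (noise_part s r w) ^+ 2)) /\
  Ex P (fun w => tint s t (fun r => enorm (noise_part s r w) ^+ 2)) <= c * a0 ^+ 2 * (t - s) ^+ 2.
Proof.
move=> s0 st.
have mn u : measurable_fun setT (fun w => enorm (noise_part s u w) ^+ 2).
  by apply: vmeas_enorm.
apply: L1_of_le.
- exact: (mint (fun r w => enorm (noise_part s r w) ^+ 2)).
- by move=> w; apply: tint_ge0 => r; exact: sqr_ge0.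
under eq_integral do rewrite EFin_tint//.
rewrite (tonelli_param P (fun p => enorm (noise_part s p.1 p.2) ^+ 2))//; last 2 first.
- exact: (measurable_continuous_process (fun r w => enorm (noise_part s r w) ^+ 2)).
- by move=> p; exact: sqr_ge0.
have -> : c * a0 ^+ 2 * (t - s) ^+ 2 = tint s t (fun=> c * a0 ^+ 2 * (t - s)).
  by rewrite tint_cst//; ring.
rewrite EFin_tint; last exact: cst_continuous.
apply: ge0_le_integral => //.
- by move=> u _; apply: integral_ge0 => w _; rewrite lee_fin sqr_ge0.
- apply: measurable_funTS.
  apply: (@measurable_fun_fubini_tonelli_F _ _ _ _ _ P
    (fun p => (enorm (noise_part s p.1 p.2) ^+ 2)%:E)).
    apply/measurable_EFinP.
    exact: (measurable_continuous_process (fun r w => enorm (noise_part s r w) ^+ 2)).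
  by move=> p; rewrite lee_fin sqr_ge0.
move=> u /=; rewrite in_itv/= => /andP[su ut].
apply: le_trans (H2 s u s0 su) _; rewrite lee_fin ler_pM ?mulr_ge0 ?sqr_ge0 ?subr_ge0//.
  by rewrite ler_wpM2l// lerXn2r// nnegrE.
by rewrite lerB.
Qed.

Let L1_Q s t : sqint_at s -> sqint_at t -> L1 P (incr_sqr s t).
Proof.
move=> hs ht; apply: L1_nsq => i.
by under [X in L2 _ X]eq_fun do rewrite !mxE; exact: L2B.
Qed.

Lemma L2_gX t i : sqint_at t -> L2 P (fun w => g (X t w) i ord0).
Proof.
move=> ht; split; first exact: mgX.
apply: (L1_le P _ (fun w => 2 * enorm (g xs) ^+ 2 + 2 * L * enorm (X t w - xs) ^+ 2)).
- by apply: measurable_funX; exact: mgX.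
- apply: L1D; first exact: L1_cst.
  apply: L1Z; apply: L1_nsq => j.
  under [X in L2 _ X]eq_fun do rewrite !mxE.
  by apply: L2B => //; exact: L2_cst.
- move=> w; rewrite ger0_norm ?sqr_ge0//.
  have h : g (X t w) i ord0 ^+ 2 <= grad_sqr t w.
    exact: sqr_entry_le.
  apply: le_trans h _.
  have := enorm_sqrD _ _ (g xs) (g (X t w) - g xs).
  rewrite [X in enorm X]addrC subrK => h; apply: le_trans h _.
  by rewrite lerD2l -mulrA ler_wpM2l//; exact: gL.
Qed.

Lemma L1_G t : sqint_at t -> L1 P (grad_sqr t).
Proof. by move=> ht; apply: L1_nsq => i; exact: L2_gX. Qed.

Lemma L1_fX t : sqint_at t -> L1 P (fun w => f (X t w)).
Proof.
move=> ht.
have iq : L1 P (fun w => enorm (X t w - xs) ^+ 2).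
  apply: L1_nsq => j; under [X in L2 _ X]eq_fun do rewrite !mxE.
  by apply: L2B => //; exact: L2_cst.
apply: (L1_le P _ (fun w => (`|f xs| + enorm (g xs) ^+ 2) + (1 + D) * enorm (X t w - xs) ^+ 2)).
- exact: (measurable_continuous_comp f).
- by apply: L1D; [exact: L1_cst|exact: L1Z].
move=> w; have h1 := fmin (X t w); have h2 := desc xs (X t w).
have h3 : \sum_i g xs i ord0 * (X t w - xs) i ord0 <=
    enorm (g xs) ^+ 2 + enorm (X t w - xs) ^+ 2.
  rewrite !enorm_col_sqr -big_split; apply: ler_sum => i _ /=.
  have := sqr_ge0 (g xs i ord0 - (X t w - xs) i ord0).
  have := sqr_ge0 (g xs i ord0 + (X t w - xs) i ord0); nra.
have h4 := ler_norm (f xs); have h5 := ler_norm (- f xs); rewrite normrN in h5.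
have h6 : 0 <= enorm (g xs) ^+ 2 by exact: sqr_ge0.
have h7 : 0 <= (1 + D) * enorm (X t w - xs) ^+ 2 by rewrite mulr_ge0 ?sqr_ge0// addr_ge0.
by rewrite ler_norml; apply/andP; split; lra.
Qed.

(** The mean integrated squared displacement over [s, t] is at most
    [W s * (t - s) ^+ 2]. *)
Let W s := 8 * a0 ^+ 2 * Ex P (grad_sqr s) + 4 * (c * a0 ^+ 2).

Let L1_intQ s t : 0 <= s -> s <= t -> 8 * (t - s) ^+ 2 * a0 ^+ 2 * L <= 1 ->
  t - s <= 1 -> sqint_at s ->
  L1 P (fun w => tint s t (fun r => incr_sqr s r w)) /\
  Ex P (fun w => tint s t (fun r => incr_sqr s r w)) <= W s * (t - s) ^+ 2.
Proof.
move=> s0 st small ts1 hs; have [i1 b1] := int_n s t s0 st.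
have iG := L1_G s hs.
have iR : L1 P (fun w => 8 * (t - s) ^+ 3 * a0 ^+ 2 * grad_sqr s w +
    4 * tint s t (fun r => enorm (noise_part s r w) ^+ 2)).
  by apply: L1D; exact: L1Z.
have iI : L1 P (fun w => tint s t (fun r => incr_sqr s r w)).
  apply: (L1_le _ _ _ _ iR); first exact: (mint (fun r w => incr_sqr s r w)).
  by move=> w; rewrite ger0_norm; [exact: intQ_le|exact: tint_ge0].
split => //; apply: le_trans (Ex_le P _ _ iI iR (fun w => intQ_le s t w st small)) _.
rewrite ExD; [|exact: L1Z..].
rewrite !ExZ// /W [leRHS]mulrDl; apply: lerD; last first.
  by rewrite -[leRHS]mulrA ler_wpM2l.
have ts0 : 0 <= t - s by rewrite subr_ge0.
have EG0 : 0 <= Ex P (grad_sqr s) by exact: Ex_ge0.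
have -> : 8 * (t - s) ^+ 3 * a0 ^+ 2 * Ex P (grad_sqr s) =
  8 * a0 ^+ 2 * Ex P (grad_sqr s) * (t - s) ^+ 2 * (t - s) by ring.
by rewrite ler_piMr// !mulr_ge0// sqr_ge0.
Qed.

(** The expected descent inequality between [s] and [t]. The linear term is
    split into noise, which vanishes in the mean by [H3], and drift, estimated by
    [drift_corr]; the quadratic term is of first order in [t - s] only through
    the noise. *)
Lemma flow_step s t : 0 <= s -> s <= t -> 8 * (t - s) ^+ 2 * a0 ^+ 2 * L <= 1 ->
  t - s <= 1 -> sqint_at s ->
  [/\ sqint_at t,
   Ex P (incr_sqr s t) <= (4 * a0 ^+ 2 * Ex P (grad_sqr s) + 4 * a0 ^+ 2 * L * W s) * (t - s) ^+ 2
     + 2 * (c * a s ^+ 2 * (t - s)) &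
   Ex P (fun w => f (X t w)) <= Ex P (fun w => f (X s w))
     - (t - s) * a t / 2 * Ex P (grad_sqr s) + a0 * L / 2 * (W s * (t - s) ^+ 2)
     + D * Ex P (incr_sqr s t)].
Proof.
move=> s0 st small ts1 hs.
have [iI bI] := L1_intQ s t s0 st small ts1 hs.
have ts0 : 0 <= t - s by rewrite subr_ge0.
have iG := L1_G s hs.
have [inn bn] := L1_of_le P _ _ (vmeas_enorm _ _ (mnz s t)) (fun w => sqr_ge0 _) (H2 s t s0 st).
pose rhs w := 4 * (t - s) ^+ 2 * a0 ^+ 2 * grad_sqr s w +
    4 * (t - s) * a0 ^+ 2 * L * tint s t (fun r => incr_sqr s r w) +
    2 * enorm (noise_part s t w) ^+ 2.
have iR : L1 P rhs by apply: L1D; [apply: L1D; exact: L1Z|exact: L1Z].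
have iQ : L1 P (incr_sqr s t).
  apply: (L1_le _ _ _ (mQ s t) iR) => w; rewrite ger0_norm//; exact: Q_le.
have ht : sqint_at t.
  move=> i; have hD : L2 P (fun w => X t w i ord0 - X s w i ord0).
    split; first exact: measurable_funB.
    apply: (L1_le _ _ _ _ iQ); first by apply: measurable_funX; exact: measurable_funB.
    move=> w; rewrite ger0_norm ?sqr_ge0//.
    by have := sqr_entry_le _ (X t w - X s w) i; rewrite !mxE.
  have := L2D _ _ _ hD (hs i); by under [X in L2 _ X -> _]eq_fun do rewrite subrK.
have W0 : 0 <= W s.
  by rewrite addr_ge0 ?mulr_ge0 ?sqr_ge0// Ex_ge0.
split => //.
  apply: le_trans (Ex_le P _ rhs iQ iR (fun w => Q_le s t t w st (lexx t))) _.
  rewrite /rhs ExD; [|by apply: L1D; exact: L1Z|exact: L1Z].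
  rewrite ExD; [|exact: L1Z..]; rewrite !ExZ//.
  set k := 4 * a0 ^+ 2 * L.
  have k0 : 0 <= k by rewrite !mulr_ge0 ?sqr_ge0.
  have h1 := ler_wpM2l (mulr_ge0 k0 ts0) bI.
  have h2 : k * (t - s) * (W s * (t - s) ^+ 2) <= k * (W s * (t - s) ^+ 2).
    rewrite -mulrA ler_wpM2l// ler_piMl// mulr_ge0// sqr_ge0//.
  set I := Ex P (fun w => tint _ _ _) in h1 *; set n := Ex P _ in bn *.
  have -> : 4 * (t - s) * a0 ^+ 2 * L * I = k * (t - s) * I by rewrite /k; ring.
  rewrite [X in _ <= X + _]mulrDl.
  have -> : 4 * (t - s) ^+ 2 * a0 ^+ 2 * Ex P (grad_sqr s) =
    4 * a0 ^+ 2 * Ex P (grad_sqr s) * (t - s) ^+ 2 by ring.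
  rewrite -[k * W s * _]mulrA; apply: lerD; last by rewrite ler_wpM2l.
  by rewrite lerD2l (le_trans h1).
have igD i : L1 P (fun w => g (X s w) i ord0 * (X t w i ord0 - X s w i ord0)).
  by apply: L2_mul; [exact: L2_gX|exact: L2B].
have ign i : L1 P (fun w => g (X s w) i ord0 * noise_part s t w i ord0).
  by apply: L2_mul; [exact: L2_gX|exact: H1].
have iB := L1_sum P _ (index_enum 'I_d) _ ign.
pose low w := (t - s) * a t / 2 * grad_sqr s w - a0 * L / 2 * tint s t (fun r => incr_sqr s r w).
have ilow : L1 P low by apply: L1B; exact: L1Z.
pose up w := f (X s w) + (\sum_i g (X s w) i ord0 * noise_part s t w i ord0 - low w) +
  D * incr_sqr s t w.
have iup : L1 P up.
  apply: L1D; last exact: L1Z.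
  by apply: L1D; [exact: L1_fX|exact: L1B].
have le_up w : f (X t w) <= up w.
  have h1 := desc (X s w) (X t w); rewrite -/(incr_sqr s t w) in h1.
  have h2 := drift_corr s t w st; rewrite -/(low w) in h2.
  have E : \sum_i g (X s w) i ord0 * (X t w - X s w) i ord0 =
     \sum_i g (X s w) i ord0 * noise_part s t w i ord0 -
     \sum_i g (X s w) i ord0 * drift s t w i ord0.
    rewrite -sumrB; apply: eq_bigr => i _; rewrite -mulrBr; congr (_ * _).
    by rewrite /noise_part [in RHS]mxE addrK.
  rewrite E in h1; rewrite /up; lra.
apply: le_trans (Ex_le P _ _ (L1_fX t ht) iup le_up) _.
rewrite /up ExD; [|by apply: L1D; [exact: L1_fX|exact: L1B]|exact: L1Z].
rewrite ExZ// lerD2r ExD; [|exact: L1_fX|exact: L1B].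
rewrite -addrA lerD2l ExB// Ex_sum// big1 ?add0r; last first.
  by move=> i _; apply: H3 => //; exact: L2_gX.
rewrite /low ExB; [|exact: L1Z..]; rewrite !ExZ//.
have hb : 0 <= a0 * L / 2 by rewrite !mulr_ge0// invr_ge0.
have := ler_wpM2l hb bI; lra.
Qed.

Let Ex_G_le s t : sqint_at s -> sqint_at t ->
  Ex P (grad_sqr t) <= 2 * Ex P (grad_sqr s) + 2 * L * Ex P (incr_sqr s t).
Proof.
move=> hs ht; have iG := L1_G s hs; have iQ := L1_Q s t hs ht.
rewrite -!ExZ// -ExD; [|exact: L1Z..].
apply: Ex_le; [exact: L1_G|by apply: L1D; exact: L1Z|by move=> w; exact: G_le].
Qed.

(** A length of the intervals to which [flow_step] applies, uniform in time. *)
Let h0 := (1 + 8 * a0 ^+ 2 * L)^-1.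
Let den0 : 0 <= 8 * a0 ^+ 2 * L. Proof. by rewrite !mulr_ge0 ?sqr_ge0. Qed.
Let h0_gt0 : 0 < h0. Proof. by rewrite invr_gt0 ltr_wpDr. Qed.

Let small s t : s <= t -> t <= s + h0 ->
  8 * (t - s) ^+ 2 * a0 ^+ 2 * L <= 1 /\ t - s <= 1.
Proof.
move=> st; rewrite -lerBlDl => th.
have ts0 : 0 <= t - s by rewrite subr_ge0.
have h1 : h0 <= 1 by rewrite invf_le1 ?lerDl// ltr_wpDr.
have ts1 : t - s <= 1 by exact: le_trans h1.
split => //.
have E : h0 * (1 + 8 * a0 ^+ 2 * L) = 1 by rewrite mulVf// gt_eqF// ltr_wpDr.
have k1 : (t - s) ^+ 2 <= h0 by rewrite expr2 (le_trans _ th)// ler_piMl.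
have := ler_wpM2r den0 k1; lra.
Qed.

Lemma sqint_all : sqint_at 0 -> forall t, 0 <= t -> sqint_at t.
Proof.
move=> hs0.
have step n t : 0 <= t -> t <= n%:R * h0 -> sqint_at t.
  elim: n t => [|n IH] t t0.
    by rewrite mul0r => t0'; rewrite (_ : t = 0)//; apply/eqP; rewrite eq_le t0 t0'.
  rewrite -natr1 mulrDl mul1r => tn.
  have [tn'|nt] := leP t (n%:R * h0); first exact: IH.
  have n0 : 0 <= n%:R * h0 by rewrite mulr_ge0// ltW.
  have [s1 s2] := small _ _ (ltW nt) tn.
  by have [] := flow_step _ t n0 (ltW nt) s1 s2 (IH _ n0 (lexx _)).
move=> t t0; apply: (step (Num.bound (t / h0)) t t0).
have b0 : 0 <= t / h0 by rewrite divr_ge0// ltW.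
by rewrite -ler_pdivrMr// ltW// archi_boundP.
Qed.

Hypothesis sq0 : sqint_at 0.
Local Notation v t := (Ex P (fun w => f (X t w)) - f xs).

(** This plays the part of the differential inequality
    [v' <= - a / 2 * E |grad f|^2 + 2 * D * c * a ^+ 2], of the kind that Ito's
    formula gives; the constant in front of the quadratic error may depend on
    [s], since the comparison with the barrier is local in time. *)
Lemma flow_right s : 0 <= s -> exists2 h : R, 0 < h & exists2 K : R, 0 <= K &
  forall t, s <= t <= s + h -> v t <= v s - (t - s) * a t / 2 * Ex P (grad_sqr s) +
    2 * D * c * a s ^+ 2 * (t - s) + K * (t - s) ^+ 2.
Proof.
move=> s0; exists h0 => //; have hs := sqint_all sq0 s s0.
have EG0 : 0 <= Ex P (grad_sqr s) by exact: Ex_ge0.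
have W0 : 0 <= W s by rewrite addr_ge0 ?mulr_ge0 ?sqr_ge0.
exists (a0 * L / 2 * W s + D * (4 * a0 ^+ 2 * Ex P (grad_sqr s) + 4 * a0 ^+ 2 * L * W s)).
  by rewrite addr_ge0 ?mulr_ge0 ?addr_ge0 ?mulr_ge0 ?sqr_ge0 ?invr_ge0.
move=> t /andP[st th]; have [s1 s2] := small _ _ st th.
have [_ e1 e2] := flow_step s t s0 st s1 s2 hs.
have := ler_wpM2l D0 e1; lra.
Qed.

(** Upward jumps of [v] at [s] have to be excluded from the left as well, with a
    constant uniform in the left end point [u]; the moments at [u] are bounded
    in terms of those at the fixed earlier time [r]. *)
Lemma flow_left s : 0 < s -> exists2 h : R, 0 < h & exists2 K : R, 0 <= K &
  forall u, 0 <= u < s -> s - h <= u -> v s <= v u + K * (s - u).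
Proof.
move=> s0; exists h0 => //; pose r := Num.max 0 (s - h0).
have r0 : 0 <= r by rewrite le_max lexx.
have hr := sqint_all sq0 r r0.
pose Kr := 4 * a0 ^+ 2 * Ex P (grad_sqr r) + 4 * a0 ^+ 2 * L * W r + 2 * (c * a0 ^+ 2).
pose g1 := 2 * Ex P (grad_sqr r) + 2 * L * Kr.
have EGr : 0 <= Ex P (grad_sqr r) by exact: Ex_ge0.
have Wr : 0 <= W r by rewrite addr_ge0 ?mulr_ge0 ?sqr_ge0.
have ca02 : 0 <= c * a0 ^+ 2 by rewrite mulr_ge0 ?sqr_ge0.
have Kr0 : 0 <= Kr by rewrite !addr_ge0 ?mulr_ge0 ?sqr_ge0.
have g10 : 0 <= g1 by rewrite addr_ge0 ?mulr_ge0.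
pose W1 := 8 * a0 ^+ 2 * g1 + 4 * (c * a0 ^+ 2).
have W10 : 0 <= W1 by rewrite addr_ge0 ?mulr_ge0 ?sqr_ge0.
have asq x : c * a x ^+ 2 <= c * a0 ^+ 2 by rewrite ler_wpM2l// lerXn2r// nnegrE.
have Qbound x y : 0 <= x -> x <= y -> y <= x + h0 -> sqint_at x ->
    Ex P (incr_sqr x y) <= (4 * a0 ^+ 2 * Ex P (grad_sqr x) + 4 * a0 ^+ 2 * L * W x +
      2 * (c * a0 ^+ 2)) * (y - x).
  move=> x0 xy yh hx; have [s1 s2] := small _ _ xy yh.
  have [_ e1 _] := flow_step x y x0 xy s1 s2 hx.
  have yx0 : 0 <= y - x by rewrite subr_ge0.
  have y2 : (y - x) ^+ 2 <= y - x by rewrite expr2 ler_piMl.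
  have EGx : 0 <= Ex P (grad_sqr x) by exact: Ex_ge0.
  have Wx : 0 <= W x by rewrite addr_ge0 ?mulr_ge0 ?sqr_ge0.
  have k0 : 0 <= 4 * a0 ^+ 2 * Ex P (grad_sqr x) + 4 * a0 ^+ 2 * L * W x.
    by rewrite addr_ge0 ?mulr_ge0 ?sqr_ge0.
  have e2 := ler_wpM2l k0 y2; have e3 := ler_wpM2r yx0 (asq x).
  apply: le_trans e1 _; rewrite [leRHS]mulrDl; apply: lerD => //.
  by rewrite -[leRHS]mulrA ler_wpM2l.
exists (a0 * L / 2 * W1 + D * (4 * a0 ^+ 2 * g1 + 4 * a0 ^+ 2 * L * W1 + 2 * (c * a0 ^+ 2))).
  by apply: addr_ge0; rewrite mulr_ge0 ?mulr_ge0 ?invr_ge0// !addr_ge0 ?mulr_ge0 ?sqr_ge0.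
move=> u /andP[u0 us] su.
have ru : r <= u by rewrite ge_max u0 su.
have urh : u <= r + h0.
  by rewrite (le_trans (ltW us))// -lerBlDr le_max lexx orbT.
have ush : s <= u + h0 by rewrite -lerBlDr.
have hu := sqint_all sq0 u u0.
have EGu : Ex P (grad_sqr u) <= g1.
  apply: le_trans (Ex_G_le r u hr hu) _; rewrite lerD2l ler_wpM2l ?mulr_ge0//.
  apply: le_trans (Qbound r u r0 ru urh hr) _; rewrite -/Kr ler_piMr//.
  by have [] := small _ _ ru urh.
have Wu : W u <= W1 by rewrite /W /W1 lerD2r ler_wpM2l ?mulr_ge0 ?sqr_ge0.
have [s1 s2] := small _ _ (ltW us) ush.
have [_ _ e2] := flow_step u s u0 (ltW us) s1 s2 hu.
have e1 := Qbound u s u0 (ltW us) ush hu.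
have su0 : 0 <= s - u by rewrite subr_ge0 ltW.
have p1 : 0 <= (s - u) * a s / 2 * Ex P (grad_sqr u).
  by rewrite !mulr_ge0 ?invr_ge0// Ex_ge0.
have p2 : a0 * L / 2 * (W u * (s - u) ^+ 2) <= a0 * L / 2 * W1 * (s - u).
  rewrite -[leRHS]mulrA ler_wpM2l ?mulr_ge0 ?invr_ge0//.
  apply: le_trans (ler_wpM2r (sqr_ge0 _) Wu) _.
  by rewrite ler_wpM2l// expr2 ler_piMl.
have b0 : 0 <= 4 * a0 ^+ 2 by rewrite mulr_ge0 ?sqr_ge0.
have b1 := ler_wpM2l b0 EGu; have b2 := ler_wpM2l (mulr_ge0 b0 L0) Wu.
have p3 : D * Ex P (incr_sqr u s) <=
    D * (4 * a0 ^+ 2 * g1 + 4 * a0 ^+ 2 * L * W1 + 2 * (c * a0 ^+ 2)) * (s - u).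
  rewrite -[leRHS]mulrA ler_wpM2l// (le_trans e1)// ler_wpM2r// lerD2r lerD//.
rewrite mulrDl; lra.
Qed.
End Flow.

(** * Smooth functions and the noise coefficient *)

Section Descent.
Context {R : realType} {d : nat}.
Variables (f : 'cV[R]_d -> R) (L : R).
Hypothesis hf : C1 f.
Hypothesis hL : 0 <= L.
Hypothesis A1 : forall x y, enorm (grad f x - grad f y) <= L * enorm (x - y).
Local Notation g := (grad f).
Local Notation e i := (delta_mx i ord0 : 'cV[R]_d).

Lemma enorm_le_entries m n (A B : 'M[R]_(m, n)) :
  (forall i j, `|A i j| <= `|B i j|) -> enorm A <= enorm B.
Proof.
move=> AB; rewrite /enorm ler_sqrt; last first.
  by apply: sumr_ge0 => i _; apply: sumr_ge0 => j _; exact: sqr_ge0.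
apply: ler_sum => i _; apply: ler_sum => j _.
by rewrite -[leLHS]real_normK ?num_real// -[leRHS]real_normK ?num_real// lerXn2r// nnegrE.
Qed.

Let is_derive_line (x : 'cV[R]_d) i (s : R) :
  is_derive s (1 : R) (fun r : R => f (x + r *: e i)) (partial f i (x + s *: e i)).
Proof.
have [h _] := hf i.
have dE : (fun h : R => h^-1 *: (((fun r : R => f (x + r *: e i)) \o shift s) (h *: (1 : R)) -
    f (x + s *: e i))) =
  (fun h : R => h^-1 *: ((f \o shift (x + s *: e i)) (h *: e i) - f (x + s *: e i))).
  apply/funext => r /=; congr (_ *: (f _ - _)).
  by rewrite [r *: 1]mulr1 scalerDl addrCA.
have := h (x + s *: e i); rewrite /derivable -dE => h'.
by split => //; rewrite /partial /derive -dE.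
Qed.

(** Only partial derivatives are at hand, so the mean value theorem is applied
    along one coordinate at a time. *)
Lemma coordinate_mvt (x z : 'cV[R]_d) i (r K : R) : 0 <= K ->
  (forall c, `|c| <= `|r| -> `|g (x + c *: e i) i ord0 - g z i ord0| <= K) ->
  `|f (x + r *: e i) - f x - r * g z i ord0| <= `|r| * K.
Proof.
move=> K0 hK; pose phi s := f (x + s *: e i).
have phi0 : f x = phi 0 by rewrite /phi scale0r addr0.
have gE y : g y i ord0 = partial f i y by rewrite mxE.
have cphi : continuous phi.
  move=> s; apply: differentiable_continuous; apply/derivable1_diffP.
  by have [] := is_derive_line x i s.
have key a b : a < b -> exists2 c, a < c < b &
    phi b - phi a = g (x + c *: e i) i ord0 * (b - a).
  move=> ab.
  have [c cab E] := @MVT R phi (fun s => partial f i (x + s *: e i)) a b ab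
    (fun s _ => is_derive_line x i s) (continuous_subspaceT cphi).
  by exists c; [move: cab; rewrite in_itv|rewrite gE].
have [r0|r0|r0] := ltgtP r 0.
- have [c /andP[c1 c2] E] := key r 0 r0.
  have -> : f (x + r *: e i) - f x - r * g z i ord0 =
    r * (g (x + c *: e i) i ord0 - g z i ord0).
    by rewrite -/(phi r) phi0; lra.
  rewrite normrM ler_wpM2l// hK// ltr0_norm// ltr0_norm//; lra.
- have [c /andP[c1 c2] E] := key 0 r r0.
  have -> : f (x + r *: e i) - f x - r * g z i ord0 =
    r * (g (x + c *: e i) i ord0 - g z i ord0).
    by rewrite -/(phi r) phi0; lra.
  rewrite normrM ler_wpM2l// hK// gtr0_norm// gtr0_norm// ltW//.
- by rewrite r0 scale0r addr0 subrr mul0r subrr normr0 mul0r.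
Qed.

Definition coordinate_path (x y : 'cV[R]_d) (k : nat) : 'cV[R]_d :=
  \col_i (if (i < k)%N then y i ord0 else x i ord0).

(** The path from [x] to [y] changes one coordinate after the other. All of its
    points stay within [enorm (y - x)] of [x], so each of the [d] steps costs at
    most [L * enorm (y - x) ^+ 2]. *)
Lemma descent_abs x y :
  `|f y - f x - \sum_i g x i ord0 * (y - x) i ord0| <= d%:R * L * enorm (y - x) ^+ 2.
Proof.
have stepE (k : 'I_d) : coordinate_path x y k.+1 = coordinate_path x y k + (y - x) k ord0 *: e k.
  apply/matrixP => i j; rewrite ord1 !mxE eqxx andbT ltnS leq_eqVlt.
  have [->|ik] := eqVneq i k; first by rewrite eqxx ltnn/= mulr1 addrC subrK.
  by rewrite -val_eqE in ik; rewrite (negbTE ik)/= mulr0 addr0.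
have tel : f y - f x = \sum_(k < d) (f (coordinate_path x y k.+1) - f (coordinate_path x y k)).
  have -> : f y - f x = f (coordinate_path x y d) - f (coordinate_path x y 0).
    congr (f _ - f _); apply/matrixP => i j; rewrite ord1 mxE ?ltn_ord//.
  rewrite -(telescope_sumr (fun k => f (coordinate_path x y k)))//.
  by rewrite big_mkord.
rewrite tel -sumrB; apply: le_trans (ler_norm_sum _ _ _) _.
have -> : d%:R * L * enorm (y - x) ^+ 2 = \sum_(k < d) L * enorm (y - x) ^+ 2.
  by rewrite sumr_const card_ord -mulrA mulr_natl.
apply: ler_sum => k _; rewrite stepE [g x k ord0 * _]mulrC.
have n0 := enorm_ge0 _ _ (y - x).
have LN : 0 <= L * enorm (y - x) by rewrite mulr_ge0.
apply: le_trans (coordinate_mvt (coordinate_path x y k) x k _ _ LN _) _.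
  move=> c hc.
  have h1 : `|g (coordinate_path x y k + c *: e k) k ord0 - g x k ord0| <=
      enorm (g (coordinate_path x y k + c *: e k) - g x).
    by have := entry_le_enorm _ _ (g (coordinate_path x y k + c *: e k) - g x) k ord0; rewrite !mxE.
  apply: le_trans h1 _; apply: le_trans (A1 _ _) _; rewrite ler_wpM2l//.
  apply: enorm_le_entries => i j; rewrite (ord1 j) !mxE eqxx andbT.
  have [ik|ik] := eqVneq i k.
    by rewrite ik ltnn/= mulr1 addrC addKr; move: hc; rewrite !mxE.
  by rewrite mulr0 addr0; case: ifP; rewrite // subrr normr0.
rewrite mulrC -mulrA ler_wpM2l// [leRHS]expr2 ler_wpM2l//.
exact: entry_le_enorm.
Qed.

Lemma descent x y : f y - f x <=
  \sum_i g x i ord0 * (y - x) i ord0 + d%:R * L * enorm (y - x) ^+ 2.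
Proof.
have := ler_norm (f y - f x - \sum_i g x i ord0 * (y - x) i ord0).
have := descent_abs x y; lra.
Qed.

Lemma continuous_grad i : continuous (fun x => g x i ord0).
Proof. by under eq_fun do rewrite mxE; have [] := hf i. Qed.

Lemma grad_lipschitz_sqr x y :
  enorm (g x - g y) ^+ 2 <= L ^+ 2 * enorm (x - y) ^+ 2.
Proof.
by rewrite -exprMn lerXn2r// ?nnegrE ?mulr_ge0 ?enorm_ge0.
Qed.
End Descent.

Section EnormContinuity.
Context {R : realType} {d : nat}.

Lemma enorm_cvg0 (x : 'cV[R]_d) : enorm (y - x) @[y --> x] --> 0.
Proof.
have term i : continuous (fun y : 'cV[R]_d => (y i ord0 - x i ord0) ^+ 2).
  move=> z; apply: (@continuous_comp _ _ _ (fun y : 'cV[R]_d => y i ord0)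
    (fun r : R => (r - x i ord0) ^+ 2)); first exact: coord_continuous.
  apply: (@continuous_comp _ _ _ (fun r : R => r - x i ord0) (fun r : R => r ^+ 2)).
    by apply: cvgB; [exact: cvg_id|exact: cvg_cst].
  exact: exprn_continuous.
have c : continuous (fun y : 'cV[R]_d => \sum_i (y i ord0 - x i ord0) ^+ 2).
  elim: (index_enum _) => [|i r IH].
    by under eq_fun do rewrite big_nil; exact: cst_continuous.
  under eq_fun do rewrite big_cons.
  by move=> z; exact: cvgD (term i z) (IH z).
have E : (fun y : 'cV[R]_d => enorm (y - x)) =
    (fun y => Num.sqrt (\sum_i (y i ord0 - x i ord0) ^+ 2)).
  apply/funext => y; rewrite /enorm; congr Num.sqrt; apply: eq_bigr => i _.
  by rewrite big_ord1 !mxE.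
have s0 : \sum_i (x i ord0 - x i ord0) ^+ 2 = 0.
  by rewrite big1// => i _; rewrite subrr expr0n.
have := @cvg_comp _ _ _ _ (@Num.sqrt R) _ _ _ (c x) (@sqrt_continuous R _).
by rewrite s0 sqrtr0 E.
Qed.

Lemma near_enorm (x : 'cV[R]_d) (e : R) : 0 < e -> \forall y \near x, enorm (y - x) < e.
Proof.
move=> e0; have /cvgrPdist_lt /(_ e e0) := enorm_cvg0 x.
by apply: filterS => y; rewrite sub0r normrN ger0_norm ?enorm_ge0.
Qed.

Lemma continuous_of_enorm_lipschitz (h : 'cV[R]_d -> R) (M : R) :
  (forall x y, `|h x - h y| <= M * enorm (x - y)) -> continuous h.
Proof.
move=> lip x; apply/(@cvgrPdist_lt _ _ _ (nbhs x) (nbhs_filter x)) => eps eps0.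
have M0 : 0 < `|M| + 1 by rewrite ltr_wpDl.
apply: filterS (near_enorm x _ (divr_gt0 eps0 M0)) => y.
rewrite ltr_pdivlMr// => hy; rewrite distrC; apply: le_lt_trans (lip y x) _.
apply: le_lt_trans hy; rewrite mulrC ler_wpM2l ?enorm_ge0//.
by rewrite (le_trans (ler_norm M))// lerDl.
Qed.

Lemma continuous_of_descent (f : 'cV[R]_d -> R) (g : 'cV[R]_d -> 'cV[R]_d) (K : R) :
  (forall x y, `|f y - f x - \sum_i g x i ord0 * (y - x) i ord0| <=
     K * enorm (y - x) ^+ 2) -> continuous f.
Proof.
move=> h x; apply/(@cvgrPdist_lt _ _ _ (nbhs x) (nbhs_filter x)) => eps eps0.
pose B := \sum_i `|g x i ord0|.
have B0 : 0 <= B by apply: sumr_ge0.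
have C0 : 0 < B + `|K| + 1 by rewrite ltr_wpDl ?addr_ge0.
pose r := Num.min 1 (eps / (B + `|K| + 1)).
have r0 : 0 < r by rewrite lt_min ltr01 divr_gt0.
apply: filterS (near_enorm x r r0) => y.
rewrite lt_min => /andP[y1]; rewrite ltr_pdivlMr// => hy.
have n0 := enorm_ge0 _ _ (y - x).
have lin : `|\sum_i g x i ord0 * (y - x) i ord0| <= B * enorm (y - x).
  apply: le_trans (ler_norm_sum _ _ _) _; rewrite mulr_suml; apply: ler_sum => i _.
  by rewrite normrM ler_wpM2l// entry_le_enorm.
have quad : K * enorm (y - x) ^+ 2 <= `|K| * enorm (y - x).
  apply: (@le_trans _ _ (`|K| * enorm (y - x) ^+ 2)).
    by rewrite ler_wpM2r ?sqr_ge0// ler_norm.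
  by rewrite ler_wpM2l// expr2 ler_piMl// ltW.
have H := h x y; rewrite distrC.
set S := \sum_i _ in lin H.
have := ler_normD (f y - f x - S) S; rewrite subrK => h3; lra.
Qed.
End EnormContinuity.

Section SquareRoot.
Context {R : realType} {d : nat} {dZ : measure_display} {Z : measurableType dZ}.
Variables (piZ : probability Z R) (f : 'cV[R]_d -> R) (H : 'cV[R]_d -> Z -> 'cV[R]_d).

(** The squared Frobenius norm of a symmetric [S] is the trace of [S *m S]. *)
Lemma enorm_psd_sqrt (A : 'M[R]_d) : (forall i, 0 <= A i i) ->
  enorm (psd_sqrt A) ^+ 2 <= \sum_i A i i.
Proof.
move=> A0; rewrite /psd_sqrt; case: xgetP => [S _ [St _ SS]|_].
  rewrite enorm_sqr -SS; apply: ler_sum => i _; rewrite mxE.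
  by apply: ler_sum => j _; rewrite -[in X in _ * X]St mxE expr2.
rewrite enorm_sqr big1 ?sumr_ge0// => i _.
by rewrite big1// => j _; rewrite mxE expr0n.
Qed.

Lemma enorm_noise_sqrt (eta : R) x :
  (forall i, piZ.-integrable setT (fun z => (H x z i ord0)%:E)) ->
  (\int[piZ]_z (enorm (H x z - grad f x) ^+ 2)%:E <= eta%:E)%E ->
  enorm (psd_sqrt (noise_cov piZ f H x)) ^+ 2 <= eta.
Proof.
move=> iH hv.
have mD i : measurable_fun setT (fun z => (H x z - grad f x) i ord0).
  under eq_fun do rewrite mxE.
  apply: measurable_funD; last exact: measurable_cst.
  exact: L1_measurable (iH i).
have mn : measurable_fun setT (fun z => enorm (H x z - grad f x) ^+ 2).
  under eq_fun do rewrite enorm_col_sqr.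
  by apply: measurable_sum => i; exact: measurable_funX.
have [iN bN] := L1_of_le piZ _ _ mn (fun z => sqr_ge0 _) hv.
have iD i : L1 piZ (fun z => (H x z - grad f x) i ord0 ^+ 2).
  apply: (L1_le _ _ _ _ iN); first exact: measurable_funX.
  by move=> z; rewrite ger0_norm ?sqr_ge0// sqr_entry_le.
have covE i : noise_cov piZ f H x i i = Ex piZ (fun z => (H x z - grad f x) i ord0 ^+ 2).
  rewrite mxE /Ex; congr (Rintegral _ _ _); apply/funext => z.
  by rewrite mxE big_ord1 [in X in _ * X]mxE expr2.
apply: le_trans (enorm_psd_sqrt _ _) _.
  by move=> i; rewrite covE; apply: Ex_ge0 => z; exact: sqr_ge0.
under eq_bigr do rewrite covE.
rewrite -Ex_sum//; apply: le_trans bN.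
rewrite le_eqVlt; apply/orP; left; apply/eqP; congr Ex; apply/funext => z.
by rewrite enorm_col_sqr.
Qed.
End SquareRoot.

(** * Comparison with a barrier *)

Section Comparison.
Context {R : realType}.

(** The supremum of the times up to which [A] holds would be a last time, which
    the two local hypotheses forbid. *)
Lemma real_induction (A : R -> Prop) :
  A 0 ->
  (forall s, 0 <= s -> A s -> exists2 h : R, 0 < h & forall t, s <= t <= s + h -> A t) ->
  (forall s, 0 < s -> (forall u, 0 <= u < s -> A u) -> A s) ->
  forall t, 0 <= t -> A t.
Proof.
move=> A0 right left t t0; apply: contrapT => nAt.
pose S := [set s | 0 <= s <= t /\ forall u, 0 <= u <= s -> A u].
have S0 : S 0.
  split; first by rewrite lexx.
  by move=> u; rewrite -eq_le => /eqP <-.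
have Sn : S !=set0 by exists 0.
have Sb : has_ubound S by exists t => s [/andP[]].
set m := sup S.
have m0 : 0 <= m by exact: ub_le_sup Sb _ S0.
have mt : m <= t by apply: ge_sup => // s [/andP[]].
have below u : 0 <= u < m -> A u.
  move=> /andP[u0 um]; have [s [_ As] us] := sup_gt Sn um.
  by apply: As; rewrite u0 ltW.
have Am : A m.
  by move: m0; rewrite le_eqVlt => /predU1P[<-//|m0]; exact: left.
have [h h0 Ah] := right m m0 Am.
have mt' : m < t.
  by rewrite lt_neqAle mt andbT; apply: contra_notN nAt => /eqP <-.
pose s := Num.min t (m + h).
have ms : m < s by rewrite lt_min mt' ltrDl.
have : S s.
  split; first by rewrite (le_trans m0 (ltW ms)) ge_min lexx.
  move=> u /andP[u0 us]; have [um|mu] := ltP u m; first by apply: below; rewrite u0.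
  by apply: Ah; rewrite mu (le_trans us)// ge_min lexx orbT.
by move=> /(ub_le_sup Sb); rewrite -/m leNgt ms.
Qed.

Lemma powR_le (r x y : R) : 0 <= r -> 0 <= x -> x <= y -> x `^ r <= y `^ r.
Proof.
by move=> r0 x0 xy; apply: ge0_ler_powR; rewrite ?nnegrE ?(le_trans x0 xy).
Qed.

Lemma gt0_powRD (x r s : R) : 0 < x -> x `^ (r + s) = x `^ r * x `^ s.
Proof. by move=> x0; rewrite powRD//; apply/implyP => _; rewrite gt_eqF. Qed.

(** For [0 <= d] this is the convexity of [x `^ (- d)], which amounts to
    [1 + y <= expR y] after a division by [x `^ (- d)]; for [d < 0] the left-hand
    side is at most [x `^ (- d)]. *)
Lemma powR_tangent (d x y : R) : 0 < x -> x <= y ->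
  x `^ (- d) - `|d| * x `^ (- d - 1) * (y - x) <= y `^ (- d).
Proof.
move=> x0 xy; have y0 : 0 < y by exact: lt_le_trans xy.
have [d0|d0] := leP 0 d; last first.
  apply: (@le_trans _ _ (x `^ (- d))).
    by rewrite gerBl !mulr_ge0 ?powR_ge0 ?subr_ge0.
  by apply: powR_le => //; rewrite ?oppr_ge0 ltW.
rewrite ger0_norm//.
have -> : x `^ (- d - 1) = x `^ (- d) / x.
  rewrite gt0_powRD// [x `^ (-1)]powRN powRr1//; exact: ltW.
have -> : y `^ (- d) = x `^ (- d) * (y / x) `^ (- d).
  by rewrite -powRM ?ltW ?divr_gt0// mulrC divfK// gt_eqF.
have -> : x `^ (- d) - d * (x `^ (- d) / x) * (y - x) =
    x `^ (- d) * (1 - d * (y / x - 1)) by field; rewrite gt_eqF.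
rewrite ler_wpM2l ?powR_ge0//.
have yx : 0 < y / x by rewrite divr_gt0.
rewrite /powR gt_eqF//.
apply: le_trans (expR_ge1Dx _); rewrite lerD2l mulNr lerN2 ler_wpM2l//.
have := expR_ge1Dx (ln (y / x)); rewrite lnK ?posrE//; lra.
Qed.

Lemma quadratic_le (A B h : R) : 0 < A -> 0 <= B -> 0 <= h -> h <= A / (B + 1) ->
  - h * A + B * h ^+ 2 <= 0.
Proof.
move=> A0 B0 h0; rewrite ler_pdivlMr ?ltr_wpDl// => hA.
have h1 : B * h <= A by lra.
by have := ler_wpM2r h0 h1; lra.
Qed.
End Comparison.

Section Rate.
Context {R : realType}.
Variables (ga alpha beta eps p q tau Cb C0 : R).
Hypothesis hga : 0 < ga < 1.
Hypothesis hp : 1 < p.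
Hypothesis hq : 0 < q.
Hypothesis hpq : p^-1 + q^-1 = 1.
Hypotheses (htau : 0 < tau) (hCb : 0 <= Cb) (hC0 : 0 <= C0).
Hypothesis heps : 0 <= eps.
Variables (v EG : R -> R).
Hypothesis EG0 : forall s, 0 <= EG s.

(** The comparison is stated for an arbitrary function [v] with one-sided
    increment bounds [step] and [left]. The function [EG] stands for the second
    moment of the gradient; [young] is the gradient domination once the free
    weight [l] of the Young inequality has been exposed. *)
Definition time_shift s := ga + s.
Definition lg s := 1 + ln (1 + ga^-1 * s).
Local Notation a s := (time_shift s `^ (- alpha)).

Hypothesis step : forall s, 0 <= s -> exists2 h : R, 0 < h & exists2 K : R, 0 <= K &
  forall t, s <= t <= s + h ->
    v t <= v s - (t - s) * a t / 2 * EG s + C0 * a s ^+ 2 * (t - s) + K * (t - s) ^+ 2.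
Hypothesis left : forall s, 0 < s -> exists2 h : R, 0 < h & exists2 K : R, 0 <= K &
  forall u, 0 <= u < s -> s - h <= u -> v s <= v u + K * (s - u).
Hypothesis young : forall s l, 0 <= s -> 0 < l ->
  tau * v s <= l `^ p / p * EG s +
    l `^ (- q) / q * (Cb * time_shift s `^ beta * lg s `^ eps).

Variable delta : R.
Hypothesis delta1 : delta <= (1 - alpha) / (p - 1) - beta.
Hypothesis delta2 : delta * p <= alpha - beta * (p - 1).

Let ga0 : 0 < ga. Proof. by case/andP: hga. Qed.
Let sh_ge s : 0 <= s -> ga <= time_shift s. Proof. by rewrite /time_shift lerDl. Qed.
Let sh0 s : 0 <= s -> 0 < time_shift s.
Proof. by move=> s0; exact: lt_le_trans ga0 (sh_ge s s0). Qed.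

Lemma lg_ge1 s : 0 <= s -> 1 <= lg s.
Proof.
by move=> s0; rewrite /lg lerDl ln_ge0// lerDl mulr_ge0// invr_ge0 ltW.
Qed.

Lemma lg_le s t : 0 <= s -> s <= t -> lg s <= lg t.
Proof.
move=> s0 st; rewrite /lg lerD2l ler_ln ?posrE; last 2 first.
- by rewrite ltr_wpDr// mulr_ge0 ?invr_ge0 ?(ltW ga0).
- by rewrite ltr_wpDr// mulr_ge0 ?invr_ge0 ?(ltW ga0) ?(le_trans s0).
by rewrite lerD2l ler_wpM2l// invr_ge0 ltW.
Qed.

Let lge_ge1 s : 0 <= s -> 1 <= lg s `^ eps.
Proof.
move=> s0; rewrite -{1}(powRr0 (lg s)); apply: ler_powR => //; exact: lg_ge1.
Qed.

Let lge_le s t : 0 <= s -> s <= t -> lg s `^ eps <= lg t `^ eps.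
Proof.
move=> s0 st; apply: powR_le => //; last exact: lg_le.
by rewrite (le_trans ler01)// lg_ge1.
Qed.

(** Powers of the shifted time can be compared up to a constant, since the
    shifted time stays above [ga]. *)
Lemma shift_powR_le x y s : 0 <= s -> x <= y ->
  ga `^ (y - x) * time_shift s `^ x <= time_shift s `^ y.
Proof.
move=> s0 xy; have s1 := sh0 s s0.
have -> : time_shift s `^ y = time_shift s `^ (y - x) * time_shift s `^ x.
  by rewrite -gt0_powRD ?subrK.
rewrite ler_wpM2r ?powR_ge0//; apply: powR_le; rewrite ?subr_ge0 ?(ltW ga0)//.
exact: sh_ge.
Qed.

Definition barrier K s := K * time_shift s `^ (- delta) * lg s `^ eps.
Local Notation e0 := (- alpha - delta - (delta + beta) * (p - 1)).
Let c1 := q * tau / (2 * (Cb + 1)).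
Let c2 := p * tau / 2 * c1 `^ (p - 1).

Let c1_gt0 : 0 < c1.
Proof. by rewrite divr_gt0 ?mulr_gt0// ltr_wpDl. Qed.
Let c2_gt0 : 0 < c2.
Proof. by rewrite !mulr_gt0 ?invr_gt0 ?powR_gt0// (lt_trans ltr01). Qed.

(** On the barrier, the Young inequality with its weight balanced against the
    moment bound forces a large gradient. *)
Let gradient_on_barrier K s : 0 < K -> 0 <= s -> v s = barrier K s ->
  c2 * K `^ p * time_shift s `^ e0 * lg s `^ eps <= a s * EG s.
Proof.
move=> K0 s0 vs; have S0 := sh0 s s0.
(* [th] is the value of [l `^ (- q)] for which the moment term in [young] is at
   most half of [tau * v s]. *)
pose S := time_shift s; pose th := c1 * K * S `^ (- (delta + beta)).
have th0 : 0 < th by apply: mulr_gt0; [exact: mulr_gt0|exact: powR_gt0].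
have p0 : 0 < p by rewrite (lt_trans ltr01).
pose l := th `^ (- q^-1).
have l0 : 0 < l by rewrite powR_gt0.
have lq : l `^ (- q) = th.
  by rewrite /l -powRrM mulrNN mulVf ?gt_eqF// powRr1// ltW.
have lp : l `^ p = (th `^ (p - 1))^-1.
  rewrite /l -powRrM -powRN; congr (_ `^ _).
  have qE : q^-1 = 1 - p^-1 by rewrite -hpq addrC addKr.
  by rewrite qE; field; rewrite gt_eqF.
have := young s l s0 l0; rewrite lq lp vs /barrier -/S => H.
have lg1 := lge_ge1 s s0; set ell := lg s `^ eps in lg1 H *.
have SS : S `^ (- (delta + beta)) * S `^ beta = S `^ (- delta).
  by rewrite -gt0_powRD//; congr (_ `^ _); ring.
have T2 : th / q * (Cb * S `^ beta * ell) <= tau / 2 * (K * S `^ (- delta) * ell).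
  have -> : th / q * (Cb * S `^ beta * ell) =
      tau / 2 * (K * S `^ (- delta) * ell) * (Cb / (Cb + 1)).
    rewrite /th /c1 -SS; field; rewrite !gt_eqF// ltr_wpDl//.
  rewrite ler_piMr ?mulr_ge0 ?powR_ge0 ?ltW// ?(lt_le_trans ltr01 lg1)//.
  by rewrite ltr_pdivrMr ?ltr_wpDl// mul1r ltrDl.
have thp : 0 < th `^ (p - 1) by rewrite powR_gt0.
have H2 : tau / 2 * (K * S `^ (- delta) * ell) <= (th `^ (p - 1))^-1 / p * EG s by lra.
have H3 : p * tau / 2 * th `^ (p - 1) * (K * S `^ (- delta) * ell) <= EG s.
  have := ler_wpM2l (ltW (mulr_gt0 p0 thp)) H2.
  have -> : p * th `^ (p - 1) * ((th `^ (p - 1))^-1 / p * EG s) = EG s.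
    by field; rewrite !gt_eqF.
  by apply: le_trans; rewrite le_eqVlt; apply/orP; left; apply/eqP; ring.
apply: le_trans (ler_wpM2l (powR_ge0 _ _) H3).
rewrite le_eqVlt; apply/orP; left; apply/eqP.
have -> : th `^ (p - 1) = c1 `^ (p - 1) * K `^ (p - 1) * S `^ (- (delta + beta) * (p - 1)).
  rewrite /th powRM ?powR_ge0//; last by rewrite mulr_ge0 ?ltW.
  by rewrite powRM ?ltW// -powRrM.
rewrite -(mulr_powRB1 (ltW K0) p0) -/S.
have -> : S `^ e0 = a s * S `^ (- delta) * S `^ (- (delta + beta) * (p - 1)).
  rewrite -!gt0_powRD//; congr (_ `^ _); ring.
by rewrite /c2; ring.
Qed.

(** Where [v] touches the barrier, the dissipation exceeds both the energy
    brought by the noise and the slope of the barrier. The exponent [e0] of the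
    dissipation is compared with [- 2 * alpha] by [delta2] and with
    [- delta - 1] by [delta1]; because [1 < p], a large [K] does the rest. *)
Let decay_on_barrier K s : 0 < K -> 0 <= s ->
  4 * C0 < c2 * Num.min (ga `^ (e0 + 2 * alpha)) (ga `^ (e0 + delta + 1)) * K `^ p ->
  4 * `|delta| < c2 * Num.min (ga `^ (e0 + 2 * alpha)) (ga `^ (e0 + delta + 1)) * K `^ (p - 1) ->
  v s = barrier K s ->
  C0 * a s ^+ 2 + `|delta| * K * time_shift s `^ (- delta - 1) * lg s `^ eps < a s / 2 * EG s.
Proof.
set c3 := Num.min _ _ => K0 s0 k1 k2 vs; have S0 := sh0 s s0.
have p0 : 0 < p by rewrite (lt_trans ltr01).
have G := gradient_on_barrier K s K0 s0 vs.
have lg1 := lge_ge1 s s0; set ell := lg s `^ eps in lg1 G *.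
have ell0 : 0 < ell by exact: lt_le_trans lg1.
set S := time_shift s in S0 G *.
have p1 : 0 < p - 1 by rewrite subr_gt0.
have h1 : 0 <= e0 + 2 * alpha.
  have -> : e0 + 2 * alpha = alpha - beta * (p - 1) - delta * p by ring.
  by rewrite subr_ge0.
have h2 : 0 <= e0 + delta + 1.
  have -> : e0 + delta + 1 = (1 - alpha) - (delta + beta) * (p - 1) by ring.
  by rewrite subr_ge0 -ler_pdivlMr// -lerBrDr.
have c30 : 0 < c3 by rewrite lt_min !powR_gt0.
have u1 : c3 * S `^ (- (2 * alpha)) <= S `^ e0.
  apply: le_trans (shift_powR_le (- (2 * alpha)) e0 s s0 _); last first.
    by rewrite -subr_ge0 opprK.
  by rewrite ler_wpM2r ?powR_ge0// opprK ge_min lexx.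
have u2 : c3 * S `^ (- delta - 1) <= S `^ e0.
  apply: le_trans (shift_powR_le (- delta - 1) e0 s s0 _); last first.
    by rewrite -subr_ge0 opprB opprK addrA addrAC.
  rewrite ler_wpM2r ?powR_ge0//.
  have -> : e0 - (- delta - 1) = e0 + delta + 1 by ring.
  by rewrite ge_min lexx orbT.
have aE : a s ^+ 2 = S `^ (- (2 * alpha)).
  by rewrite expr2 -gt0_powRD//; congr (_ `^ _); rewrite /S; ring.
have KE := mulr_powRB1 (ltW K0) p0.
have Kp0 : 0 < K `^ p by rewrite powR_gt0.
have w1 : 4 * (C0 * a s ^+ 2) < c2 * K `^ p * S `^ e0 * ell.
  apply: (@lt_le_trans _ _ (c2 * c3 * K `^ p * S `^ (- (2 * alpha)))).
    by rewrite aE mulrA ltr_pM2r// powR_gt0.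
  apply: (@le_trans _ _ (c2 * K `^ p * S `^ e0)); last first.
    by rewrite ler_peMr// !mulr_ge0 ?powR_ge0// ltW.
  have := ler_wpM2l (ltW (mulr_gt0 c2_gt0 Kp0)) u1.
  by apply: le_trans; rewrite le_eqVlt; apply/orP; left; apply/eqP; ring.
have w2 : 4 * (`|delta| * K * S `^ (- delta - 1) * ell) < c2 * K `^ p * S `^ e0 * ell.
  apply: (@lt_le_trans _ _ (c2 * c3 * K `^ p * S `^ (- delta - 1) * ell)).
    have t0 : 0 < K * S `^ (- delta - 1) * ell.
      by do 2 (apply: mulr_gt0 => //); exact: powR_gt0.
    have -> : 4 * (`|delta| * K * S `^ (- delta - 1) * ell) =
      4 * `|delta| * (K * S `^ (- delta - 1) * ell) by ring.
    have -> : c2 * c3 * K `^ p * S `^ (- delta - 1) * ell =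
      c2 * c3 * K `^ (p - 1) * (K * S `^ (- delta - 1) * ell) by rewrite -KE; ring.
    by rewrite ltr_pM2r.
  rewrite ler_pM2r//.
  have := ler_wpM2l (ltW (mulr_gt0 c2_gt0 Kp0)) u2.
  by apply: le_trans; rewrite le_eqVlt; apply/orP; left; apply/eqP; ring.
lra.
Qed.

(** The logarithmic factor of the barrier increases, so freezing it at time [s]
    gives a lower bound. *)
Let barrier_lower K s t : 0 <= K -> 0 <= s -> s <= t ->
  barrier K s - `|delta| * K * time_shift s `^ (- delta - 1) * lg s `^ eps * (t - s) <=
  barrier K t.
Proof.
move=> K0 s0 st; have S0 := sh0 s s0.
have ST : time_shift s <= time_shift t by rewrite /time_shift lerD2l.
have T := powR_tangent delta _ _ S0 ST.
have ts : time_shift t - time_shift s = t - s by rewrite /time_shift; ring.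
rewrite ts in T.
have l0 : 0 <= lg s `^ eps by exact: powR_ge0.
have H := ler_wpM2r l0 (ler_wpM2l K0 T).
apply: (@le_trans _ _ (K * time_shift t `^ (- delta) * lg s `^ eps)).
  by apply: le_trans H; rewrite le_eqVlt; apply/orP; left; apply/eqP; rewrite /barrier; ring.
by rewrite /barrier ler_wpM2l ?mulr_ge0 ?powR_ge0// lge_le.
Qed.

Let barrier_upper K s : 0 <= K -> 0 <= s -> exists2 c : R, 0 <= c &
  forall u, 0 <= u <= s -> barrier K u <= barrier K s + c * (s - u).
Proof.
move=> K0 s0; have S0 := sh0 s s0.
exists (K * (`|delta| * (ga `^ (- delta - 1) + time_shift s `^ (- delta - 1))) * lg s `^ eps).
  by rewrite !mulr_ge0 ?powR_ge0// addr_ge0 ?powR_ge0.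
move=> u /andP[u0 us]; have U0 := sh0 u u0.
have US : time_shift u <= time_shift s by rewrite /time_shift lerD2l.
have T := powR_tangent delta _ _ U0 US.
have su : time_shift s - time_shift u = s - u by rewrite /time_shift; ring.
rewrite su in T.
have E : time_shift u `^ (- delta - 1) <= ga `^ (- delta - 1) + time_shift s `^ (- delta - 1).
  have [d0|d0] := leP 0 (- delta - 1).
    by rewrite ler_wpDl ?powR_ge0// powR_le// ltW.
  rewrite ler_wpDr ?powR_ge0//.
  rewrite -[- delta - 1]opprK powRN [leRHS]powRN lef_pV2 ?posrE ?powR_gt0//.
  by apply: powR_le; [rewrite oppr_ge0 ltW|exact: ltW|exact: sh_ge].
have l0 : 0 <= lg s `^ eps by exact: powR_ge0.
have us0 : 0 <= s - u by rewrite subr_ge0.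
apply: (@le_trans _ _ (K * time_shift u `^ (- delta) * lg s `^ eps)).
  by rewrite /barrier ler_wpM2l ?mulr_ge0 ?powR_ge0// lge_le.
have T' : time_shift u `^ (- delta) <= time_shift s `^ (- delta) +
    `|delta| * (ga `^ (- delta - 1) + time_shift s `^ (- delta - 1)) * (s - u).
  have := ler_wpM2r us0 (ler_wpM2l (normr_ge0 delta) E); lra.
have H := ler_wpM2r l0 (ler_wpM2l K0 T').
apply: le_trans H _; rewrite le_eqVlt; apply/orP; left; apply/eqP.
by rewrite /barrier; ring.
Qed.

(** A crossing of the barrier has a first time. At that time [v] touches the
    barrier, since [left] rules out a jump, and [decay_on_barrier] makes [v] fall
    below the barrier immediately afterwards. *)
Lemma rate_below_barrier : exists2 K : R, 0 <= K & forall t, 0 <= t -> v t <= barrier K t.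
Proof.
have p0 : 0 < p by rewrite (lt_trans ltr01).
have p1 : 0 < p - 1 by rewrite subr_gt0.
pose c3 := Num.min (ga `^ (e0 + 2 * alpha)) (ga `^ (e0 + delta + 1)).
have c30 : 0 < c3 by rewrite lt_min !powR_gt0.
have c0 : 0 < c2 * c3 by rewrite mulr_gt0.
(* [A1] and [A2] make [K] large enough for [decay_on_barrier]; [A3] puts [v 0]
   below the barrier. *)
pose A1 := 4 * C0 / (c2 * c3); pose A2 := (4 * `|delta| / (c2 * c3) + 1) `^ (p - 1)^-1.
pose A3 := `|v 0| * ga `^ delta.
have A10 : 0 <= A1 by apply: divr_ge0; [exact: mulr_ge0|exact: ltW].
have A20 : 0 <= A2 by exact: powR_ge0.
have A30 : 0 <= A3 by rewrite mulr_ge0 ?powR_ge0.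
pose K := 1 + A1 + A2 + A3.
have K1 : 1 <= K by rewrite /K; lra.
have K0 : 0 < K by exact: lt_le_trans K1.
have k1 : 4 * C0 < c2 * c3 * K `^ p.
  rewrite -ltr_pdivrMl// mulrC -/A1.
  apply: (@lt_le_trans _ _ K); first by rewrite /K; lra.
  by apply: le1r_powR => //; exact: ltW.
have k2 : 4 * `|delta| < c2 * c3 * K `^ (p - 1).
  rewrite -ltr_pdivrMl// mulrC.
  apply: (@lt_le_trans _ _ (A2 `^ (p - 1))).
    rewrite /A2 -powRrM mulVf ?gt_eqF// powRr1 ?ltrDl//.
    by apply: addr_ge0 => //; apply: divr_ge0; [exact: mulr_ge0|exact: ltW].
  by apply: powR_le; rewrite ?(ltW p1)// /K; lra.
exists K; first exact: ltW.
apply: real_induction.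
- rewrite /barrier /lg mulr0 addr0 ln1 addr0 powR1 mulr1 /time_shift addr0.
  apply: le_trans (ler_norm _) _.
  have -> : `|v 0| = A3 * ga `^ (- delta).
    by rewrite /A3 -mulrA -gt0_powRD// subrr powRr0 mulr1.
  by rewrite ler_wpM2r ?powR_ge0// /K; lra.
- move=> s s0 vs; have [h h0 [k k0 st]] := step s s0.
  pose x := C0 * a s ^+ 2 - a s / 2 * EG s +
    `|delta| * K * time_shift s `^ (- delta - 1) * lg s `^ eps.
  pose k' := k + `|alpha| * time_shift s `^ (- alpha - 1) / 2 * EG s.
  have k'0 : 0 <= k' by rewrite addr_ge0// !mulr_ge0 ?powR_ge0 ?invr_ge0.
  have diff t : s <= t <= s + h ->
      v t - barrier K t <= v s - barrier K s + x * (t - s) + k' * (t - s) ^+ 2.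
    move=> /andP[t1 t2]; have := st t; rewrite t1 t2 => /(_ isT) H1.
    have H2 := barrier_lower K s t (ltW K0) s0 t1.
    have ST : time_shift s <= time_shift t by rewrite /time_shift lerD2l.
    have H3 := powR_tangent alpha _ _ (sh0 s s0) ST.
    have ts : time_shift t - time_shift s = t - s by rewrite /time_shift; ring.
    rewrite ts in H3.
    have ts0 : 0 <= (t - s) / 2 * EG s by rewrite !mulr_ge0 ?subr_ge0 ?invr_ge0.
    have H4 := ler_wpM2l ts0 H3.
    rewrite /x /k'; lra.
  (* On the barrier the first-order coefficient [x] is negative; strictly below
     it, there is room [y] for a short time whatever the sign of [x]. *)
  move: vs; rewrite le_eqVlt => /predU1P[vs|vs].
    have := decay_on_barrier K s K0 s0 k1 k2 vs => dec.
    have x0 : 0 < - x by rewrite /x; lra.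
    exists (Num.min h (- x / (k' + 1))).
      by rewrite lt_min h0 divr_gt0// ltr_wpDl.
    move=> t /andP[t1 t2].
    have th : t - s <= Num.min h (- x / (k' + 1)) by rewrite lerBlDl.
    move: th; rewrite le_min => /andP[th1 th2].
    have ts0 : 0 <= t - s by rewrite subr_ge0.
    have := diff t; rewrite t1 -lerBlDl th1 => /(_ isT) H.
    have := quadratic_le (- x) k' (t - s) x0 k'0 ts0 th2.
    lra.
  pose y := barrier K s - v s.
  have y0 : 0 < y by rewrite subr_gt0.
  pose z := `|x| + k' + 1.
  have z0 : 0 < z by rewrite ltr_wpDl// addr_ge0.
  exists (Num.min h (Num.min 1 (y / z))); first by rewrite !lt_min h0 ltr01 divr_gt0.
  move=> t /andP[t1 t2].
  have : t - s <= Num.min h (Num.min 1 (y / z)) by rewrite lerBlDl.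
  rewrite !le_min => /and3P[th1 th2 th3].
  have ts0 : 0 <= t - s by rewrite subr_ge0.
  have := diff t; rewrite t1 -lerBlDl th1 => /(_ isT) H.
  rewrite ler_pdivlMr// in th3.
  have h1 : x * (t - s) <= `|x| * (t - s) by rewrite ler_wpM2r// ler_norm.
  have h2 : k' * (t - s) ^+ 2 <= k' * (t - s).
    by rewrite ler_wpM2l// expr2 ler_piMl.
  rewrite /z /y in th3; lra.
- move=> s s0 below; have [h h0 [k k0 st]] := left s s0.
  have [c c4 up] := barrier_upper K s (ltW K0) (ltW s0).
  apply/ler_addgt0Pr => e e_gt0.
  pose r := Num.min h (Num.min s (e / (k + c + 1))).
  have kc : 0 < k + c + 1 by rewrite ltr_wpDl// addr_ge0.
  have r0 : 0 < r by rewrite !lt_min h0 s0 divr_gt0.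
  pose u := s - r.
  have us : u < s by rewrite /u ltrBlDr ltrDl.
  have u0 : 0 <= u by rewrite /u subr_ge0 !ge_min lexx orbT.
  have uh : s - h <= u by rewrite /u lerB// ge_min lexx.
  have H1 := st u; rewrite u0 us uh in H1; have {}H1 := H1 isT isT.
  have H2 := below u; rewrite u0 us in H2; have {}H2 := H2 isT.
  have H3 := up u; rewrite u0 (ltW us) in H3; have {}H3 := H3 isT.
  have su : s - u = r by rewrite /u opprB addrC subrK.
  rewrite su in H1 H3.
  have : r <= e / (k + c + 1) by rewrite /r !ge_min lexx !orbT.
  rewrite ler_pdivlMr// => H4; lra.
Qed.
End Rate.

(** * Increments of the solution *)

Section Solution.
Context {R : realType} {d : nat} {dO : measure_display} {O : measurableType dO}.
Variables (P : probability O R) (B : R -> O -> 'cV[R]_d).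
Hypothesis hB : brownian_motion P B.
Local Notation F := (augmented_filtration P B).
Local Notation mu := (@lebesgue_measure R).

(** The exceptional null set belongs to every sigma-algebra of the augmented
    filtration, so redefining the process on it preserves adaptedness. *)
Lemma continuous_modification (X : R -> O -> 'cV[R]_d) :
  adapted F X -> continuous_paths P X ->
  exists N : set O, exists X' : R -> O -> 'cV[R]_d,
  [/\ measurable N /\ P N = 0%E, forall w, continuous (fun t => X' t w),
      forall t w, 0 <= t -> ~ N w -> X' t w = X t w &
      forall t i, 0 <= t -> Fmeas P B t (fun w => X' t w i ord0)] /\
      (forall t i, measurable_fun setT (fun w => X' t w i ord0)).
Proof.
move=> aX [N [mN N0 hN]].
pose X' t w : 'cV[R]_d := if `[< N w >] then 0 else X (Num.max 0 t) w.
have FX' t i : 0 <= t -> Fmeas P B t (fun w => X' t w i ord0).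
  move=> t0.
  have E : (fun w => X' t w i ord0) = (fun w => \1_(~` N) w * X t w i ord0).
    apply/funext => w; rewrite /X' (max_idPr t0) indicE in_setC.
    case: asboolP => Nw; first by rewrite mem_set// mxE mul0r.
    by rewrite memNset// mul1r.
  rewrite E; apply: FmeasM; last by move=> U mU; exact: aX.
  have FN : F t N by apply: sub_sigma_algebra; right.
  have [n0 nC nU] := smallest_sigma_algebra setT
    (past B t `|` [set M | measurable M /\ P M = 0%E]).
  apply/FmeasE; apply: measurable_indic.
  by rewrite -setTD; exact: nC.
exists N, X'; split; first split => //.
- move=> w; rewrite /X'; case: asboolP => Nw; first exact: cst_continuous.
  have cw : {within `[0, +oo[, continuous (fun t => X t w)}.
    by apply: contrapT => h; apply: Nw; exact: hN.
  apply: (continuous_retract `[0, +oo[%classic (fun t => Num.max 0 t) (fun t => X t w)) => //.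
    by have [] := continuous_clip (0 : R).
  by move=> t; rewrite /= in_itv/= le_max lexx.
- by move=> t w t0 Nw; rewrite /X' (max_idPr t0); case: asboolP.
- move=> t i.
  have t0 : 0 <= Num.max 0 t by rewrite le_max lexx.
  rewrite (_ : (fun w => X' t w i ord0) = (fun w => X' (Num.max 0 t) w i ord0)).
    exact: Fmeas_measurable (FX' _ i t0).
  by apply/funext => w; rewrite /X' maxA maxxx.
Qed.

Lemma Fmeas_continuous_comp (h : 'cV[R]_d -> R) (Y : O -> 'cV[R]_d) s :
  continuous h -> (forall i, Fmeas P B s (fun w => Y w i ord0)) ->
  Fmeas P B s (fun w => h (Y w)).
Proof.
move=> ch FY; apply/FmeasE.
apply: (@measurable_continuous_comp R _ (g_sigma_algebraType
  (past B s `|` [set N | measurable N /\ P N = 0%E])) d h Y) => // i.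
by have /FmeasE := FY i; apply.
Qed.

Variables (ga alpha k q : R) (g : 'cV[R]_d -> 'cV[R]_d) (sigma : 'cV[R]_d -> 'M[R]_d).
Hypotheses (ga0 : 0 < ga) (alpha0 : 0 < alpha) (q0 : 0 <= q).
Hypothesis cg : forall i, continuous (fun x => g x i ord0).
Hypothesis cs : forall i j, continuous (fun x => sigma x i j).
Hypothesis sq : forall x, enorm (sigma x) ^+ 2 <= q.

(** The learning rate, frozen at its initial value for negative times so that it
    is continuous, bounded and monotone on the whole line. *)
Definition rate_fun t : R := (ga + Num.max 0 t) `^ (- alpha).

Lemma rate_funE t : 0 <= t -> rate_fun t = (ga + t) `^ (- alpha).
Proof. by move=> t0; rewrite /rate_fun (max_idPr t0). Qed.

Lemma continuous_rate_fun : continuous rate_fun.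
Proof.
have [c1 _] := continuous_clip (0 : R).
rewrite (_ : rate_fun = (fun x => x `^ (- alpha)) \o (fun t => ga + Num.max 0 t))//.
move=> t; apply: continuous_comp.
  by apply: cvgD; [exact: cvg_cst|exact: c1].
have pos : 0 < ga + Num.max 0 t by rewrite ltr_wpDr// le_max lexx.
apply: differentiable_continuous; apply/derivable1_diffP.
by have [] := is_derive1_powR (- alpha) pos.
Qed.

Lemma rate_fun_ge0 t : 0 <= rate_fun t. Proof. exact: powR_ge0. Qed.

Lemma rate_fun_le s t : s <= t -> rate_fun t <= rate_fun s.
Proof.
move=> st; rewrite /rate_fun !powRN lef_pV2 ?posrE; last 2 first.
- by rewrite powR_gt0// ltr_wpDr// le_max lexx.
- by rewrite powR_gt0// ltr_wpDr// le_max lexx.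
have m0 r : 0 <= ga + Num.max 0 r by rewrite addr_ge0 ?(ltW ga0)// le_max lexx.
apply: ge0_ler_powR; rewrite ?nnegrE ?(ltW alpha0)//.
by rewrite lerD2l ge_max !le_max lexx/= st orbT.
Qed.

Lemma rate_fun_ub t : rate_fun t <= ga `^ (- alpha).
Proof.
have [t0|t0] := leP 0 t; last by rewrite /rate_fun (max_idPl (ltW t0)) addr0.
apply: le_trans (rate_fun_le 0 t t0) _.
by rewrite rate_funE// addr0.
Qed.

Variables (x0 : 'cV[R]_d) (X : R -> O -> 'cV[R]_d).
Hypothesis hX : strong_solution P B
  (fun t x => - (ga + t) `^ (- alpha) *: g x)
  (fun t x => - (ga + t) `^ (- alpha) *: (k *: sigma x)) x0 X.

Local Notation c := (4 * ito_cst (d := d) * (k ^+ 2 * q)).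

(** The noise part of an increment of the solution is, almost surely, the
    increment of the stochastic integral, so [ito_increment] applies to it; its
    integrand has squared norm at most [rate_fun s ^+ 2 * (k ^+ 2 * q)] after
    time [s], because the learning rate decreases. *)
Lemma solution_increments : exists X' : R -> O -> 'cV[R]_d,
  [/\ forall w, continuous (fun t => X' t w),
      forall t i, measurable_fun setT (fun w => X' t w i ord0),
      forall t, 0 <= t -> {ae P, forall w, X t w = X' t w},
      forall t i, 0 <= t -> measurable_fun setT (fun w => X t w i ord0) &
      [/\ forall s t i, 0 <= s -> s <= t ->
            L2 P (fun w => noise_part g rate_fun X' s t w i ord0),
          forall s t, 0 <= s -> s <= t ->
            (nsq P d (noise_part g rate_fun X' s t) <= (c * rate_fun s ^+ 2 * (t - s))%:E)%E,
          forall s t i, 0 <= s -> s <= t -> L2 P (fun w => g (X' s w) i ord0) ->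
            Ex P (fun w => g (X' s w) i ord0 * noise_part g rate_fun X' s t w i ord0) = 0 &
          sqint_at P X' 0]].
Proof.
have [aX cX eX] := hX.
have [N [X' [[[mN N0] cX' XX' FX'] mX']]] := continuous_modification X aX cX.
exists X'.
have aeXX' t : 0 <= t -> {ae P, forall w, X t w = X' t w}.
  move=> t0; exists N; split => // w h; apply: contrapT => Nw.
  by apply: h; apply/esym; exact: XX'.
have mX t i : 0 <= t -> measurable_fun setT (fun w => X t w i ord0).
  move=> t0; apply: (Fmeas_measurable P B hB t) => U mU; exact: aX.
pose Phi u w : 'M[R]_d := - (ga + u) `^ (- alpha) *: (k *: sigma (X' u w)).
have jPhi : jmeas d d Phi.
  move=> i j; under eq_fun do rewrite /Phi !mxE.
  apply: measurable_funM.
    apply: measurable_funN.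
    apply: (measurableT_comp (f := fun x : R => x `^ (- alpha)) (g := fun p : R * O => ga + p.1)).
      exact: measurable_powR.
    by apply: measurable_funD; [exact: measurable_cst|exact: measurable_fst].
  apply: measurable_funM; first exact: measurable_cst.
  apply: (measurable_continuous_process (fun t w => sigma (X' t w) i j)) => [t|w t].
    by apply: (measurable_continuous_comp (fun x => sigma x i j)) => // ?; exact: mX'.
  apply: (@continuous_comp _ _ _ (fun t => X' t w) (fun x => sigma x i j)).
    exact: cX'.
  exact: cs.
have drift_cont w i : continuous (fun u => rate_fun u * g (X' u w) i ord0).
  apply: continuous_mul; first exact: continuous_rate_fun.
  move=> t; apply: (@continuous_comp _ _ _ (fun t => X' t w) (fun x => g x i ord0)).
    exact: cX'.
  exact: cg.
have mdr s t i : measurable_fun setT (fun w => drift g rate_fun X' s t w i ord0).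
  under eq_fun do rewrite mxE.
  apply: (measurable_tint_param (fun p => rate_fun p.1 * g (X' p.1 p.2) i ord0)).
  apply: (measurable_continuous_process (fun t w => rate_fun t * g (X' t w) i ord0)) => //.
  move=> u; apply: measurable_funM; first exact: measurable_cst.
  by apply: (measurable_continuous_comp (fun x => g x i ord0)).
have mnz s t : vmeas d (noise_part g rate_fun X' s t).
  move=> i; under eq_fun do rewrite /noise_part mxE.
  apply: measurable_funD; last exact: mdr.
  by under eq_fun do rewrite !mxE; exact: measurable_funB.
(* The stochastic integral, read off the equation along the modified paths. *)
have int t : 0 <= t -> exists2 J : O -> 'cV[R]_d,
    ito_integral P F B Phi t J &
    {ae P, forall w, X' t w = x0 - drift g rate_fun X' 0 t w + J w}.
  move=> t0; have [J hJ [M [mM M0 hM]]] := eX t t0; exists J.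
    apply: (ito_integral_modification P B _ _ _ _ N) hJ => // u w u0 Nw.
    by rewrite /Phi XX'.
  exists (N `|` M); split; first exact: measurableU.
    by apply: null_set_setU.
  move=> w h; apply: contrapT => /not_orP[Nw Mw].
  have [E|nE] := pselect (X t w = x0 + \col_i (\int[mu]_(u in `[0, t])
    ((- (ga + u) `^ (- alpha) *: g (X u w)) i ord0)) + J w); last first.
    by apply: Mw; exact: hM.
  apply: h => /=; rewrite XX'// E; congr (_ + _ + _).
  apply/matrixP => i j; rewrite (ord1 j) !mxE /tint.
  rewrite -[RHS]mulN1r -RintegralZl//; last exact: tint_integrable.
  apply: eq_Rintegral => u; rewrite inE/= in_itv/= => /andP[u0 _].
  by rewrite !mxE XX'// rate_funE// mulNr mulN1r.
have incr s t : 0 <= s -> s <= t -> exists Is It : O -> 'cV[R]_d,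
    [/\ ito_integral P F B Phi s Is, ito_integral P F B Phi t It &
    {ae P, forall w, It w - Is w = noise_part g rate_fun X' s t w}].
  move=> s0 st; have t0 := le_trans s0 st.
  have [Is hIs Es] := int s s0; have [It hIt Et] := int t t0.
  exists Is, It; split => //; apply: filterS2 Es Et => w Es Et.
  have ch : drift g rate_fun X' 0 t w = drift g rate_fun X' 0 s w +
      drift g rate_fun X' s t w.
    by apply/matrixP => i j; rewrite !mxE -tint_chasles.
  rewrite /noise_part Es Et ch; move: (drift _ _ _ 0 s w) (drift _ _ _ s t w) => D1 D2.
  by apply/matrixP => i j; rewrite !mxE; ring.
have key s t : 0 <= s -> s <= t -> exists Is It : O -> 'cV[R]_d,
    {ae P, forall w, It w - Is w = noise_part g rate_fun X' s t w} /\
    [/\ forall i, L2 P (fun w => It w i ord0 - Is w i ord0),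
      (nsq P d (fun w => It w - Is w)%R <=
        (4 * ito_cst (d := d) * (rate_fun s ^+ 2 * (k ^+ 2 * q)) * (t - s))%:E)%E &
      forall i Y, Fmeas P B s Y -> L2 P Y ->
        Ex P (fun w => Y w * (It w i ord0 - Is w i ord0)) = 0].
  move=> s0 st; have [Is [It [hIs hIt E]]] := incr s t s0 st.
  exists Is, It; split => //.
  apply: (ito_increment P B hB Phi _ s t Is It) => //.
    by do 2 (apply: mulr_ge0; first exact: sqr_ge0).
  move=> u w /andP[su _].
  have u0 : 0 <= u by rewrite (le_trans s0)// ltW.
  rewrite /Phi !enorm_sqrZ sqrrN -rate_funE//.
  apply: ler_pM.
  - exact: sqr_ge0.
  - by apply: mulr_ge0; exact: sqr_ge0.
  - by rewrite lerXn2r ?nnegrE ?rate_fun_ge0// rate_fun_le// ltW.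
  - by rewrite ler_wpM2l ?sqr_ge0.
split => //; split.
- move=> s t i s0 st; have [Is [It [E [K1 _ _]]]] := key s t s0 st.
  have mi : measurable_fun setT (fun w => noise_part g rate_fun X' s t w i ord0) by exact: mnz.
  split => //.
  apply: (L1_ae P _ _ (L2_sqr _ _ (K1 i)) _ _).1; first exact: measurable_funX.
  by apply: filterS E => w <-; rewrite !mxE.
- move=> s t s0 st; have [Is [It [E [K1 K2 _]]]] := key s t s0 st.
  have mI : measurable_fun setT (fun w => enorm (It w - Is w) ^+ 2).
    by apply: vmeas_enorm => i; under eq_fun do rewrite !mxE; case: (K1 i).
  apply: le_trans (le_trans _ K2) _.
    rewrite /nsq le_eqVlt; apply/orP; left; apply/eqP; apply: ge0_ae_eq_integral => //.
    + by apply/measurable_EFinP; exact: vmeas_enorm.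
    + exact/measurable_EFinP.
    + by move=> w _; rewrite lee_fin sqr_ge0.
    + by move=> w _; rewrite lee_fin sqr_ge0.
    + by apply: filterS E => w /= -> _.
  by rewrite lee_fin le_eqVlt; apply/orP; left; apply/eqP; ring.
- move=> s t i s0 st hg; have [Is [It [E [K1 _ K3]]]] := key s t s0 st.
  have Fg : Fmeas P B s (fun w => g (X' s w) i ord0).
    by apply: (Fmeas_continuous_comp (fun x => g x i ord0)) => // j; exact: FX'.
  rewrite -(K3 i _ Fg hg); apply: (L1_ae P _ _ (L2_mul _ _ _ hg (K1 i)) _ _).2.
    by apply: measurable_funM; [case: hg|exact: mnz].
  by apply: filterS E => w <-; rewrite !mxE.
- have [J hJ E] := int 0 (lexx 0).
  have mJ := ito_integral_vmeas P B hB _ _ _ hJ.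
  have [phi [_ hphi]] := ito_approx P B Phi 0 J 1 ltr01 hJ.
  have sp0 w : sp_integral phi B 0 w = 0.
    rewrite /sp_integral big1// => j _.
    by rewrite !(min_idPr (sp_time_nonneg P B _ _)) subrr mulmx0.
  have hJ1 : (nsq P d J <= 1%:E)%E.
    apply: le_trans hphi; rewrite /nsq le_eqVlt; apply/orP; left; apply/eqP.
    by apply: eq_integral => w _; rewrite sp0 sub0r enorm_sqrN.
  move=> i.
  have h := L2D _ _ _ (L2_cst P (x0 i ord0)) (L2_of_nsq P d J i 1 mJ hJ1).
  split; first exact: mX'.
  apply: (L1_ae P _ _ (L2_sqr _ _ h) _ _).1; first exact: measurable_funX.
  apply: filterS E => w ->; rewrite !mxE /tint set_itv1 Rintegral_set1 subr0.
  by [].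
Qed.
End Solution.

(** * The convergence rate *)

(** Young's inequality with the conjugate exponents [2 / r1] and
    [(1 - r1 / 2)^-1], applied to [l * A `^ r1] and [l^-1 * B `^ r2]. The weight
    [l] is free because the best choice depends on time. *)
Lemma weighted_young (R : realType) (l A B r1 r2 : R) : 0 < l -> 0 <= A -> 0 <= B ->
  0 < r1 < 2 ->
  A `^ r1 * B `^ r2 <= l `^ (2 / r1) / (2 / r1) * A ^+ 2 +
    l `^ (- (1 - r1 / 2)^-1) / (1 - r1 / 2)^-1 * B `^ (r2 * (1 - r1 / 2)^-1).
Proof.
move=> l0 A0 B0 /andP[r10 r12].
have q0 : 0 < (1 - r1 / 2)^-1 by rewrite invr_gt0; lra.
have p0 : 0 < 2 / r1 by rewrite divr_gt0.
have pq : (2 / r1)^-1 + (1 - r1 / 2)^-1^-1 = 1 by rewrite invrK invf_div subrKC.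
have li0 : 0 <= l^-1 by rewrite invr_ge0 ltW.
have := @conjugate_powR R (l * A `^ r1) (l^-1 * B `^ r2) _ _
  (mulr_ge0 (ltW l0) (powR_ge0 _ _)) (mulr_ge0 li0 (powR_ge0 _ _)) p0 q0 pq.
have -> : l * A `^ r1 * (l^-1 * B `^ r2) = A `^ r1 * B `^ r2.
  by field; rewrite gt_eqF.
rewrite (powRM _ (ltW l0) (powR_ge0 _ _)) (powRM _ li0 (powR_ge0 _ _)) -!powRrM.
have -> : r1 * (2 / r1) = 2%:R by field; rewrite gt_eqF.
rewrite powR_mulrn//.
have -> : l^-1 `^ (1 - r1 / 2)^-1 = l `^ (- (1 - r1 / 2)^-1).
  by rewrite -(powR_inv1 (ltW l0)) -powRrM mulN1r.
by move=> h; apply: le_trans h _; rewrite le_eqVlt; apply/orP; left; apply/eqP; ring.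
Qed.

Theorem theorem10 (R : realType) (d : nat) (hd : (0 < d)%N)
  (f : 'cV[R]_d -> R) (hf : C2 f)
  (* (A1) *)
  (L : R) (hL : 0 <= L)
  (A1 : forall x y, enorm (grad f x - grad f y) <= L * enorm (x - y))
  (* (A2a) *)
  (Z : completePseudoMetricType R) (hZ : polish Z)
  (piZ : probability (borel Z) R) (eta : R) (heta : 0 <= eta)
  (H : 'cV[R]_d -> Z -> 'cV[R]_d)
  (Hmeas : forall i, measurable_fun [set: borel 'cV[R]_d * borel Z]
                       (fun p => H p.1 p.2 i ord0))
  (Hmean : forall x i,
     piZ.-integrable [set: borel Z] (fun z => (H x z i ord0)%:E) /\
     (\int[piZ]_z (H x z i ord0)%:E = (grad f x i ord0)%:E)%E)
  (Hvar : forall x,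
     (\int[piZ]_z (enorm (H x z - grad f x) ^+ 2)%:E <= eta%:E)%E)
  (* (A3) *)
  (M : R) (hM : 0 <= M)
  (A3 : forall x y,
     enorm (psd_sqrt (noise_cov piZ f H x) - psd_sqrt (noise_cov piZ f H y))
     <= M * enorm (x - y))
  (* (F3) *)
  (xs : 'cV[R]_d) (hxs : forall x, f xs <= f x)
  (r1 r2 tau : R) (hr1 : 0 < r1 < 2) (hr2 : 0 <= r2) (htau : 0 < tau)
  (F3 : forall x, tau * (f x - f xs)
                  <= enorm (grad f x) `^ r1 * enorm (x - xs) `^ r2)
  (alpha gamma : R) (halpha : 0 < alpha < 1) (hgamma : 0 < gamma < 1)
  (dO : measure_display) (O : measurableType dO) (P : probability O R)
  (B : R -> O -> 'cV[R]_d) (hB : brownian_motion P B)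
  (x0 : 'cV[R]_d) (X : R -> O -> 'cV[R]_d) :
  let gammaa := gamma `^ (1 - alpha)^-1 in
  strong_solution P B
    (fun t x => - (gammaa + t) `^ (- alpha) *: grad f x)
    (fun t x => - (gammaa + t) `^ (- alpha) *:
                  (gammaa `^ 2^-1 *: psd_sqrt (noise_cov piZ f H x)))
    x0 X ->
  let r3 := (1 - r1 / 2)^-1 in
  forall beta eps Cbe : R, 0 <= beta -> 0 <= eps -> 0 <= Cbe ->
  (forall t, 0 <= t ->
     ('E_P[fun w => (enorm (X t w - xs) `^ (r2 * r3))%R] <=
      (Cbe * (gammaa + t) `^ beta *
         (1 + ln (1 + gammaa^-1 * t)) `^ eps)%:E)%E) ->
  let delta1 := r1 / 2 * (1 - r1 / 2)^-1 * (1 - alpha) - beta in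
  let delta2 := r1 / 2 * alpha - beta * (1 - r1 / 2) in
  let delta := Num.min delta1 delta2 in
  exists2 C : R, 0 <= C &
  forall T, 1 <= T ->
    ('E_P[fun w => f (X T w)] - (f xs)%:E <=
     (C * T `^ (- delta) * (1 + ln (1 + gammaa^-1 * T)) `^ eps)%:E)%E.
Proof.
move=> gammaa hX r3 beta eps Cbe hbeta heps hCbe hmom delta1 delta2 delta.
have /andP[al0 al1] := halpha; have /andP[g0 g1] := hgamma; have /andP[r10 r12] := hr1.
have ga0 : 0 < gammaa by exact: powR_gt0.
have ga1 : gammaa < 1.
  suff : gamma `^ (1 - alpha)^-1 < 1 `^ (1 - alpha)^-1 by rewrite powR1.
  apply: gt0_ltr_powR; rewrite ?nnegrE//; last exact: ltW.
  by rewrite invr_gt0 subr_gt0.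
have hC1 : C1 f := hf.1.
pose g := grad f.
pose sigma x := psd_sqrt (noise_cov piZ f H x).
have iH x i : piZ.-integrable [set: borel Z] (fun z => (H x z i ord0)%:E).
  by case: (Hmean x i).
have sq x : enorm (sigma x) ^+ 2 <= eta by exact: enorm_noise_sqrt.
have cs i j : continuous (fun x => sigma x i j).
  apply: (continuous_of_enorm_lipschitz _ M) => x y.
  apply: le_trans (A3 x y); have := entry_le_enorm _ _ (sigma x - sigma y) i j.
  by rewrite !mxE.
have cg i : continuous (fun x => g x i ord0) by exact: continuous_grad.
have cf : continuous f :=
  continuous_of_descent f (grad f) _ (descent_abs f L hC1 hL A1).
have [X' [cX' mX' XX' mX [H1 H2 H3 H0]]] :=
  solution_increments P B hB gammaa alpha (gammaa `^ 2^-1) eta g sigma ga0 al0 heta cg cs sq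
    x0 X hX.
set c := 4 * _ * _ in H2.
have c0 : 0 <= c.
  by rewrite /c; apply: mulr_ge0; [rewrite mulr_ge0// ito_cst_ge0|rewrite mulr_ge0 ?sqr_ge0].
pose a := rate_fun gammaa alpha.
pose D := d%:R * L; have D0 : 0 <= D by rewrite mulr_ge0.
have L20 : 0 <= L ^+ 2 by exact: sqr_ge0.
have gL := grad_lipschitz_sqr f L hL A1.
have desc := descent f L hC1 hL A1.
have ca := continuous_rate_fun gammaa alpha ga0.
have ap := rate_fun_ge0 gammaa alpha.
have au := rate_fun_ub gammaa alpha ga0 al0.
have ad := rate_fun_le gammaa alpha ga0 al0.
pose v t := Ex P (fun w => f (X' t w)) - f xs.
pose EG t := Ex P (grad_sqr g X' t).
have sqX := sqint_all P f g xs (L ^+ 2) D L20 D0 gL desc hxs cf cg a _ ca ap au ad X' cX' mX'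
  c c0 H1 H2 H3 H0.
have right := flow_right P f g xs (L ^+ 2) D L20 D0 gL desc hxs cf cg a _ ca ap au ad X' cX' mX'
  c c0 H1 H2 H3 H0.
have left := flow_left P f g xs (L ^+ 2) D L20 D0 gL desc hxs cf cg a _ ca ap au ad X' cX' mX'
  c c0 H1 H2 H3 H0.
have offnull t : 0 <= t -> exists N, [/\ measurable N, P N = 0%E &
    forall w, ~ N w -> X t w = X' t w].
  move=> t0; have [N [mN N0 hN]] := XX' t t0; exists N; split => // w Nw.
  by apply: contrapT => h; apply: Nw; exact: hN.
pose m t w := enorm (X' t w - xs) `^ (r2 * r3).
have mm t : measurable_fun setT (m t).
  have -> : m t = (fun x : R => x `^ (r2 * r3)) \o (@Num.sqrt R) \o
      (fun w => enorm (X' t w - xs) ^+ 2).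
    by apply/funext => w; rewrite /= sqrtr_sqr ger0_norm ?enorm_ge0.
  apply: measurableT_comp; last first.
    apply: vmeas_enorm => i; under eq_fun do rewrite !mxE.
    by apply: measurable_funB => //; exact: measurable_cst.
  apply: measurableT_comp; first exact: measurable_powR.
  by apply: continuous_measurable_fun; exact: sqrt_continuous.
have mE t : 0 <= t -> L1 P (m t) /\
    Ex P (m t) <= Cbe * time_shift gammaa t `^ beta * lg gammaa t `^ eps.
  move=> t0; apply: L1_of_le; [exact: mm|by move=> w; exact: powR_ge0|].
  have hm := hmom t t0; rewrite -/(time_shift gammaa t) -/(lg gammaa t) in hm.
  apply: le_trans _ hm; have [N [mN N0 hN]] := offnull t t0.
  rewrite unlock; apply: (le_integral_off_null P N) => //.
  - by move=> w; rewrite lee_fin powR_ge0.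
  - by move=> w; rewrite lee_fin powR_ge0.
  - by move=> w Nw; rewrite hN.
have iG t : 0 <= t -> L1 P (grad_sqr g X' t).
  move=> t0; apply: (L1_G P g xs (L ^+ 2) gL cg X' mX' t); exact: sqX.
have iF t : 0 <= t -> L1 P (fun w => f (X' t w)).
  move=> t0; apply: (L1_fX P f g xs D D0 desc hxs cf X' mX' t); exact: sqX.
(* Exponents [p] and [r3] are conjugate; in terms of [p] the two rates become
   [delta1 = (1 - alpha) / (p - 1) - beta] and
   [delta2 * p = alpha - beta * (p - 1)]. *)
pose p := 2 / r1.
have p1 : 1 < p by rewrite /p ltr_pdivlMr ?mul1r.
have r30 : 0 < r3 by rewrite invr_gt0; lra.
have pq : p^-1 + r3^-1 = 1 by rewrite /p /r3 invrK invf_div subrKC.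
have young s l : 0 <= s -> 0 < l -> tau * v s <= l `^ p / p * EG s +
    l `^ (- r3) / r3 * (Cbe * time_shift gammaa s `^ beta * lg gammaa s `^ eps).
  move=> s0 l0; have [im bm] := mE s s0.
  have i1 := iG s s0; have i2 := iF s s0.
  have lr : 0 <= l `^ (- r3) / r3 by rewrite divr_ge0 ?powR_ge0// ltW.
  apply: (@le_trans _ _ (l `^ p / p * EG s + l `^ (- r3) / r3 * Ex P (m s))); last first.
    by rewrite lerD2l ler_wpM2l.
  rewrite /EG -!ExZ// -ExD; [|exact: L1Z..].
  have -> : tau * v s = Ex P (fun w => tau * (f (X' s w) - f xs)).
    rewrite ExZ; last by apply: L1B => //; exact: L1_cst.
    by rewrite ExB ?Ex_cst//; exact: L1_cst.
  apply: Ex_le.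
  - by apply: L1Z; apply: L1B => //; exact: L1_cst.
  - by apply: L1D; exact: L1Z.
  - move=> w; apply: le_trans (F3 _) _.
    by apply: weighted_young; rewrite ?enorm_ge0.
have d1 : delta <= (1 - alpha) / (p - 1) - beta.
  apply: (@le_trans _ _ delta1); first by rewrite /delta ge_min lexx.
  rewrite /delta1 /p le_eqVlt; apply/orP; left; apply/eqP.
  by field; apply/andP; split; rewrite ?gt_eqF// ?subr_gt0//; lra.
have d2 : delta * p <= alpha - beta * (p - 1).
  have p0 : 0 < p by rewrite (lt_trans ltr01).
  apply: (@le_trans _ _ (delta2 * p)).
    by rewrite ler_pM2r// /delta ge_min lexx orbT.
  rewrite /delta2 /p le_eqVlt; apply/orP; left; apply/eqP.
  by field; rewrite gt_eqF.
have hC0 : 0 <= 2 * D * c by apply: mulr_ge0 => //; exact: mulr_ge0.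
have EG0 s : 0 <= EG s by apply: (Ex_ge0 P) => w; exact: sqr_ge0.
have step s : 0 <= s -> exists2 h : R, 0 < h & exists2 K : R, 0 <= K &
  forall t, s <= t <= s + h -> v t <= v s -
    (t - s) * time_shift gammaa t `^ (- alpha) / 2 * EG s +
    2 * D * c * (time_shift gammaa s `^ (- alpha)) ^+ 2 * (t - s) + K * (t - s) ^+ 2.
  move=> s0; have [h h0 [K K0 hK]] := right s s0; exists h => //; exists K => // t st.
  have t0 : 0 <= t by case/andP: st => st _; exact: le_trans st.
  by have := hK t st; rewrite /a !rate_funE.
have [K K0 hK] := rate_below_barrier gammaa alpha beta eps p r3 tau Cbe (2 * D * c)
  (introT andP (conj ga0 ga1)) p1 r30 pq htau hCbe hC0 heps v EG EG0
  step left young delta d1 d2.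
exists (K * (1 + 2 `^ (- delta))); first by rewrite mulr_ge0// addr_ge0 ?powR_ge0.
move=> T T1; have T0 : 0 < T by exact: lt_le_trans T1.
have [N [mN N0 hN]] := offnull T (ltW T0).
have EE : ('E_P[fun w => f (X T w)] = (Ex P (fun w => f (X' T w)))%:E)%E.
  rewrite EFin_Ex; last by apply: iF; exact: ltW.
  rewrite unlock; apply: ae_eq_integral => //.
  - apply/measurable_EFinP; apply: (measurable_continuous_comp f) => // i.
    by apply: mX; exact: ltW.
  - exact: measurable_int (iF T (ltW T0)).
  - by exists N; split => // w /= h; apply: contrapT => Nw; apply: h => _; rewrite hN.
rewrite EE -EFinB lee_fin; apply: le_trans (hK T (ltW T0)) _.
rewrite /barrier -/(lg gammaa T) ler_wpM2r ?powR_ge0// -mulrA ler_wpM2l//.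
have S1 : T <= time_shift gammaa T by rewrite /time_shift lerDr ltW.
have S2 : time_shift gammaa T <= 2 * T by rewrite /time_shift; lra.
(* The shifted time lies between [T] and [2 * T]; the sign of [delta] decides
   which of the two bounds is relevant, and the constant covers both. *)
rewrite mulrDl mul1r; have [dl|dl] := leP 0 delta.
  rewrite ler_wpDr ?mulr_ge0 ?powR_ge0// !powRN lef_pV2 ?posrE ?powR_gt0 ?(lt_le_trans T0)//.
  by apply: powR_le => //; exact: ltW.
rewrite ler_wpDl ?powR_ge0// -powRM//; last exact: ltW.
by apply: powR_le => //; rewrite ?oppr_ge0; [exact: ltW|rewrite addr_ge0 ?ltW].
Qed.
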